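(* Let $T>0$ and $\varepsilon\in(0,1]$. Let $f^1_\varepsilon,f^2_\varepsilon$ be two measure solutions on $[0,T]$ of $$\partial_t f_\varepsilon+v\,\partial_x f_\varepsilon+E_\varepsilon\,\partial_v f_\varepsilon=0,\qquad E_\varepsilon=-U_\varepsilon',\qquad \varepsilon^2U_\varepsilon''=e^{U_\varepsilon}-\int_{\mathbb{R}}f_\varepsilon\,dv$$ on $\mathbb{T}\times\mathbb{R}$, and assume that $\rho^1_\varepsilon(t,x):=\int f^1_\varepsilon(t,x,v)\,dv$ is bounded in $L^\infty$ on $[0,T]\times\mathbb{T}$. Then, for all $t\in[0,T]$, $$W_1(f^1_\varepsilon(t),f^2_\varepsilon(t))\le\frac1\varepsilon\exp\left(\frac1\varepsilon\left[\left(1+\frac{3}{\varepsilon^2}\right)t+\left(8+\frac1{\varepsilon^2}e^{15/(2\varepsilon^2)}\right)\int_0^t\|\rho^1_\varepsilon(\tau)\|_\infty\,d\tau\right]\right)W_1(f^1_\varepsilon(0),f^2_\varepsilon(0)).$$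
   Context: $\mathbb{T}$ is the one-dimensional torus of length one, identified with $[-1/2,1/2)$ with periodic boundary conditions; the prime denotes $\partial_x$. $\mathcal{P}_1(\mathbb{T}\times\mathbb{R})$ is the set of Borel probability measures on $\mathbb{T}\times\mathbb{R}$ with $\int|v|\,d\mu<\infty$. $W_1(\mu,\nu)=\sup_{\|\varphi\|_{\rm Lip}\le1}\left(\int\varphi\,d\mu-\int\varphi\,d\nu\right)$, where $\|\cdot\|_{\rm Lip}$ is the Lipschitz semi-norm. Measure solution on $[0,T]$: a curve $t\in[0,T]\mapsto f_\varepsilon(t)\in\mathcal{P}_1(\mathbb{T}\times\mathbb{R})$, continuous for $W_1$, such that, with $\rho_\varepsilon(t)$ the $x$-marginal of $f_\varepsilon(t)$, the Vlasov equation holds in the sense of distributions. When $\rho_\varepsilon$ is only a measure, the electric field is understood as $E_\varepsilon=\bar E_\varepsilon+\widehat E_\varepsilon$, where, with $W(x)=\frac{x^2-|x|}{2}$ on $[-1/2,1/2)$ extended periodically, $\bar U_\varepsilon(t,x)=\varepsilon^{-2}\int_{\mathbb{T}}W(x-y)\,\rho_\varepsilon(t,dy)$, $\bar E_\varepsilon(t,x)=-\varepsilon^{-2}\int_{\mathbb{T}}W'(x-y)\,\rho_\varepsilon(t,dy)$ with the convention $W'(0)=0$, $\widehat U_\varepsilon$ is the periodic solution of $\varepsilon^2\widehat U_\varepsilon''=e^{\bar U_\varepsilon+\widehat U_\varepsilon}-1$, $\widehat E_\varepsilon=-\widehat U_\varepsilon'$ and $U_\varepsilon=\bar U_\varepsilon+\widehat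 U_\varepsilon$. *)

(* Defs.v *)
From HB Require Import structures.
From mathcomp Require Import all_boot all_order all_algebra.
From mathcomp Require Import all_classical all_reals all_analysis.

Set Implicit Arguments.
Unset Strict Implicit.
Unset Printing Implicit Defensive.

Import Order.TTheory GRing.Theory Num.Theory.
Import numFieldNormedType.Exports.

Local Open Scope ring_scope.
Local Open Scope classical_set_scope.

(* The torus T of length one is identified with [-1/2, 1/2[: points of T are
   points of this interval, (smooth, Lipschitz) functions on T are 1-periodic
   functions on the real line, and Borel measures on T are Borel measures on
   the real line carried by the interval. *)
Definition torus (R : realType) : set R := `[- 2^-1, 2^-1[%classic.
Arguments torus : clear implicits.

Lemma measurable_torus (R : realType) : measurable (torus R).
Proof. exact: measurable_itv. Qed.
Arguments measurable_torus : clear implicits.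

Definition in_P1 (R : realType) (mu : probability (R * R)%type R) : Prop :=
  mu (torus R `*` [set: R]) = 1%E /\ (\int[mu]_z `|z.2|%:E < +oo)%E.

(* The library's distance on R * R is the sup distance, whence the explicit
   Euclidean one. A 1-periodic function is 1-Lipschitz for it iff it is
   1-Lipschitz on T x R for the quotient distance. *)
Definition euclidean_dist (R : realType) (z w : R * R) : R :=
  Num.sqrt ((z.1 - w.1) ^+ 2 + (z.2 - w.2) ^+ 2).

Definition lip1 (R : realType) : set (R * R -> R) :=
  [set phi : R * R -> R | (forall v, periodic (fun x => phi (x, v)) 1) /\
             (forall z w, `|phi z - phi w| <= euclidean_dist z w)].

Definition W1 (R : realType) (mu nu : probability (R * R)%type R) : \bar R :=
  ereal_sup [set (\int[mu]_z (phi z)%:E - \int[nu]_z (phi z)%:E)%E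
            | phi in @lip1 R].

Definition xproj (R : realType) (z : R * R) : R := z.1.

HB.instance Definition _ (R : realType) :=
  isMeasurableFun.Build _ _ _ _ (@xproj R) measurable_fst.

Definition xmarginal (R : realType) (mu : probability (R * R)%type R) :
  probability R R := distribution mu (@xproj R).

(* The representative of x modulo 1 in [-1/2, 1/2[. *)
Definition torus_repr (R : realType) (x : R) : R := x - (Num.floor (x + 2^-1))%:~R.

Definition W (R : realType) (x : R) : R :=
  (torus_repr x ^+ 2 - `|torus_repr x|) / 2.

(* W is differentiable exactly off the integers. *)
Definition W' (R : realType) (x : R) : R :=
  if torus_repr x == 0 then 0 else derive1 (@W R) x.

Definition Ubar (R : realType) (eps : R) (rho : probability R R) (x : R) : R :=
  eps ^- 2 * \int[rho]_(y in torus R) W (x - y).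

Definition Ebar (R : realType) (eps : R) (rho : probability R R) (x : R) : R :=
  - (eps ^- 2 * \int[rho]_(y in torus R) W' (x - y)).

(* Ubar is continuous, so the solution u is classical (of class C^2); it is
   unique since the exponential is increasing. *)
Definition is_Uhat (R : realType) (eps : R) (rho : probability R R)
    (u : R -> R) : Prop :=
  [/\ periodic u 1,
      forall x, derivable u x 1,
      forall x, derivable (derive1 u) x 1 &
      forall x, eps ^+ 2 * derive1n 2 u x = expR (Ubar eps rho x + u x) - 1].

(* All iterated directional derivatives exist and are differentiable. *)
Definition smooth (R : realType) (V : normedModType R) (phi : V -> R) : Prop :=
  forall (s : seq V) (z : V),
    differentiable (foldr (fun v (g : V -> R) => 'D_v g) phi s) z.

(* C^oo functions of (t, x, v) with compact support in ]0, T[ x T x R. *)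
Definition test_function (R : realType) (T : R) : set (R * R * R -> R) :=
  [set phi : R * R * R -> R | [/\ smooth phi,
      forall t v, periodic (fun x => phi (t, x, v)) 1 &
      exists a b M : R, [/\ 0 < a, b < T &
        forall t x v, phi (t, x, v) != 0 -> a <= t <= b /\ `|v| <= M]]].

Definition vlasov (R : realType) (T : R)
    (f : R -> probability (R * R)%type R) (E : R -> R -> R) : Prop :=
  forall phi : R * R * R -> R, test_function T phi ->
    (\int[lebesgue_measure]_(t in `[0%R, T]) \int[f t]_z
       ('D_(1, 0, 0) phi (t, z.1, z.2) + z.2 * 'D_(0, 1, 0) phi (t, z.1, z.2)
        + E t z.1 * 'D_(0, 0, 1) phi (t, z.1, z.2))%:E = 0)%E.

Definition measure_solution (R : realType) (T eps : R)
    (f : R -> probability (R * R)%type R) : Prop :=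
  [/\ forall t, 0 <= t <= T -> in_P1 (f t),
      forall s, 0 <= s <= T ->
        (fun t => W1 (f t) (f s)) @ within `[0, T] (nbhs s) --> 0%E &
      exists Uhat : R -> R -> R,
        (forall t, 0 <= t <= T ->
           is_Uhat eps (xmarginal (f t)) (Uhat t)) /\
        vlasov T f (fun t x => Ebar eps (xmarginal (f t)) x
                               - derive1 (Uhat t) x)].

Definition is_density (R : realType) (rho : probability R R) (r : R -> R) :
    Prop :=
  measurable_fun (torus R) r /\
  forall A, measurable A -> A `<=` torus R ->
    rho A = (\int[lebesgue_measure]_(x in A) (r x)%:E)%E.

Definition Linfty_norm (R : realType) (r : R -> R) : \bar R :=
  ('N[mrestr lebesgue_measure (measurable_torus R)]_+oo [EFin \o r])%E.

(* The x-marginals of f have densities r bounded in L^oo([0, T] x T). *)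
Definition Linfty_density (R : realType) (T : R)
    (f : R -> probability (R * R)%type R) (r : R -> R -> R) : Prop :=
  exists M : R, {ae @lebesgue_measure R, forall t, 0 <= t <= T ->
    is_density (xmarginal (f t)) (r t) /\ (Linfty_norm (r t) <= M%:E)%E}.

(* Main.v *)
(** By duality it suffices to transport a 1-Lipschitz test function backwards
    over a short time [h].  If [S (x, v) = (x + h v, v + h E1 x)] then [phi o S]
    is [(1 + h (1 + L))]-Lipschitz, with [L] the Lipschitz constant of [E1],
    which is affine in the supremum [r] of the density of [f1]; the replacement
    of [E2] by [E1] costs [h] times the integral of [|E1 - E2|] against [f2].
    For the singular part of the field this integral is at most [2 r W1] up to
    the factor [eps^-2]: if [G] is the difference of the two forces, smoothed by
    Poisson kernels [k] so that [G' = f2 * k - f1 * k], then [G |G| / 2] is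
    periodic, whence the integrals of [|G|] against [f1 * k] and [f2 * k]
    coincide, and the former is at most [r] times the [L^1] norm of [G], itself
    bounded by [2 W1].  The maximum principle controls the Boltzmann part.
    Since the Vlasov equation is only tested on smooth compactly supported
    functions, [phi] is truncated in [v] and mollified by a Poisson kernel in
    [x] and a bump in [v].  Iterating over a fine partition of time gives a
    Gronwall inequality whose constants are smaller than the stated ones. *)
Require Import Defs.
From HB Require Import structures.
From mathcomp Require Import all_boot all_order all_algebra.
From mathcomp Require Import all_classical all_reals all_analysis.
From mathcomp Require Import measurable_realfun ess_sup_inf ring lra.
Import Order.TTheory GRing.Theory Num.Theory.
Import numFieldNormedType.Exports.

Local Open Scope ring_scope.
Local Open Scope classical_set_scope.

Set Implicit Arguments.
Unset Strict Implicit.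
Unset Printing Implicit Defensive.

(** * Bounded smooth functions *)

Section smooth_bounded.
Context {R : realType}.
Implicit Types (f g : R -> R) (n k : nat).

(** Only [f1] has a bounded density: [E2] may jump wherever [f2] charges a line [x = const], so no
    flow is available for [f2]. Duality moves functions along the field of [f1] alone, and the field
    of [f2] enters only through an integral against [f2]. As atoms count in that integral, the
    smoothing of [W'] must converge at every point, with value 0 at integers. The Poisson kernel
    gives it in closed form: an arctangent, odd, and equal to the identity minus a nondecreasing
    function. Time raises two more obstacles. The Lipschitz constant of [E1] is merely measurable in
    time, whereas each step freezes the field at one instant: [good_time] picks one where the
    density exceeds its mean by at most a small slack, and continuity of [E1] in time, uniform in
    [x], pays for the freezing. The densities exist only for almost every time, and their norms need
    not be measurable in time: [sup_density], a countable supremum of smoothed densities, replaces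
    them. Its floor 1 is harmless, since a probability density on a torus of length one has norm at
    least 1; this lets [t] be absorbed into the integral of the norm. *)

Fixpoint Cb n f : Prop :=
  (exists C, forall x, `|f x| <= C) /\
  if n is m.+1 then
    exists df, (forall x, is_derive x (1 : R) f (df x)) /\ Cb m df
  else True.

(** Uniform bounds at every order make Taylor remainders uniform, so that they can be integrated;
    carrying derivatives as witnesses reduces the closure lemmas to inductions on the order. *)
Definition bsmooth f := forall n, Cb n f.

Lemma CbS n f : Cb n.+1 f -> Cb n f.
Proof.
elim: n f => [|n ih] f [bf [df [h1 h2]]]; first by split.
by split => //; exists df; split => //; apply: ih.
Qed.

Lemma Cb_bounded n f : Cb n f -> exists C, forall x, `|f x| <= C.
Proof. by case: n => [|n] []. Qed.

Lemma Cb_cst n (c : R) : Cb n (fun=> c).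
Proof.
elim: n c => [|n ih] c; split=> //; try by exists `|c|.
by exists (fun=> 0); split; [move=> x; exact: is_derive_cst|exact: ih].
Qed.

Lemma CbD n f g : Cb n f -> Cb n g -> Cb n (fun x => f x + g x).
Proof.
elim: n f g => [|n ih] f g [[C hC] hf] [[C' hC'] hg].
  split=> //; exists (C + C') => x.
  by rewrite (le_trans (ler_normD _ _))// lerD.
split.
  exists (C + C') => x; by rewrite (le_trans (ler_normD _ _))// lerD.
case: hf hg => [df [h1 h2]] [dg [h3 h4]].
exists (fun x => df x + dg x); split; last exact: ih.
by move=> x; apply: is_deriveD.
Qed.

Lemma CbM n f g : Cb n f -> Cb n g -> Cb n (fun x => f x * g x).
Proof.
elim: n f g => [|n ih] f g hf hg.
  case: hf hg => [[C hC] hf] [[C' hC'] hg].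
  split=> //; exists (C * C') => x.
  by rewrite normrM ler_pM.
have hf' := CbS hf; have hg' := CbS hg.
case: hf hg => [[C hC] hf] [[C' hC'] hg].
split.
  by exists (C * C') => x; rewrite normrM ler_pM.
case: hf hg => [df [h1 h2]] [dg [h3 h4]].
exists (fun x => df x * g x + f x * dg x); split.
  move=> x; apply: is_derive_eq (is_deriveM (h1 x) (h3 x)) _.
  by rewrite /GRing.scale/= addrC mulrC.
by apply: CbD; apply: ih.
Qed.

Lemma CbZ n (c : R) f : Cb n f -> Cb n (fun x => c * f x).
Proof. by move=> hf; apply: CbM => //; exact: Cb_cst. Qed.

Lemma Cb_affine n f (c d : R) : Cb n f -> Cb n (fun x => f (c * x + d)).
Proof.
elim: n f => [|n ih] f [[C hC] hf]; split => //; try by exists C.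
case: hf => [df [h1 h2]].
exists (fun x => c * df (c * x + d)); split; last first.
  by apply: CbZ; apply: ih.
move=> x.
have h : is_derive x (1 : R) (fun y => c * y + d) c.
  apply: (is_derive_eq (is_deriveD (is_deriveZ c (is_derive_id x 1))
    (is_derive_cst d x 1))).
  by rewrite addr0 /GRing.scale/= mulr1.
have := @is_derive1_comp _ f _ x _ _ (h1 _) h.
by rewrite mulrC.
Qed.

Lemma Cb_inv n f (m : R) : 0 < m -> (forall x, m <= f x) -> Cb n f ->
  Cb n (fun x => (f x)^-1).
Proof.
move=> m0 fm; have f0 x : 0 < f x by apply: lt_le_trans (fm x).
have B : exists C, forall x, `|(f x)^-1| <= C.
  exists m^-1 => x; rewrite gtr0_norm ?invr_gt0//.
  by rewrite lef_pV2 ?posrE.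
elim: n => [|n ih] hf; split => //.
have hf' := ih (CbS hf).
case: hf => [_ [df [h1 h2]]].
exists (fun x => (-1) * (df x * ((f x)^-1 * (f x)^-1))); split.
  move=> x; apply: is_derive_eq.
    by apply: is_deriveV => //; rewrite gt_eqF.
  by rewrite /GRing.scale/= mulN1r mulNr expr2 invfM mulrC.
by apply: CbZ; apply: CbM => //; apply: CbM.
Qed.

(** General coefficients, because differentiation sends the pair [(a, b)] to another one: the
    statement is stable under the induction. *)
Lemma Cb_trig n (a b : R) :
  Cb n (fun x => a * cos (2 * pi * x) + b * sin (2 * pi * x)).
Proof.
have B a' b' : exists C, forall x : R,
    `|a' * cos (2 * pi * x) + b' * sin (2 * pi * x)| <= C.
  exists (`|a'| + `|b'|) => x; rewrite (le_trans (ler_normD _ _))//.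
  rewrite !normrM lerD// ler_piMr//.
    by rewrite ler_norml cos_geN1 cos_le1.
  by rewrite ler_norml sin_geN1 sin_le1.
elim: n a b => [|n ih] a b; split => //.
exists (fun x => (b * (2 * pi)) * cos (2 * pi * x) +
   (- (a * (2 * pi))) * sin (2 * pi * x)); split => // x.
have h : is_derive x (1 : R) (fun y => 2 * pi * y) (2 * pi).
  apply: (is_derive_eq (is_deriveZ (2 * pi) (is_derive_id x 1))).
  by rewrite /GRing.scale/= mulr1.
have hc := @is_derive1_comp _ cos _ x _ _ (is_derive_cos _) h.
have hs := @is_derive1_comp _ sin _ x _ _ (is_derive_sin _) h.
apply: (is_derive_eq (is_deriveD (is_deriveZ a hc) (is_deriveZ b hs))).
by rewrite /GRing.scale/=; ring.
Qed.

Lemma bsmooth_derive f : bsmooth f ->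
  exists df, (forall x, is_derive x (1 : R) f (df x)) /\ bsmooth df.
Proof.
move=> hf; have [_ [df [h1 h2]]] := hf 1%N; exists df; split => // n.
have [_ [df' [h1' h2']]] := hf n.+1.
suff -> : df = df' by [].
apply/funext => x.
have := h1 x; have := h1' x => /@derive_val <- /@derive_val <-//.
Qed.

End smooth_bounded.

(** * Derivatives from quadratic remainders *)

Section quadratic_remainder.
Context {R : realType}.

(** A quadratic remainder survives integration in a parameter, so this criterion replaces theorems
    on differentiation under the integral sign. It also handles points where a formula changes, such
    as the origin for [flat]. *)
Lemma is_derive_quad (V : normedModType R) (f : V -> R) (a v : V) (d C : R) :
  (forall h : R, `|h| <= 1 -> `|f (h *: v + a) - f a - h * d| <= C * h ^+ 2) ->
  is_derive a v f d.
Proof.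
move=> H.
suff L : h^-1 *: (f (h *: v + a) - f a) @[h --> (0:R)^'] --> d.
  apply: DeriveDef; first by apply/cvg_ex; exists d.
  exact/cvg_lim.
apply/cvgrPdist_le => /= e e0.
have C0 : 0 <= C.
  have := H 1; rewrite normr1 lexx => /(_ isT); rewrite expr1n mulr1.
  exact: le_trans.
near=> h.
have h0 : h != 0 by near: h; exact: nbhs_dnbhs_neq.
have h1 : `|h| <= 1.
  near: h; apply/nbhs_dnbhs/nbhs_ballP; exists 1 => //= y.
  by rewrite /ball/= sub0r normrN => /ltW.
have he : `|h| <= e / (C + 1).
  near: h; apply/nbhs_dnbhs/nbhs_ballP.
  exists (e / (C + 1)) => /=; first by rewrite divr_gt0// ltr_wpDl.
  by move=> y; rewrite /ball/= sub0r normrN => /ltW.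
rewrite distrC -[X in `|_ - X|](mulKf h0) /GRing.scale/= -mulrBr normrM normfV.
rewrite ler_pdivrMl ?normr_gt0// (le_trans (H h h1))//.
rewrite -real_normK ?num_real// expr2 mulrA mulrC ler_wpM2l//.
rewrite (le_trans (ler_wpM2l C0 he))// mulrA ler_pdivrMr ?ltr_wpDl//.
by rewrite mulrDr mulr1 mulrC lerDl ltW.
Unshelve. all: by end_near. Qed.

Lemma derive_continuous (f df : R -> R) :
  (forall x, is_derive x (1 : R) f (df x)) -> continuous f.
Proof.
move=> h x; apply: differentiable_continuous; apply/derivable1_diffP.
exact: (@ex_derive _ _ _ _ _ _ _ (h x)).
Qed.

Lemma MVT_line (f df : R -> R) (x y : R) :
  (forall z, is_derive z (1 : R) f (df z)) ->
  exists2 c, `|c - x| <= `|y - x| & f y - f x = df c * (y - x).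
Proof.
move=> h; have cf := derive_continuous h.
have [xy|yx] := leP x y.
  have [|c + E] := MVT_segment xy (fun z _ => h z).
    exact: continuous_subspaceT.
  rewrite in_itv/= => /andP[c1 c2]; exists c => //.
  by rewrite !ger0_norm ?subr_ge0 ?lerD2r.
have [|c + E] := MVT_segment (ltW yx) (fun z _ => h z).
  exact: continuous_subspaceT.
rewrite in_itv/= => /andP[c1 c2]; exists c.
  by rewrite distrC (distrC y) !ger0_norm ?subr_ge0 ?(ltW yx)// lerD2l lerN2.
by rewrite -(opprB (f x)) E -mulrN opprB.
Qed.

Lemma derive_bound_lipschitz (f df : R -> R) (C : R) :
  (forall z, is_derive z (1 : R) f (df z)) -> (forall z, `|df z| <= C) ->
  forall x y, `|f x - f y| <= C * `|x - y|.
Proof.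
move=> h hC x y; have [c _ ->] := MVT_line y x h.
by rewrite normrM ler_wpM2r.
Qed.

Lemma taylor1 (f df : R -> R) (C : R) :
  (forall z, is_derive z (1 : R) f (df z)) ->
  (forall x y, `|df x - df y| <= C * `|x - y|) ->
  forall x h, `|f (x + h) - f x - h * df x| <= C * h ^+ 2.
Proof.
move=> h1 hC x h.
have [c + E] := MVT_line x (x + h) h1.
rewrite [x + h - x]addrAC subrr add0r in E *.
move=> ch; rewrite E mulrC -mulrBr normrM (le_trans (ler_wpM2l _ (hC _ _)))//.
rewrite -(real_normK (num_real h)) expr2.
have C0 : 0 <= C.
  by have := hC 1 0; rewrite subr0 normr1 mulr1; exact: le_trans.
by rewrite mulrCA ler_wpM2l// ler_wpM2l.
Qed.

Lemma bsmooth_taylor (f df : R -> R) : bsmooth f ->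
  (forall z, is_derive z (1 : R) f (df z)) ->
  exists C, forall x h, `|f (x + h) - f x - h * df x| <= C * h ^+ 2.
Proof.
move=> bf hf; have [df' [h1 /(_ 1%N)]] := bsmooth_derive bf.
have -> : df' = df.
  by apply/funext => x; have := h1 x; have := hf x => /@derive_val <- /@derive_val <-.
case=> _ [ddf [h2 [[C hC] _]]].
exists C; apply: taylor1 => // x y; exact: derive_bound_lipschitz hC _ _.
Qed.

End quadratic_remainder.

(** * Smooth functions flat at the origin *)

Section bump.
Context {R : realType}.
Implicit Types (n k : nat) (x : R).

(** The powers of [1 / x] in front of [e^(-1/x)] make the family stable under differentiation, so
    that one induction over all [k] proves smoothness. *)
Definition flat k x : R := if 0 < x then x^-1 ^+ k * expR (- x^-1) else 0.

Lemma flat_ge0 k x : 0 <= flat k x.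
Proof.
rewrite /flat; case: ifP => // x0.
by rewrite mulr_ge0 ?expR_ge0 ?exprn_ge0 ?invr_ge0 ?ltW.
Qed.

Lemma flat_le_fact k x : flat k x <= k`!%:R.
Proof.
rewrite /flat; case: ifP => // x0; rewrite expRN ler_pdivrMr ?expR_gt0//.
have y0 : 0 <= x^-1 by rewrite invr_ge0 ltW.
case: k => [|k]; first by rewrite expr0 fact0 mul1r (le_trans _ (expR_ge1Dx _))// lerDl.
rewrite mulrC -ler_pdivrMr ?ltr0n ?fact_gt0//.
apply: le_trans (expR_ge1Dxn k y0); by rewrite lerDr.
Qed.

(** Used at the origin: as [flat k.+2] is bounded, [flat k] is quadratically small there, whence a
    zero derivative. *)
Lemma flat_sqr k x : flat k x = x ^+ 2 * flat k.+2 x.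
Proof.
rewrite /flat; case: ifP => x0; last by rewrite mulr0.
by rewrite mulrA !exprS; field; rewrite gt_eqF.
Qed.

Lemma is_derive_flat k x :
  is_derive x (1 : R) (flat k) (flat k.+2 x - k%:R * flat k.+1 x).
Proof.
have [x0|x0|->] := ltgtP x 0.
- have -> : flat k.+2 x - k%:R * flat k.+1 x = 0.
    by rewrite /flat ltNge (ltW x0)/= mulr0 subrr.
  apply: (@near_eq_is_derive _ _ _ (fun=> 0)) (is_derive_cst _ _ _).
  near=> y; rewrite /flat ltNge (_ : y <= 0)//.
  by apply: ltW; near: y; exact: lt_nbhsl.
- have x1 : x != 0 by rewrite gt_eqF.
  have h1 := is_deriveV x1 (is_derive_id x (1 : R)).
  have h2 := is_deriveX k h1.
  have h3 := @is_derive1_comp _ (@expR R) _ x _ _ (is_derive_expR _)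
    (is_deriveN h1).
  apply: (near_eq_is_derive _ (is_derive_eq (is_deriveM h2 h3) _)).
    near=> y; rewrite /flat (_ : 0 < y) ?exprfctE//.
    by near: y; exact: lt_nbhsr.
  rewrite exprfctE /flat x0 /GRing.scale/= -mulr_natl.
  case: (k) => [|m]; first by rewrite /= !exprS; field.
  by rewrite /= !exprS; field.
- apply: (@is_derive_quad _ _ _ _ _ _ (k.+2`!%:R)) => h _.
  rewrite /GRing.scale/= mulr1 addr0 {2 3 4}/flat ltxx !mulr0 !subr0 mulr0 subr0.
  rewrite flat_sqr normrM ger0_norm ?sqr_ge0// mulrC ler_wpM2r ?sqr_ge0//.
  by rewrite ger0_norm ?flat_ge0// flat_le_fact.
Unshelve. all: by end_near. Qed.

Lemma bsmooth_flat k : bsmooth (flat k).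
Proof.
move=> n; elim: n k => [|n ih] k.
  by split=> //; exists k`!%:R => x; rewrite ger0_norm ?flat_ge0// flat_le_fact.
split.
  by exists k`!%:R => x; rewrite ger0_norm ?flat_ge0// flat_le_fact.
exists (fun x => flat k.+2 x + (- k%:R) * flat k.+1 x); split.
  by move=> x; rewrite mulNr; exact: is_derive_flat.
by apply: CbD => //; apply: CbZ.
Qed.

End bump.

(** * Integrals of bounded functions *)

Section real_integrable.
Context d (T : measurableType d) (R : realType).
Variables (mu : {measure set T -> \bar R}) (D : set T).
Hypothesis mD : measurable D.
Implicit Types f g : T -> R.

Lemma integrable_add f g : mu.-integrable D (EFin \o f) ->
  mu.-integrable D (EFin \o g) -> mu.-integrable D (EFin \o (fun x => f x + g x)).
Proof. by move=> fi gi; have := integrableD mD fi gi; apply: eq_integrable. Qed.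

Lemma integrable_sub f g : mu.-integrable D (EFin \o f) ->
  mu.-integrable D (EFin \o g) -> mu.-integrable D (EFin \o (fun x => f x - g x)).
Proof. by move=> fi gi; have := integrableB mD fi gi; apply: eq_integrable. Qed.

Lemma integrable_scale f (c : R) : mu.-integrable D (EFin \o f) ->
  mu.-integrable D (EFin \o (fun x => c * f x)).
Proof. by move=> fi; have := integrableZl mD c fi; apply: eq_integrable. Qed.

End real_integrable.

Section bounded_integrals.
Context d (T : measurableType d) (R : realType).
Variables (mu : {measure set T -> \bar R}) (D : set T).
Hypotheses (mD : measurable D) (finD : (mu D < +oo)%E).
Implicit Types (f g : T -> R) (C : R).

Lemma bounded_integrable f C : measurable_fun D f ->
  (forall x, D x -> `|f x| <= C) -> mu.-integrable D (EFin \o f).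
Proof.
move=> mf fC; apply: measurable_bounded_integrable => //.
exists C; split; first exact: num_real.
by move=> M CM x Dx; exact: le_trans (fC x Dx) (ltW CM).
Qed.

Lemma Rintegral_norm_le f C : measurable_fun D f ->
  (forall x, D x -> `|f x| <= C) ->
  `|\int[mu]_(x in D) f x| <= C * fine (mu D).
Proof.
move=> mf fC; have fi := bounded_integrable mf fC.
rewrite (le_trans (le_normr_Rintegral mD fi))// -Rintegral_cst//.
apply: le_Rintegral => //; first exact: integrable_norm.
exact: (@bounded_integrable (cst C) `|C|).
Qed.

Lemma Rintegral_cvg (f_ : nat -> T -> R) f C :
  (forall n, measurable_fun D (f_ n)) -> measurable_fun D f ->
  (forall n x, D x -> `|f_ n x| <= C) ->
  (forall x, D x -> f_ n x @[n --> \oo] --> f x) ->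
  \int[mu]_(x in D) f_ n x @[n --> \oo] --> \int[mu]_(x in D) f x.
Proof.
move=> mf_ mf bf cf.
have bC : mu.-integrable D (EFin \o cst C).
  exact: (@bounded_integrable _ `|C|).
have [] := @dominated_convergence _ _ _ mu _ mD (fun n => EFin \o f_ n)
  (EFin \o f) (EFin \o cst C).
- by move=> n; exact/measurable_EFinP.
- exact/measurable_EFinP.
- by apply: aeW => x Dx; apply: cvg_EFin; [exact: nearW|exact: cf].
- exact: bC.
- by apply: aeW => x n Dx /=; rewrite lee_fin bf.
move=> fi _ h; apply: (@fine_cvg _ _ _ _ (fun n => \int[mu]_(x in D) (f_ n x)%:E)%E).
by rewrite fineK //; exact: integrable_fin_num.
Qed.

End bounded_integrals.

Section bounded_fubini.
Context d1 d2 (T1 : measurableType d1) (T2 : measurableType d2) (R : realType).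
Variable m1 : {sigma_finite_measure set T1 -> \bar R}.
Variable m2 : {sigma_finite_measure set T2 -> \bar R}.
Variables (D1 : set T1) (D2 : set T2).
Hypotheses (mD1 : measurable D1) (mD2 : measurable D2).
Hypotheses (fin1 : (m1 D1 < +oo)%E) (fin2 : (m2 D2 < +oo)%E).
Variables (F : T1 * T2 -> R) (C : R).
Hypotheses (mF : measurable_fun setT F) (FC : forall z, `|F z| <= C).

Let mDD : measurable (D1 `*` D2). Proof. exact: measurableX. Qed.

Lemma product_measureX_lty : ((m1 \x m2)%E (D1 `*` D2) < +oo)%E.
Proof. by rewrite product_measure1E// lte_mul_pinfty// ge0_fin_numE. Qed.

(** Extension by zero turns integrals over rectangles into integrals over the whole product, where
    Fubini's theorem applies. *)
Let FD := F \_ (D1 `*` D2).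

Let iFD : (m1 \x m2)%E.-integrable setT (EFin \o FD).
Proof.
rewrite /FD -restrict_EFin; apply/integrable_restrict => //.
rewrite setTI; apply: (@bounded_integrable _ _ _ _ _ _ _ _ C) => //.
  exact: product_measureX_lty.
exact: measurable_funTS.
Qed.

Let inner1 x : \int[m2]_y FD (x, y) = ((fun x => \int[m2]_(y in D2) F (x, y)) \_ D1) x.
Proof.
rewrite patchE; case: ifPn => [xD|xD].
  rewrite [RHS]Rintegral_mkcond; apply: eq_Rintegral => y _.
  by rewrite /FD !patchE in_setX xD.
transitivity (\int[m2]_(y in setT) (0 : R)).
  by apply: eq_Rintegral => y _; rewrite /FD patchE in_setX (negbTE xD).
by rewrite Rintegral_cst// mul0r.
Qed.

Let fin_inner1 x : (\int[m2]_y (FD (x, y))%:E)%E = (\int[m2]_y FD (x, y))%:E.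
Proof.
rewrite fineK//; apply: integrable_fin_num => //.
pose g y := if x \in D1 then F (x, y) else 0.
suff -> : (fun y => (FD (x, y))%:E) = EFin \o (g \_ D2).
  rewrite -restrict_EFin; apply/integrable_restrict => //.
  rewrite setTI; apply: (@bounded_integrable _ _ _ _ _ _ _ g `|C|) => //.
    rewrite /g; case: (x \in D1); last exact: measurable_cst.
    apply: measurable_funTS; exact: measurableT_comp (measurable_pair1 _).
  move=> y _; rewrite /g; case: ifP => _; last by rewrite normr0.
  exact: le_trans (FC _) (ler_norm _).
apply/funext => y; rewrite /= /FD /g !patchE in_setX.
by case: (x \in D1) => /=; case: (y \in D2).
Qed.

Lemma Rintegral_prod12 :
  \int[(m1 \x m2)%E]_(z in D1 `*` D2) F z =
  \int[m1]_(x in D1) \int[m2]_(y in D2) F (x, y).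
Proof.
rewrite Rintegral_mkcond [RHS]Rintegral_mkcond; congr fine.
rewrite -integral12_prod_meas1//; apply: eq_integral => x _.
by rewrite /fubini_F/= fin_inner1 inner1.
Qed.

Let inner2 y : \int[m1]_x FD (x, y) = ((fun y => \int[m1]_(x in D1) F (x, y)) \_ D2) y.
Proof.
rewrite patchE; case: ifPn => [yD|yD].
  rewrite [RHS]Rintegral_mkcond; apply: eq_Rintegral => x _.
  by rewrite /FD !patchE in_setX yD andbT.
transitivity (\int[m1]_(y in setT) (0 : R)).
  by apply: eq_Rintegral => x _; rewrite /FD patchE in_setX (negbTE yD) andbF.
by rewrite Rintegral_cst// mul0r.
Qed.

Let fin_inner2 y : (\int[m1]_x (FD (x, y))%:E)%E = (\int[m1]_x FD (x, y))%:E.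
Proof.
rewrite fineK//; apply: integrable_fin_num => //.
pose g x := if y \in D2 then F (x, y) else 0.
suff -> : (fun x => (FD (x, y))%:E) = EFin \o (g \_ D1).
  rewrite -restrict_EFin; apply/integrable_restrict => //.
  rewrite setTI; apply: (@bounded_integrable _ _ _ _ _ _ _ g `|C|) => //.
    rewrite /g; case: (y \in D2); last exact: measurable_cst.
    apply: measurable_funTS; exact: measurableT_comp (measurable_pair2 _).
  move=> x _; rewrite /g; case: ifP => _; last by rewrite normr0.
  exact: le_trans (FC _) (ler_norm _).
apply/funext => x; rewrite /= /FD /g !patchE in_setX.
by case: (x \in D1) => /=; case: (y \in D2).
Qed.

Lemma Rintegral_Fubini :
  \int[m1]_(x in D1) \int[m2]_(y in D2) F (x, y) =
  \int[m2]_(y in D2) \int[m1]_(x in D1) F (x, y).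
Proof.
rewrite -Rintegral_prod12 Rintegral_mkcond [RHS]Rintegral_mkcond; congr fine.
rewrite -integral21_prod_meas1//; apply: eq_integral => y _.
by rewrite /fubini_G/= fin_inner2 inner2.
Qed.

Lemma measurable_Rintegral21 :
  measurable_fun D2 (fun y => \int[m1]_(x in D1) F (x, y)).
Proof.
apply/(measurable_restrictT _ mD2).
rewrite (_ : _ \_ _ = (fun y => \int[m1]_x FD (x, y))); last first.
  by apply/funext => y; rewrite inner2.
apply/measurable_EFinP.
have := measurable_fubini_G iFD; apply: eq_measurable_fun => y _.
by rewrite /fubini_G/= fin_inner2.
Qed.

End bounded_fubini.

(** * Translation invariance on the line and on the torus *)

Section translation.
Context {R : realType}.
Local Notation leb := (@lebesgue_measure R).

Let addr_measurable (a : R) :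
  measurable_fun setT (fun x : measurableTypeR R => (x + a : measurableTypeR R)).
Proof. exact: measurable_funD. Qed.

Lemma lebesgue_measure_translation (a : R) (A : set R) : measurable A ->
  pushforward leb (fun x : measurableTypeR R => (x + a : measurableTypeR R)) A =
  leb A.
Proof.
move=> mA; apply/esym.
have @mu : {measure set (measurableTypeR R) -> \bar R}.
  pose f : {mfun measurableTypeR R >-> measurableTypeR R} :=
    mfun_Sub (mem_set (addr_measurable a)).
  exact: (pushforward leb f).
apply: (lebesgue_measure_unique (mu := mu)) => //= _ [[u v]] _ <-.
rewrite /mu /pushforward/=.
rewrite (_ : _ @^-1` _ = `]u - a, v - a]%classic).
  rewrite !lebesgue_measure_itv/= !lte_fin ltrD2r -!EFinB.
  by have -> : v - a - (u - a) = v - u by ring.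
by apply/seteqP; split => x/=; rewrite !in_itv/= ltrBlDr lerBrDr.
Qed.

Lemma Rintegral_translation (f : R -> R) (a : R) (D : set R) (C : R) :
  measurable D -> measurable_fun setT f -> (forall x, `|f x| <= C) ->
  (leb D < +oo)%E ->
  \int[leb]_(x in (fun x => x + a) @^-1` D) f (x + a) = \int[leb]_(x in D) f x.
Proof.
move=> mD mf fC finD; congr fine.
have mpre : measurable ((fun x : R => x + a) @^-1` D).
  by rewrite -[X in measurable X]setTI; exact: addr_measurable.
have iF : leb.-integrable ((fun x : R => x + a) @^-1` D)
    (EFin \o (fun x => f (x + a))).
  apply: (@bounded_integrable _ _ _ _ _ _ _ _ C) => //.
    by move: (finD); rewrite -{1}(lebesgue_measure_translation a mD).
  by apply: measurable_funTS; exact: measurableT_comp mf (addr_measurable a).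
rewrite -(@integral_pushforward _ _ _ _ _ _ (addr_measurable a) leb D (EFin \o f))//.
- apply: eq_measure_integral => A mA _.
  exact: lebesgue_measure_translation.
- exact/measurable_EFinP.
Qed.

Lemma Rintegral_itv_translation (f : R -> R) (a u v C : R) :
  measurable_fun setT f -> (forall x, `|f x| <= C) ->
  \int[leb]_(x in `[u, v[) f (x + a) = \int[leb]_(x in `[u + a, v + a[) f x.
Proof.
move=> mf fC; rewrite -(@Rintegral_translation f a _ C)//.
  congr Rintegral; apply/seteqP; split => x /=; rewrite !in_itv/= lerD2r ltrD2r//.
by rewrite lebesgue_measure_itv/=; case: ifP => _; rewrite ltry.
Qed.

(** Periodicity reduces [a] to its fractional part [b]; the piece of the shifted interval beyond
    [1/2] is then moved back by one period. *)
Lemma torus_translation (f : R -> R) (a C : R) :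
  measurable_fun setT f -> (forall x, `|f x| <= C) -> periodic f 1 ->
  \int[leb]_(x in torus R) f (x + a) = \int[leb]_(x in torus R) f x.
Proof.
move=> mf fC pf.
have pfn (n : nat) x : f (x + n%:R) = f x by rewrite (periodicn pf).
have pfz (n : int) x : f (x + n%:~R) = f x.
  case: n => n; first exact: pfn.
  by rewrite -(pfn n.+1) NegzE mulrNz subrK.
pose b := a - (Num.floor a)%:~R.
have /andP[b0 b1] : 0 <= b < 1.
  have /andP[] := floor_itv a; rewrite intrD1 => h1 h2.
  by rewrite subr_ge0 h1/= ltrBlDr addrC.
transitivity (\int[leb]_(x in torus R) f (x + b)).
  apply: eq_Rintegral => x _.
  by rewrite /b -[LHS](pfz (- Num.floor a)) mulrNz addrA.
have finI u v : (leb `[u, v[ < +oo)%E.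
  by rewrite lebesgue_measure_itv/=; case: ifP => _; rewrite ltry.
have iI u v : leb.-integrable `[u, v[ (EFin \o f).
  apply: (@bounded_integrable _ _ _ leb _ (measurable_itv _) (finI u v) f C) => //.
  exact: measurable_funTS.
rewrite /torus (@Rintegral_itv_translation f b _ _ C)//.
have split u v w : u <= v -> v <= w ->
    \int[leb]_(x in `[u, w[) f x =
    \int[leb]_(x in `[u, v[) f x + \int[leb]_(x in `[v, w[) f x.
  move=> uv vw; have E : `[u, w[%classic = `[u, v[ `|` `[v, w[.
    by rewrite -itv_bndbnd_setU// bnd_simp.
  rewrite E Rintegral_setU -?E//.
  by apply/disj_setPS => x/= [] /=; rewrite !in_itv/= => /andP[_ +] /andP[+ _]; lra.
rewrite (split (- 2^-1 + b) (2^-1)); [|lra|lra].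
rewrite (split (- 2^-1) (- 2^-1 + b) (2^-1)); [|lra|lra].
rewrite addrC; congr (_ + _).
rewrite -[X in `[X, _[](_ : - 2^-1 + 1 = 2^-1); last lra.
rewrite [X in `[_, X[](_ : 2^-1 + b = (- 2^-1 + b) + 1); last lra.
rewrite -(@Rintegral_itv_translation f 1 _ _ C)//.
by apply: eq_Rintegral => x _; rewrite pf.
Qed.

End translation.

(** * The Wasserstein distance *)

Section euclid.
Context {R : realType}.
Implicit Types z w : R * R.

Lemma euclidean_dist_ge1 z w : `|z.1 - w.1| <= euclidean_dist z w.
Proof.
by rewrite /euclidean_dist -sqrtr_sqr ler_wsqrtr// lerDl sqr_ge0.
Qed.

Lemma euclidean_dist_ge2 z w : `|z.2 - w.2| <= euclidean_dist z w.
Proof.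
by rewrite /euclidean_dist -sqrtr_sqr ler_wsqrtr// lerDr sqr_ge0.
Qed.

Lemma euclidean_dist_ge0 z w : 0 <= euclidean_dist z w.
Proof. exact: sqrtr_ge0. Qed.

Lemma euclidean_dist_le z w (a b c : R) : 0 <= c ->
  `|z.1 - w.1| <= a -> `|z.2 - w.2| <= b -> a ^+ 2 + b ^+ 2 <= c ^+ 2 ->
  euclidean_dist z w <= c.
Proof.
move=> c0 za wb abc; rewrite /euclidean_dist -(ger0_norm c0) -sqrtr_sqr.
apply/ler_wsqrtr/(le_trans _ abc)/lerD.
  by rewrite -(real_normK (num_real (z.1 - w.1))) lerXn2r ?nnegrE// (le_trans _ za).
by rewrite -(real_normK (num_real (z.2 - w.2))) lerXn2r ?nnegrE// (le_trans _ wb).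
Qed.

Lemma euclidean_dist_le_sum z w :
  euclidean_dist z w <= `|z.1 - w.1| + `|z.2 - w.2|.
Proof.
apply: (@euclidean_dist_le _ _ `|z.1 - w.1| `|z.2 - w.2|) => //.
by rewrite sqrrD lerD2r lerDl mulrn_wge0// mulr_ge0.
Qed.

(** [phi] is the infimum of the cones [h k] with vertices at the rational points: a countable family
    of functions measurable for the product sigma-algebra. *)
Lemma lipschitz_measurable (phi : R * R -> R) (L : R) :
  (forall z w, `|phi z - phi w| <= L * (`|z.1 - w.1| + `|z.2 - w.2|)) ->
  measurable_fun setT phi.
Proof.
move=> H.
have L0 : 0 <= L.
  have := H (1, 0) (0, 0); rewrite /= subrr normr0 addr0 subr0 normr1 mulr1.
  exact: le_trans.
pose q k : R * R := if @unpickle (rat * rat)%type k is Some ab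
  then (ratr ab.1, ratr ab.2) else (0, 0).
pose h k z := phi (q k) + L * (`|z.1 - (q k).1| + `|z.2 - (q k).2|).
have hge k z : phi z <= h k z.
  by rewrite -lerBlDl (le_trans (ler_norm _))// (le_trans (H _ _)).
have lb z : has_lbound (range (h ^~ z)).
  by exists (phi z) => _ [k _ <-]; exact: hge.
have mh k : measurable_fun setT (h k).
  apply: measurable_funD => //; apply: measurable_funM => //.
  apply: measurable_funD; apply: measurableT_comp => //;
    apply: measurable_funB => //.
suff -> : phi = fun z => infs (h ^~ z) 0%N by exact: measurable_fun_infs.
apply/funext => z; rewrite /infs/=.
have S0 : sdrop (h ^~ z) 0%N !=set0 by exists (h 0%N z), 0%N.
apply/le_anti/andP; split.
  by apply: lb_le_inf => // _ [k _ <-]; exact: hge.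
apply/ler_addgt0Pr => e e0.
(* Two errors of size [2 * L * d] arise: the cone over its vertex value, and that value against
   [phi z]. *)
pose d := e / (4 * (L + 1)).
have d0 : 0 < d by rewrite divr_gt0// mulr_gt0// ltr_wpDl.
have [a /=] := @rat_in_itvoo _ (z.1 - d) (z.1 + d) ltac:(lra).
rewrite in_itv/= => /andP[a1 a2].
have [b /=] := @rat_in_itvoo _ (z.2 - d) (z.2 + d) ltac:(lra).
rewrite in_itv/= => /andP[b1 b2].
pose k := pickle (a, b).
have qk : q k = (ratr a, ratr b) by rewrite /q /k pickleK.
apply: (@le_trans _ _ (h k z)).
  apply: ge_inf; last by exists k.
  by have [y hy] := lb z; exists y => _ [m _ <-]; apply: hy; exists m.
have za : `|z.1 - ratr a| <= d by rewrite ler_norml; apply/andP; split; lra.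
have zb : `|z.2 - ratr b| <= d by rewrite ler_norml; apply/andP; split; lra.
rewrite /h qk/=.
have : phi (ratr a, ratr b) - phi z <= L * (d + d).
  rewrite (le_trans (ler_norm _))// (le_trans (H _ _))//= ler_wpM2l//.
  by rewrite lerD// distrC.
have : L * (`|z.1 - ratr a| + `|z.2 - ratr b|) <= L * (d + d).
  by rewrite ler_wpM2l// lerD.
have : (L + 1) * d <= e / 4.
  rewrite (_ : (L + 1) * d = e / 4)// /d; field.
  by rewrite gt_eqF// ltr_wpDl.
lra.
Qed.

End euclid.

Lemma prob_cst d (T : measurableType d) (R : realType) (mu : probability T R) (c : R) :
  \int[mu]_z c = c.
Proof.
rewrite Rintegral_cst// -[RHS]mulr1; congr (_ * _).
by rewrite -[RHS]/(fine 1%E); congr fine; exact: probability_setT.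
Qed.

Section wasserstein.
Context {R : realType}.
Implicit Types (mu nu : probability (R * R)%type R) (phi : R * R -> R).

Definition plip (L : R) phi := (forall v, periodic (fun x => phi (x, v)) 1) /\
  (forall z w, `|phi z - phi w| <= L * euclidean_dist z w).

Lemma lip1P phi : lip1 phi <-> plip 1 phi.
Proof.
by split=> -[h1 h2]; split => // z w; have := h2 z w; rewrite mul1r.
Qed.

Lemma plip_sum L phi : 0 <= L -> plip L phi ->
  forall z w, `|phi z - phi w| <= L * (`|z.1 - w.1| + `|z.2 - w.2|).
Proof.
move=> L0 [_ h] z w; rewrite (le_trans (h _ _))// ler_wpM2l//.
exact: euclidean_dist_le_sum.
Qed.

Lemma plip_measurable L phi : 0 <= L -> plip L phi -> measurable_fun setT phi.
Proof. by move=> L0 /(plip_sum L0); exact: lipschitz_measurable. Qed.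

Lemma periodic_int (f : R -> R) (n : int) x : periodic f 1 -> f (x + n%:~R) = f x.
Proof.
move=> pf; have pfn (m : nat) y : f (y + m%:R) = f y by rewrite (periodicn pf).
by case: n => n; [exact: pfn|rewrite -(pfn n.+1) NegzE mulrNz subrK].
Qed.

Lemma torus_repr_itv (x : R) : - 2^-1 <= torus_repr x < 2^-1.
Proof.
have /andP[] := floor_itv (x + 2^-1); rewrite intrD1 /torus_repr => h1 h2.
by apply/andP; split; lra.
Qed.

Lemma torus_repr_norm (x : R) : `|torus_repr x| <= 2^-1.
Proof. by have /andP[] := torus_repr_itv x; rewrite ler_norml => ? ?; lra. Qed.

Lemma periodic_repr (f : R -> R) x : periodic f 1 -> f (torus_repr x) = f x.
Proof. by move=> pf; rewrite /torus_repr -mulrNz periodic_int. Qed.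

Lemma plip_growth L phi : 0 <= L -> plip L phi ->
  forall z, `|phi z| <= `|phi (0, 0)| + L * (1 + `|z.2|).
Proof.
move=> L0 hphi [x v]; case: (hphi) => per _.
have -> : phi (x, v) = phi (torus_repr x, v).
  by rewrite (periodic_repr x (per v)).
have := plip_sum L0 hphi (torus_repr x, v) (0, 0); rewrite /= !subr0 => h.
have h1 := torus_repr_norm x.
have : `|phi (torus_repr x, v)| <= `|phi (0, 0)| + `|phi (torus_repr x, v) - phi (0, 0)|.
  by rewrite -[X in `|X| <= _](subrKC (phi (0, 0))) ler_normD.
have : L * (`|torus_repr x| + `|v|) <= L * (1 + `|v|).
  by rewrite ler_wpM2l// lerD2r (le_trans h1)//; lra.
lra.
Qed.

Lemma in_P1_integrable mu : in_P1 mu ->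
  mu.-integrable setT (EFin \o (fun z : R * R => `|z.2|)).
Proof.
move=> [_ fin]; apply/integrableP; split.
  by apply/measurable_EFinP; apply: measurableT_comp.
by under eq_integral do rewrite /= normr_id.
Qed.

Lemma growth_integrable mu phi (A B : R) : in_P1 mu -> measurable_fun setT phi ->
  (forall z, `|phi z| <= A + B * `|z.2|) -> mu.-integrable setT (EFin \o phi).
Proof.
move=> Pmu mphi gphi.
have i1 : mu.-integrable setT (EFin \o (fun z : R * R => A + B * `|z.2|)).
  rewrite (_ : _ \o _ = (EFin \o cst A) \+ (fun z => B%:E * (`|z.2|)%:E))%E.
    apply: integrableD => //; first exact: finite_measure_integrable_cst.
    exact/integrableZl/in_P1_integrable.
  by apply/funext.
apply: (le_integrable _ _ _ i1) => //; first exact/measurable_EFinP.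
move=> z _ /=; rewrite lee_fin (le_trans (gphi z))//.
exact: ler_norm.
Qed.

Lemma plip_integrable mu L phi : 0 <= L -> in_P1 mu -> plip L phi ->
  mu.-integrable setT (EFin \o phi).
Proof.
move=> L0 Pmu hphi.
apply: (@growth_integrable _ _ (`|phi (0, 0)| + L) L) => //.
  exact: plip_measurable hphi.
by move=> z; have := plip_growth L0 hphi z; rewrite mulrDr mulr1 addrA.
Qed.

Definition w1 mu nu : R := fine (W1 mu nu).

Lemma W1_intgE mu nu L phi : 0 <= L -> in_P1 mu -> in_P1 nu -> plip L phi ->
  (\int[mu]_z (phi z)%:E - \int[nu]_z (phi z)%:E)%E =
  (\int[mu]_z phi z - \int[nu]_z phi z)%:E.
Proof.
move=> L0 Pmu Pnu hphi.
rewrite EFinB !fineK//; apply: integrable_fin_num => //.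
  exact: plip_integrable hphi.
exact: plip_integrable hphi.
Qed.

Let plip0 : plip 1 (cst 0).
Proof.
by split => // z w; rewrite /= subrr normr0 mul1r euclidean_dist_ge0.
Qed.

Lemma plipZ (L c : R) phi : plip L phi -> plip (`|c| * L) (fun z => c * phi z).
Proof.
move=> [p h]; split; first by move=> v x /=; rewrite (p v x).
by move=> z w; rewrite -mulrBr normrM -mulrA ler_wpM2l.
Qed.

(** Equal masses allow [phi (0, 0)] to be subtracted; as [x] can be brought into one period, what
    remains is at most [1 + |v|], which is integrable. *)
Lemma W1_fin mu nu : in_P1 mu -> in_P1 nu -> W1 mu nu = (w1 mu nu)%:E.
Proof.
move=> Pmu Pnu; rewrite /w1 fineK// fin_numE; apply/andP; split.
  rewrite -ltNye (@lt_le_trans _ _ 0%E)// ?ltNy0//.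
  apply: ereal_sup_ubound; exists (cst 0); first exact/lip1P.
  by rewrite /= !integral0 sube0.
rewrite -ltey.
pose m (mu : probability (R * R)%type R) := \int[mu]_z (1 + `|z.2|).
have im (mu' : probability (R * R)%type R) : in_P1 mu' ->
    mu'.-integrable setT (EFin \o (fun z : R * R => 1 + `|z.2|)).
  move=> P'; apply: (@growth_integrable _ _ 1 1) => //.
    by apply: measurable_funD => //; exact: measurableT_comp.
  by move=> z; rewrite mul1r ger0_norm// addr_ge0.
apply: (@le_lt_trans _ _ (m mu + m nu)%:E); last exact: ltry.
apply: ge_ereal_sup => _ [phi /lip1P hphi <-].
rewrite (@W1_intgE _ _ 1)// lee_fin.
have hb (mu' : probability (R * R)%type R) : in_P1 mu' ->
    `|\int[mu']_z phi z - phi (0, 0)| <= m mu'.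
  move=> P'.
  have -> : \int[mu']_z phi z - phi (0, 0) = \int[mu']_z (phi z - phi (0, 0)).
    have i1 := plip_integrable ler01 P' hphi.
    have i2 := finite_measure_integrable_cst mu' (phi (0, 0)) measurableT.
    by rewrite (RintegralB measurableT i1 i2) prob_cst.
  have hphi' : plip 1 (fun z => phi z - phi (0, 0)).
    case: (hphi) => p h; split; first by move=> v x /=; rewrite (p v x).
    by move=> z w; rewrite opprB addrA subrK.
  have i' := plip_integrable ler01 P' hphi'.
  rewrite (le_trans (le_normr_Rintegral _ i'))//.
  apply: le_Rintegral => //; [exact: integrable_norm|exact: im|].
  move=> z _; have := plip_growth ler01 hphi' z.
  by rewrite subrr normr0 add0r mul1r.
have := hb _ Pmu; have := hb _ Pnu; rewrite !ler_norml => /andP[? ?] /andP[? ?].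
lra.
Qed.

Lemma w1_ge0 mu nu : in_P1 mu -> in_P1 nu -> 0 <= w1 mu nu.
Proof.
move=> Pmu Pnu; rewrite -lee_fin -W1_fin//.
apply: ereal_sup_ubound; exists (cst 0); first exact/lip1P.
by rewrite /= !integral0 sube0.
Qed.

Lemma w1_ub mu nu L phi : 0 <= L -> in_P1 mu -> in_P1 nu -> plip L phi ->
  \int[mu]_z phi z - \int[nu]_z phi z <= L * w1 mu nu.
Proof.
move=> L0 Pmu Pnu hphi.
have [L1|L1] := ltP 0 L; last first.
  have L00 : L = 0 by apply/le_anti/andP.
  have E z : phi z = phi (0, 0).
    apply/eqP; rewrite -subr_eq0 -normr_le0.
    by have [_ /(_ z (0, 0))] := hphi; rewrite L00 mul0r.
  rewrite L00 mul0r.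
  have -> : phi = cst (phi (0, 0)) by apply/funext => z; exact: E.
  by rewrite !prob_cst subrr.
rewrite -ler_pdivrMl//.
have h1 : plip 1 (fun z => L^-1 * phi z).
  by have := plipZ L^-1 hphi; rewrite gtr0_norm ?invr_gt0// mulVf ?gt_eqF.
rewrite -lee_fin -W1_fin// mulrBr -!RintegralZl//; last 2 first.
- exact: plip_integrable hphi.
- exact: plip_integrable hphi.
rewrite -(W1_intgE ler01 Pmu Pnu h1).
by apply: ereal_sup_ubound; exists (fun z => L^-1 * phi z) => //; exact/lip1P.
Qed.

Lemma w1_norm mu nu L phi : 0 <= L -> in_P1 mu -> in_P1 nu -> plip L phi ->
  `|\int[mu]_z phi z - \int[nu]_z phi z| <= L * w1 mu nu.
Proof.
move=> L0 Pmu Pnu hphi; rewrite ler_norml (w1_ub L0 Pmu Pnu hphi) andbT lerNl.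
have hN : plip L (fun z => (-1) * phi z).
  by have := plipZ (-1) hphi; rewrite normrN1 mul1r.
have := w1_ub L0 Pmu Pnu hN.
have i1 := plip_integrable L0 Pmu hphi; have i2 := plip_integrable L0 Pnu hphi.
by rewrite !RintegralZl// !mulN1r opprK opprB addrC.
Qed.

Lemma w1_le mu nu (c : R) : in_P1 mu -> in_P1 nu ->
  (forall phi, plip 1 phi -> \int[mu]_z phi z - \int[nu]_z phi z <= c) ->
  w1 mu nu <= c.
Proof.
move=> Pmu Pnu h; rewrite -lee_fin -W1_fin//.
apply: ge_ereal_sup => _ [phi /lip1P hphi <-].
by rewrite (W1_intgE ler01)// lee_fin h.
Qed.

Lemma w1_sym mu nu : in_P1 mu -> in_P1 nu -> w1 mu nu = w1 nu mu.
Proof.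
move=> Pmu Pnu; apply/le_anti/andP; split; apply: w1_le => // phi hphi.
  rewrite -(mul1r (w1 _ _)) (le_trans (ler_norm _))// distrC.
  exact: w1_norm.
rewrite -(mul1r (w1 _ _)) (le_trans (ler_norm _))// distrC.
exact: w1_norm.
Qed.

Lemma w1_triangle mu1 mu2 mu3 : in_P1 mu1 -> in_P1 mu2 -> in_P1 mu3 ->
  w1 mu1 mu3 <= w1 mu1 mu2 + w1 mu2 mu3.
Proof.
move=> P1 P2 P3; apply: w1_le => // phi hphi.
have := w1_ub ler01 P1 P2 hphi; have := w1_ub ler01 P2 P3 hphi.
rewrite !mul1r; lra.
Qed.

End wasserstein.

(** * The Poisson kernel and the sawtooth function *)

Section ftc.
Context {R : realType}.
Local Notation leb := (@lebesgue_measure R).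

Lemma Rintegral_FTC2 (F f : R -> R) (a b : R) : a < b ->
  (forall x, is_derive x (1 : R) F (f x)) -> continuous f ->
  \int[leb]_(x in `[a, b]) f x = F b - F a.
Proof.
move=> ab hF cf; rewrite /Rintegral (@continuous_FTC2 _ f F)//.
- exact: continuous_subspaceT.
- have cF := derive_continuous hF; split.
  + by move=> x _; exact: (@ex_derive _ _ _ _ _ _ _ (hF x)).
  + exact/cvg_at_right_filter/cF.
  + exact/cvg_at_left_filter/cF.
- by move=> x _; rewrite derive1E; exact: (@derive_val _ _ _ _ _ _ _ (hF x)).
Qed.

Lemma continuous_measurable (f : R -> R) (D : set R) : continuous f -> measurable_fun D f.
Proof. by move=> cf; apply: measurable_funTS; exact: continuous_measurable_fun. Qed.

Lemma continuous_torus_integrable (f : R -> R) : continuous f ->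
  leb.-integrable (torus R) (EFin \o f).
Proof.
move=> cf; apply: (@integrableS _ _ _ leb `[- 2^-1, 2^-1]) => //.
- exact: measurable_torus.
- exact: subset_itv_co_cc.
apply: continuous_compact_integrable => //; first exact: segment_compact.
exact: continuous_subspaceT.
Qed.

Lemma torus_FTC2 (F f : R -> R) :
  (forall x, is_derive x (1 : R) F (f x)) -> continuous f ->
  \int[leb]_(x in torus R) f x = F 2^-1 - F (- 2^-1).
Proof.
move=> hF cf; rewrite -(@Rintegral_FTC2 F f)//; last lra.
rewrite /torus -[RHS]Rintegral_itv_bndo_bndc//.
exact: continuous_torus_integrable.
Qed.

Lemma mtorus : measurable (torus R : set (measurableTypeR R)).
Proof. exact: measurable_torus. Qed.

Lemma torus_measure : leb (torus R) = 1%E.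
Proof. by rewrite /torus lebesgue_measure_itv/= ifT ?lte_fin -?EFinD; [congr EFin|]; lra. Qed.

Lemma Rintegral_torus_cst (c : R) : \int[leb]_(x in torus R) c = c.
Proof.
rewrite Rintegral_cst; last exact: measurable_torus.
rewrite -[RHS]mulr1; congr (_ * _).
by rewrite -[RHS]/(fine 1%E); congr fine; exact: torus_measure.
Qed.

Lemma torus_lty : (leb (torus R) < +oo)%E.
Proof. by rewrite torus_measure ltry. Qed.

End ftc.

Section poisson_kernel.
Context {R : realType}.
Local Notation leb := (@lebesgue_measure R).
Implicit Types a x : R.

(** [pk_den a x] is [|a - e^(2 i pi x)|^2], and [pk a] is the Poisson kernel of radius [1 / a].
    [sawtooth a] is the Poisson integral of [W']: its [atan] is the argument of [a - e^(-2 i pi x)],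
    whose real part is positive for [a > 1]. *)
Definition pk_den a x : R := a ^+ 2 - 2 * a * cos (2 * pi * x) + 1.
Definition pk a x : R := (a ^+ 2 - 1) / pk_den a x.
Definition sawtooth a x : R :=
  - (pi^-1 * atan (sin (2 * pi * x) / (a - cos (2 * pi * x)))).

Lemma cosD1 x : cos (2 * pi * (x + 1)) = cos (2 * pi * x) :> R.
Proof. by rewrite mulrDr mulr1 mulr_natl cosD2pi. Qed.

Lemma sinD1 x : sin (2 * pi * (x + 1)) = sin (2 * pi * x) :> R.
Proof. by rewrite mulrDr mulr1 mulr_natl sinD2pi. Qed.

Lemma pk_den_ge a x : 1 < a -> (a - 1) ^+ 2 <= pk_den a x.
Proof.
move=> a1; rewrite /pk_den; have := cos_le1 (2 * pi * x).
move: (cos _) => c c1; have : 0 <= a * (1 - c) by apply: mulr_ge0; lra.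
by rewrite sqrrB mulr1 expr1n; lra.
Qed.

Lemma pk_den_gt0 a x : 1 < a -> 0 < pk_den a x.
Proof.
by move=> a1; apply: lt_le_trans (pk_den_ge _ a1); rewrite exprn_gt0// subr_gt0.
Qed.

Lemma pk_ge0 a x : 1 < a -> 0 <= pk a x.
Proof.
move=> a1; rewrite /pk divr_ge0//; last exact/ltW/pk_den_gt0.
by rewrite subr_ge0 -[leLHS](expr1n _ 2) lerXn2r ?nnegrE//; lra.
Qed.

Lemma pk_periodic a : periodic (pk a) 1.
Proof. by move=> x; rewrite /pk /pk_den cosD1. Qed.

Lemma pk_even a x : pk a (- x) = pk a x.
Proof. by rewrite /pk /pk_den mulrN cosN. Qed.

Lemma pk_bsmooth a : 1 < a -> bsmooth (pk a).
Proof.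
move=> a1 n.
have h : Cb n (pk_den a).
  rewrite (_ : pk_den a = fun x =>
    ((- (2 * a)) * cos (2 * pi * x) + 0 * sin (2 * pi * x)) + (a ^+ 2 + 1)).
    by apply: CbD; [exact: Cb_trig|exact: Cb_cst].
  by apply/funext => x; rewrite /pk_den; ring.
apply: CbZ; apply: (@Cb_inv _ _ _ ((a - 1) ^+ 2)) => //.
  by rewrite exprn_gt0// subr_gt0.
by move=> x; exact: pk_den_ge.
Qed.

Lemma sawtooth_periodic a : periodic (sawtooth a) 1.
Proof. by move=> x; rewrite /sawtooth cosD1 sinD1. Qed.

Lemma sawtooth_odd a x : sawtooth a (- x) = - sawtooth a x.
Proof. by rewrite /sawtooth mulrN cosN sinN mulNr atanN mulrN. Qed.

Lemma sawtooth_bound a x : `|sawtooth a x| <= 2^-1.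
Proof.
rewrite /sawtooth normrN normrM gtr0_norm ?invr_gt0 ?pi_gt0//.
rewrite ler_pdivrMl ?pi_gt0//.
have := atan_gtNpi2 (sin (2 * pi * x) / (a - cos (2 * pi * x))).
have := atan_ltpi2 (sin (2 * pi * x) / (a - cos (2 * pi * x))).
by move=> h1 h2; rewrite ler_norml; apply/andP; split; apply/ltW; lra.
Qed.

Lemma is_derive_sawtooth a x : 1 < a ->
  is_derive x (1 : R) (sawtooth a) (1 - pk a x).
Proof.
move=> a1.
have h : is_derive x (1 : R) (fun y => 2 * pi * y) (2 * pi).
  apply: (is_derive_eq (is_deriveZ (2 * pi) (is_derive_id x 1))).
  by rewrite /GRing.scale/= mulr1.
have hc := @is_derive1_comp _ (@cos R) _ x _ _ (is_derive_cos _) h.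
have hs := @is_derive1_comp _ (@sin R) _ x _ _ (is_derive_sin _) h.
have hd := is_deriveB (is_derive_cst a x 1) hc.
have ac0 : 0 < a - cos (2 * pi * x).
  by rewrite subr_gt0 (le_lt_trans (cos_le1 _)).
have ac : (cst a - cos \o (fun y : R => 2 * pi * y)) x != 0 by rewrite gt_eqF.
have hq := is_deriveM hs (is_deriveV ac hd).
have ha := @is_derive1_comp _ (@atan R) _ x _ _ (is_derive1_atan _) hq.
apply: (is_derive_eq (is_deriveN (is_deriveZ pi^-1 ha))).
have D0 := pk_den_gt0 x a1.
rewrite !fctE /= /GRing.scale/= /pk; move: D0 ac0; rewrite /pk_den.
have E : sin (2 * pi * x) ^+ 2 = 1 - cos (2 * pi * x) ^+ 2 by rewrite sin2cos2.
move: E; set s := sin _; set c := cos _ => E D0 ac0.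
have E1 : 1 + (s * (a - c)^-1) ^+ 2 = (a ^+ 2 - 2 * a * c + 1) / (a - c) ^+ 2.
  rewrite exprMn E; field; lra.
have p0 : pi != 0 :> R by rewrite gt_eqF ?pi_gt0.
clearbody s c; rewrite E1 invf_div.
have -> : s * (- (a - c) ^- 2 * (0 - - s * (2 * pi))) +
    (a - c)^-1 * (c * (2 * pi)) = (2 * pi * (a * c - 1)) / (a - c) ^+ 2.
  have -> : s * (- (a - c) ^- 2 * (0 - - s * (2 * pi))) =
    - (2 * pi * s ^+ 2) / (a - c) ^+ 2 by ring.
  by rewrite E; field; lra.
move: p0; move: (pi : R) => q q0.
by field; rewrite q0 andbT; apply/andP; split; lra.
Qed.

Lemma pk_continuous a : 1 < a -> continuous (pk a).
Proof.
by move=> /pk_bsmooth/bsmooth_derive[df [h _]]; exact: derive_continuous h.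
Qed.

Lemma pk_integral a : 1 < a -> \int[leb]_(x in torus R) pk a x = 1.
Proof.
move=> a1.
have h x : is_derive x (1 : R) (fun y => y - sawtooth a y) (pk a x).
  apply: (is_derive_eq (is_deriveB (is_derive_id x 1) (is_derive_sawtooth x a1))).
  by rewrite opprB addrC subrK.
rewrite (torus_FTC2 h (pk_continuous a1)).
have : sawtooth a (- 2^-1) = sawtooth a 2^-1.
  by rewrite -(sawtooth_periodic a (- 2^-1)); congr sawtooth; lra.
lra.
Qed.

End poisson_kernel.

(** * The potential [W] and the limit of the sawtooth *)

Section periodic_potential.
Context {R : realType}.
Implicit Types (a x y z : R) (n : int).

Lemma torus_reprE n x : - 2^-1 <= x - n%:~R < 2^-1 -> torus_repr x = x - n%:~R.
Proof.
move=> /andP[h1 h2]; rewrite /torus_repr (@floor_def _ (x + 2^-1) n)//.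
by rewrite intrD1; apply/andP; split; lra.
Qed.

Lemma torus_repr_periodic : periodic (@torus_repr R) 1.
Proof.
move=> x; rewrite (@torus_reprE (Num.floor (x + 2^-1) + 1)).
  by rewrite intrD1 /torus_repr opprD addrACA subrr addr0.
have := torus_repr_itv x; rewrite /torus_repr intrD1 => /andP[? ?].
by apply/andP; split; lra.
Qed.

Lemma torus_repr_min n x : `|torus_repr x| <= `|x - n%:~R|.
Proof.
have [h|h] := boolP (- 2^-1 <= x - n%:~R < 2^-1).
  by rewrite (torus_reprE h).
apply: (le_trans (torus_repr_norm x)).
rewrite leNgt; apply/negP; rewrite ltr_norml => /andP[h1 h2].
by move: h; rewrite h2 (ltW h1).
Qed.

Lemma torus_repr_lipschitz x y :
  `| `|torus_repr x| - `|torus_repr y| | <= `|x - y|.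
Proof.
have h (u v : R) : `|torus_repr u| <= `|u - v| + `|torus_repr v|.
  have := torus_repr_min (Num.floor (v + 2^-1)) u; have := ler_normD (u - v) (torus_repr v).
  by rewrite {2}/torus_repr addrA subrK => h1 h2; exact: le_trans h2 h1.
rewrite ler_norml; apply/andP; split.
  rewrite lerNl opprB lerBlDr. rewrite [X in X + _]distrC; exact: h.
by rewrite lerBlDr; exact: h.
Qed.

Lemma W_periodic : periodic (@W R) 1.
Proof. by move=> x; rewrite /W torus_repr_periodic. Qed.

Lemma W_lipschitz x y : `|W x - W y| <= 2^-1 * `|x - y|.
Proof.
have := torus_repr_lipschitz x y; have := torus_repr_norm x.
have := torus_repr_norm y.
rewrite /W -(real_normK (num_real (torus_repr x))) -(real_normK (num_real (torus_repr y))).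
have : 0 <= `|torus_repr x| by []. have : 0 <= `|torus_repr y| by [].
move: (`|torus_repr x|) (`|torus_repr y|) => p q q0 p0 q1 p1 pq.
have -> : (p ^+ 2 - p) / 2 - (q ^+ 2 - q) / 2 = (p - q) * ((p + q - 1) / 2) by field.
rewrite normrM mulrC ler_pM//.
by rewrite ler_norml; apply/andP; split; lra.
Qed.

Lemma W_bounds x : - 8^-1 <= W x <= 0.
Proof.
rewrite /W -(real_normK (num_real (torus_repr x))).
have := torus_repr_norm x; have : 0 <= `|torus_repr x| by [].
move: (`|torus_repr x|) => p p0 p1.
have : 0 <= (p - 2^-1) ^+ 2 by exact: sqr_ge0.
have : p * (1 - p) >= 0 by apply: mulr_ge0; lra.
by rewrite sqrrB => h1 h2; apply/andP; split; lra.
Qed.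

(** The symmetry [t -> 1 - t] of [t^2 - t] glues the two halves of the cell: [W] has no kink at
    half-integers, where [torus_repr] jumps. *)
Lemma W_cell n z : n%:~R <= z <= n%:~R + 1 ->
  W z = ((z - n%:~R) ^+ 2 - (z - n%:~R)) / 2.
Proof.
move=> /andP[h1 h2]; rewrite /W; have [h3|h3] := ltP (z - n%:~R) 2^-1.
  rewrite (@torus_reprE n); last by rewrite h3 andbT; lra.
  by rewrite ger0_norm// subr_ge0.
rewrite (@torus_reprE (n + 1)) ?intrD1; last by apply/andP; split; lra.
rewrite ler0_norm; last lra.
by field.
Qed.

Lemma W'_cell n z : n%:~R < z < n%:~R + 1 -> W' z = z - n%:~R - 2^-1.
Proof.
move=> /andP[h1 h2]; rewrite /W'.
have -> : (torus_repr z == 0) = false.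
  apply/negbTE/negP => /eqP; have [h3|h3] := ltP (z - n%:~R) 2^-1.
    by rewrite (@torus_reprE n); [|apply/andP; split]; lra.
  by rewrite (@torus_reprE (n + 1)) ?intrD1; [|apply/andP; split]; lra.
rewrite derive1E.
have D : is_derive z (1 : R) (fun y => (y ^+ 2 - (2 * n%:~R + 1) * y) / 2) (z - n%:~R - 2^-1).
  have hX : is_derive z (1 : R) (fun y : R => y ^+ 2) (2 * z).
    apply: (is_derive_eq (is_deriveX 2 (is_derive_id z (1 : R)))).
    by rewrite /GRing.scale/= expr1 mulr1.
  have h := is_deriveB hX (is_deriveZ (2 * n%:~R + 1) (is_derive_id z (1 : R))).
  rewrite (_ : (fun y => _) = 2^-1 *: ((fun y : R => y ^+ 2) - (2 * n%:~R + 1) *: id)).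
    apply: (is_derive_eq (is_deriveZ 2^-1 h)).
    by rewrite /GRing.scale/= mulr1; field.
  by apply/funext => y; rewrite !fctE /GRing.scale/= mulrC.
have := near_eq_is_derive (g := @W R) _ (is_deriveD D (is_derive_cst ((n%:~R ^+ 2 + n%:~R) / 2 : R) z (1 : R))).
rewrite addr0 => h; apply: (@derive_val _ _ _ _ _ _ _ (h _)).
near=> y; rewrite (@W_cell n); first by rewrite !fctE; field.
apply/andP; split; apply: ltW; near: y; first exact: lt_nbhsr.
exact: lt_nbhsl.
Unshelve. all: by end_near. Qed.

Lemma W'_int z : torus_repr z = 0 -> W' z = 0.
Proof. by move=> h; rewrite /W' h eqxx. Qed.

Lemma torus_repr0_cell z : torus_repr z <> 0 -> exists n, n%:~R < z < n%:~R + 1.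
Proof.
move=> h; exists (Num.floor z); have /andP[h1 h2] := floor_itv z.
rewrite intrD1 in h2; rewrite h2 andbT lt_neqAle h1 andbT.
apply/eqP => E; apply: h; rewrite (@torus_reprE (Num.floor z)) E ?subrr//.
by apply/andP; split; lra.
Qed.

Lemma W'_periodic : periodic (@W' R) 1.
Proof.
move=> x; have [h|/torus_repr0_cell[n hn]] := pselect (torus_repr x = 0).
  by rewrite !W'_int// torus_repr_periodic.
rewrite (W'_cell hn) (@W'_cell (n + 1)) intrD1; first by lra.
by move: hn => /andP[? ?]; apply/andP; split; lra.
Qed.

Lemma W'_bound x : `|W' x| <= 2^-1.
Proof.
have [h|/torus_repr0_cell[n hn]] := pselect (torus_repr x = 0).
  by rewrite W'_int// normr0.
rewrite (W'_cell hn) ler_norml; move: hn => /andP[? ?].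
by apply/andP; split; lra.
Qed.

Definition pk_a (k : nat) : R := 1 + k.+1%:R^-1.

Lemma pk_a_gt1 k : 1 < pk_a k.
Proof. by rewrite /pk_a ltrDl invr_gt0. Qed.

Lemma cvg_pk_a : pk_a k @[k --> \oo] --> (1 : R).
Proof.
rewrite -[X in _ --> X]addr0; apply: cvgD; first exact: cvg_cst.
exact: cvg_harmonic.
Qed.

Lemma sinZ n : sin (2 * pi * n%:~R) = 0 :> R.
Proof.
have p : periodic (fun x : R => sin (2 * pi * x)) 1 by move=> x; rewrite sinD1.
by have := periodic_int n 0 p; rewrite add0r => ->; rewrite mulr0 sin0.
Qed.

(** Both sides vanish at integers, in agreement with the convention [W'(0) = 0]; elsewhere [1 - cos]
    does not vanish and one may let [a] tend to 1 in the formula. *)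
Lemma cvg_sawtooth x : sawtooth (pk_a k) x @[k --> \oo] --> W' x.
Proof.
have [h|/torus_repr0_cell[n hn]] := pselect (torus_repr x = 0).
  have E k : sawtooth (pk_a k) x = 0.
    have -> : x = (Num.floor (x + 2^-1))%:~R.
      by apply/eqP; rewrite -subr_eq0; apply/eqP.
    by rewrite /sawtooth sinZ mul0r atan0 mulr0 oppr0.
  rewrite W'_int//; under eq_fun do rewrite E; exact: cvg_cst.
rewrite (W'_cell hn).
pose y := x - n%:~R.
have y01 : 0 < y < 1 by move: hn => /andP[? ?]; rewrite /y; apply/andP; split; lra.
have E a : sawtooth a x = sawtooth a y.
  by rewrite /y -mulrNz (periodic_int _ _ (sawtooth_periodic a)).
under eq_fun do rewrite E; rewrite -/y.
have p0 : 0 < pi :> R := pi_gt0 R.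
have s0 : 0 < sin (pi * y).
  apply: sin_gt0_pi; move: y01 => /andP[y0 y1].
  by rewrite mulr_gt0//= gtr_pMr.
have c2 : cos (2 * pi * y) = 1 - 2 * sin (pi * y) ^+ 2.
  rewrite -mulrA mulr_natl cos_mulr2n cos2sin2; ring.
have s2 : sin (2 * pi * y) = 2 * (cos (pi * y) * sin (pi * y)).
  by rewrite -mulrA mulr_natl sin_mulr2n mulr_natl.
have E2 : 1 - cos (2 * pi * y) = 2 * sin (pi * y) ^+ 2 by rewrite c2; ring.
have d0 : 1 - cos (2 * pi * y) != 0.
  by rewrite E2 gt_eqF// mulr_gt0// exprn_gt0.
have -> : y - 2^-1 = - (pi^-1 * atan (sin (2 * pi * y) / (1 - cos (2 * pi * y)))).
  (* The half-angle formulas give the cotangent of [pi * y]. *)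
  have -> : sin (2 * pi * y) / (1 - cos (2 * pi * y)) = tan (pi / 2 - pi * y).
    rewrite /tan sinB cosB sin_pihalf cos_pihalf !mul0r !mul1r subr0 add0r E2 s2.
    move: (gt_eqF s0); move: (sin (pi * y)) (cos (pi * y)) => s c sn0.
    by field; rewrite sn0.
  rewrite tanK; last by rewrite in_itv/=; move: y01 => /andP[y0 y1]; apply/andP; split; nra.
  by rewrite mulrBr mulKf ?gt_eqF// mulrA mulVf ?gt_eqF// mul1r opprB.
apply: cvgN; apply: cvgMr.
apply: continuous_cvg; first exact: continuous_atan.
apply: cvgMr; apply: cvgV => //.
by apply: cvgB; [exact: cvg_pk_a|exact: cvg_cst].
Qed.

End periodic_potential.

(** * Convolution with the Poisson kernel *)

Section convolution.
Context {R : realType}.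
Local Notation leb := (@lebesgue_measure R).
Implicit Types (mu nu : probability (R * R)%type R) (h : R -> R).

(** A convolution with the [x]-marginal, written as an integral on phase space so that the duality
    bounds of [w1] apply to it. *)
Definition conv mu h (x : R) : R := \int[mu]_z h (x - z.1).

Lemma measurable_shift_fst h (x : R) : measurable_fun setT h ->
  measurable_fun setT (fun z : R * R => h (x - z.1)).
Proof.
move=> mh; apply: (measurableT_comp mh).
by apply: measurable_funB => //; exact: measurable_cst.
Qed.

Lemma prob_lty mu : (mu setT < +oo)%E.
Proof. by rewrite probability_setT ltry. Qed.

Lemma prob_integrable mu (f : R * R -> R) (C : R) : measurable_fun setT f ->
  (forall z, `|f z| <= C) -> mu.-integrable setT (EFin \o f).
Proof. by move=> mf fC; apply: (bounded_integrable measurableT (prob_lty mu) mf) => z _. Qed.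

Lemma prob_norm_le mu (f : R * R -> R) (C : R) : measurable_fun setT f ->
  (forall z, `|f z| <= C) -> `|\int[mu]_z f z| <= C.
Proof.
move=> mf fC.
have fi := prob_integrable mu mf fC.
rewrite (le_trans (le_normr_Rintegral measurableT fi))// -[leRHS](prob_cst mu).
apply: le_Rintegral => //; first exact: integrable_norm.
exact: finite_measure_integrable_cst.
Qed.

Lemma conv_integrable mu h (C x : R) : measurable_fun setT h ->
  (forall y, `|h y| <= C) -> mu.-integrable setT (EFin \o (fun z => h (x - z.1))).
Proof.
move=> mh hC; apply: (@prob_integrable _ _ C) => //.
exact: measurable_shift_fst.
Qed.

Lemma conv_bound mu h (C x : R) : measurable_fun setT h ->
  (forall y, `|h y| <= C) -> `|conv mu h x| <= C.
Proof. by move=> mh hC; apply: prob_norm_le => //; exact: measurable_shift_fst. Qed.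

Lemma conv_cvg mu (h_ : nat -> R -> R) h (C x : R) :
  (forall n, measurable_fun setT (h_ n)) -> measurable_fun setT h ->
  (forall n y, `|h_ n y| <= C) -> (forall y, h_ n y @[n --> \oo] --> h y) ->
  conv mu (h_ n) x @[n --> \oo] --> conv mu h x.
Proof.
move=> mh_ mh hC hh; apply: (Rintegral_cvg measurableT (prob_lty mu) (C := C)) => //.
- by move=> n; exact: measurable_shift_fst.
- exact: measurable_shift_fst.
Qed.

Lemma conv_derive mu h dh (A C L x : R) :
  (forall z, is_derive z (1 : R) h (dh z)) ->
  (forall z, `|h z| <= A) -> (forall z, `|dh z| <= C) ->
  (forall z w, `|dh z - dh w| <= L * `|z - w|) -> continuous dh ->
  is_derive x (1 : R) (conv mu h) (conv mu dh x).
Proof.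
move=> hd hA hC hL cdh; apply: (@is_derive_quad _ _ _ _ _ _ L) => k _.
have mh := continuous_measurable_fun (derive_continuous hd).
have mdh := continuous_measurable_fun cdh.
rewrite /GRing.scale/= mulr1 /conv.
have i1 := conv_integrable mu (k + x) mh hA.
have i2 := conv_integrable mu x mh hA.
have i3 := conv_integrable mu x mdh hC.
rewrite -RintegralB// -RintegralZl// -RintegralB//; last 2 first.
- exact: integrable_sub.
- exact: integrable_scale.
apply: prob_norm_le => [|z].
  apply: measurable_funB; first by apply: measurable_funB; exact: measurable_shift_fst.
  by apply: measurable_funM => //; exact: measurable_shift_fst.
have := taylor1 hd hL (x - z.1) k.
by rewrite (_ : x - z.1 + k = k + x - z.1)//; ring.
Qed.

Lemma conv_periodic mu h : periodic h 1 -> periodic (conv mu h) 1.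
Proof. by move=> ph x; rewrite /conv; apply: eq_Rintegral => z _; rewrite addrAC ph. Qed.

Lemma plip_shift_fst h (L x : R) : 0 <= L -> periodic h 1 ->
  (forall u v, `|h u - h v| <= L * `|u - v|) -> plip L (fun z => h (x - z.1)).
Proof.
move=> L0 ph hL; split.
  by move=> v y /=; rewrite opprD addrA -(ph (x - y - 1)) subrK.
move=> z w; rewrite (le_trans (hL _ _))// ler_wpM2l//.
rewrite (_ : x - z.1 - (x - w.1) = w.1 - z.1); last by ring.
by rewrite distrC euclidean_dist_ge1.
Qed.

Lemma conv_w1 mu nu h (L x : R) : in_P1 mu -> in_P1 nu -> 0 <= L ->
  periodic h 1 -> (forall u v, `|h u - h v| <= L * `|u - v|) ->
  `|conv mu h x - conv nu h x| <= L * w1 mu nu.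
Proof. by move=> P1 P2 L0 ph hL; apply: w1_norm => //; exact: plip_shift_fst. Qed.

End convolution.

(** * Concentration of the Poisson kernels *)

Section sawtooth_limits.
Context {R : realType}.
Local Notation leb := (@lebesgue_measure R).
Implicit Types (x y u : R) (n : nat).

Definition saw n : R -> R := sawtooth (pk_a n).
Definition kap n : R -> R := pk (pk_a n).

Lemma kap_ge0 n x : 0 <= kap n x. Proof. exact/pk_ge0/pk_a_gt1. Qed.

Lemma kap_periodic n : periodic (kap n) 1. Proof. exact: pk_periodic. Qed.

Lemma kap_even n x : kap n (- x) = kap n x. Proof. exact: pk_even. Qed.

Lemma kap_bsmooth n : bsmooth (kap n). Proof. exact/pk_bsmooth/pk_a_gt1. Qed.

Lemma kap_continuous n : continuous (kap n). Proof. exact/pk_continuous/pk_a_gt1. Qed.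

Lemma kap_measurable n : measurable_fun setT (kap n).
Proof. by apply: continuous_measurable_fun; exact: kap_continuous. Qed.

Lemma kap_bounded n : exists C, forall x, `|kap n x| <= C.
Proof. exact: Cb_bounded (@kap_bsmooth n 0%N). Qed.

Lemma kap_lipschitz n : exists C, forall x y, `|kap n x - kap n y| <= C * `|x - y|.
Proof.
have [_ [df [h [[C hC] _]]]] := @kap_bsmooth n 1%N.
by exists C => x y; exact: (derive_bound_lipschitz h).
Qed.

Lemma kap_integral n : \int[leb]_(x in torus R) kap n x = 1.
Proof. exact/pk_integral/pk_a_gt1. Qed.

Lemma saw_bound n x : `|saw n x| <= 2^-1. Proof. exact: sawtooth_bound. Qed.

Lemma saw_periodic n : periodic (saw n) 1. Proof. exact: sawtooth_periodic. Qed.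

Lemma is_derive_saw n x : is_derive x (1 : R) (saw n) (1 - kap n x).
Proof. exact/is_derive_sawtooth/pk_a_gt1. Qed.

Lemma saw_continuous n : continuous (saw n).
Proof. exact: derive_continuous (is_derive_saw n). Qed.

Lemma saw_measurable n : measurable_fun setT (saw n).
Proof. by apply: continuous_measurable_fun; exact: saw_continuous. Qed.

Lemma W'_measurable : measurable_fun setT (@W' R).
Proof.
apply: (measurable_fun_cvg (h := saw)); first exact: saw_measurable.
by move=> x _; exact: cvg_sawtooth.
Qed.

Lemma saw_lipschitz n : exists2 L, 0 <= L & forall x y, `|saw n x - saw n y| <= L * `|x - y|.
Proof.
have [C hC] := kap_bounded n; exists (1 + C).
  by rewrite addr_ge0// (le_trans _ (hC 0)).
apply: (derive_bound_lipschitz (is_derive_saw n)) => z.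
by rewrite (le_trans (ler_normB _ _))// normr1 lerD2l.
Qed.

(* [x - saw n x] is a smooth approximation of the integer part plus 1/2. *)
Lemma saw_stair_mono n x y : x <= y -> x - saw n x <= y - saw n y.
Proof.
move=> xy.
have h z : is_derive z (1 : R) (fun t => t - saw n t) (kap n z).
  apply: (is_derive_eq (is_deriveB (is_derive_id z 1) (is_derive_saw n z))).
  by rewrite opprB addrC subrK.
have [c _] := MVT_line x y h.
rewrite -subr_ge0 => ->; rewrite mulr_ge0 ?kap_ge0// subr_ge0//.
Qed.

(** Where [|x| <= d] the moment is at most [d] times the mass; on the rest of the period [q] bounds
    the denominator of the kernel from below, while the numerator tends to 0. *)
Lemma kap_moment : \int[leb]_(x in torus R) (kap n x * `|x|) @[n --> \oo] --> (0 : R).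
Proof.
apply/cvgrPdist_le => /= e e0.
pose d : R := Num.min (e / 2) 4^-1.
have d0 : 0 < d by rewrite lt_min divr_gt0//=.
have d4 : d <= 4^-1 by rewrite ge_min lexx orbT.
have de : d <= e / 2 by rewrite ge_min lexx.
pose q : R := 2 * (1 - cos (2 * pi * d)).
have p0 : 0 < pi :> R := pi_gt0 R.
have q0 : 0 < q.
  rewrite mulr_gt0// subr_gt0 -[ltRHS](@cos0 R) ltr_cos.
  - by rewrite !mulr_gt0.
  - by rewrite in_itv/= pi_ge0 lexx.
  - by rewrite in_itv/=; apply/andP; split; nra.
have key n x : `|x| <= 2^-1 ->
    kap n x * `|x| <= d * kap n x + (pk_a n ^+ 2 - 1) / q.
  move=> x2; have a1 := pk_a_gt1 (R:=R) n.
  have A0 : 0 <= pk_a n ^+ 2 - 1 :> R.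
    by rewrite subr_ge0 -[leLHS](expr1n _ 2) lerXn2r ?nnegrE//; lra.
  have [xd|xd] := leP `|x| d.
    by rewrite mulrC ler_wpDr ?divr_ge0// ?(ltW q0)// ler_wpM2r ?kap_ge0.
  apply: (@le_trans _ _ ((pk_a n ^+ 2 - 1) / q)); last first.
    by rewrite lerDr mulr_ge0 ?kap_ge0// ltW.
  apply: (@le_trans _ _ (kap n x)).
    by rewrite ler_piMr ?kap_ge0//; lra.
  rewrite /kap /pk ler_wpM2l// lef_pV2 ?posrE ?pk_den_gt0//.
  have : cos (2 * pi * x) <= cos (2 * pi * d).
    rewrite -(cos_norm (2 * pi * x)) normrM ger0_norm ?mulr_ge0 ?pi_ge0//.
    rewrite le_eqVlt ltr_cos ?in_itv/=; last 2 first.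
    - by rewrite !mulr_ge0 ?pi_ge0//=; nra.
    - by rewrite !mulr_ge0 ?pi_ge0 ?(ltW d0)//=; nra.
    by rewrite ltr_pM2l ?mulr_gt0// xd orbT.
  rewrite /q /pk_den; have := cos_le1 (2 * pi * x).
  move: (cos (2 * pi * x)) (cos (2 * pi * d)) (pk_a n) a1 => c1 c2 a a1 h1 h2.
  have : 0 <= (a - 1) ^+ 2 by exact: sqr_ge0.
  have : 0 <= (a - 1) * (1 - c1) by apply: mulr_ge0; lra.
  by rewrite sqrrB mulr1 expr1n; lra.
have ik n : leb.-integrable (torus R) (EFin \o kap n).
  exact/continuous_torus_integrable/kap_continuous.
have cM n : continuous (fun x : R => kap n x * `|x|).
  move=> x; apply: cvgM; first exact: kap_continuous.
  exact: norm_continuous.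
have bd n : \int[leb]_(x in torus R) (kap n x * `|x|) <= d + (pk_a n ^+ 2 - 1) / q.
  have ic : leb.-integrable (torus R) (EFin \o cst ((pk_a n ^+ 2 - 1) / q)).
    apply: continuous_torus_integrable => x; exact: cvg_cst.
  have -> : d + (pk_a n ^+ 2 - 1) / q =
      \int[leb]_(x in torus R) (d * kap n x + (pk_a n ^+ 2 - 1) / q).
    rewrite RintegralD//; [|exact: measurable_torus|]; last by apply: integrable_scale => //; exact: measurable_torus.
    rewrite RintegralZl//; last exact: measurable_torus.
    by rewrite kap_integral mulr1 Rintegral_torus_cst.
  apply: le_Rintegral; first exact: measurable_torus.
  - exact: continuous_torus_integrable.
  - apply: integrable_add => //; first exact: measurable_torus.
    by apply: integrable_scale => //; exact: measurable_torus.
  move=> x; rewrite /torus/= in_itv/= => /andP[h1 h2]; apply: key.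
  by rewrite ler_norml; apply/andP; split; lra.
have : (pk_a n ^+ 2 - 1) / q @[n --> \oo] --> ((1 : R) ^+ 2 - 1) / q.
  apply: cvgMl; apply: cvgB; last exact: cvg_cst.
  have h : pk_a n * pk_a n @[n --> \oo] --> (1 : R) * 1.
    by apply: cvgM; exact: cvg_pk_a.
  by under eq_fun do rewrite expr2.
rewrite expr1n subrr mul0r => /cvgrPdist_le /(_ (e / 2)) => /(_ ltac:(by rewrite divr_gt0)).
apply: filterS => n; rewrite !sub0r !normrN => hn.
rewrite ger0_norm; last first.
  by apply: Rintegral_ge0 => x _; rewrite mulr_ge0 ?kap_ge0.
have := bd n; have := ler_norm ((pk_a n ^+ 2 - 1) / q : R); lra.
Qed.

End sawtooth_limits.

(** * The sawtooth smoothed twice *)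

Section smoothed_sawtooth.
Context {R : realType}.
Local Notation leb := (@lebesgue_measure R).
Implicit Types (x y u : R) (n : nat).

Lemma torus_integrable (f : R -> R) (C : R) : measurable_fun setT f ->
  (forall x, `|f x| <= C) -> leb.-integrable (torus R) (EFin \o f).
Proof.
move=> mf fC.
apply: (@bounded_integrable _ _ _ leb _ (mtorus) torus_lty f C) => //.
exact: measurable_funTS.
Qed.

Lemma torus_reflection (f : R -> R) : continuous f ->
  \int[leb]_(x in torus R) f (- x) = \int[leb]_(x in torus R) f x.
Proof.
move=> cf; rewrite /torus !Rintegral_itv_bndo_bndc; last 2 first.
- exact: continuous_torus_integrable.
- apply: continuous_torus_integrable => x.
  by apply: continuous_comp; [exact: opp_continuous|exact: cf].
rewrite /Rintegral -{1}(opprK 2^-1) -integration_by_substitution_oppr ?opprK//.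
  lra.
exact: continuous_subspaceT.
Qed.

(** The second smoothing appears when [kap n] is integrated against a force that is already built
    from [saw n]. *)
Definition smoothed_saw n u : R := \int[leb]_(x in torus R) (kap n x * saw n (x + u)).

Let kap_saw_cont n u : continuous (fun x => kap n x * saw n (x + u)).
Proof.
move=> x; apply: cvgM; first exact: kap_continuous.
apply: continuous_cvg; first exact: saw_continuous.
by apply: cvgD; [exact: cvg_id|exact: cvg_cst].
Qed.

Lemma smoothed_saw_bound n u : `|smoothed_saw n u| <= 2^-1.
Proof.
have i := continuous_torus_integrable (@kap_saw_cont n u).
rewrite (le_trans (le_normr_Rintegral mtorus i))//.
have ik := continuous_torus_integrable (kap_continuous (n := n)).
rewrite [leRHS](_ : _ = \int[leb]_(x in torus R) (2^-1 * kap n x)); last first.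
  by rewrite RintegralZl ?kap_integral ?mulr1//; exact: mtorus.
apply: le_Rintegral => //; [exact: mtorus| |by apply: integrable_scale => //; exact: mtorus|].
  by apply: integrable_norm.
move=> x _; rewrite normrM ger0_norm ?kap_ge0// [leRHS]mulrC.
by rewrite ler_wpM2l ?kap_ge0// saw_bound.
Qed.

Lemma smoothed_saw_lipschitz n : exists2 L, 0 <= L &
  forall u v, `|smoothed_saw n u - smoothed_saw n v| <= L * `|u - v|.
Proof.
have [L L0 hL] := saw_lipschitz (R := R) n; exists L => // u v.
have iu := continuous_torus_integrable (@kap_saw_cont n u).
have iv := continuous_torus_integrable (@kap_saw_cont n v).
have ik := continuous_torus_integrable (kap_continuous (n := n)).
rewrite /smoothed_saw -RintegralB//; last exact: mtorus.
have i : leb.-integrable (torus R)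
    (EFin \o (fun x => kap n x * saw n (x + u) - kap n x * saw n (x + v))).
  by apply: integrable_sub => //; exact: mtorus.
rewrite (le_trans (le_normr_Rintegral mtorus i))//.
rewrite [leRHS](_ : _ = \int[leb]_(x in torus R) (L * `|u - v| * kap n x)); last first.
  by rewrite RintegralZl ?kap_integral ?mulr1//; exact: mtorus.
apply: le_Rintegral => //; [exact: mtorus|exact: integrable_norm|by apply: integrable_scale => //; exact: mtorus|].
move=> x _; rewrite -mulrBr normrM ger0_norm ?kap_ge0// [leRHS]mulrC.
rewrite ler_wpM2l ?kap_ge0// (le_trans (hL _ _))// (_ : x + u - (x + v) = u - v)//.
by ring.
Qed.

(** At integers the integrand is odd. Elsewhere [G n] is nondecreasing and tends to the same
    constant [c] at [u - d] and [u + d], hence uniformly between them; shifts larger than [d] are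
    controlled by the first moment of the kernel. *)
Lemma cvg_smoothed_saw u : smoothed_saw n u @[n --> \oo] --> W' u.
Proof.
have [u0|/torus_repr0_cell[k hk]] := pselect (torus_repr u = 0).
  rewrite W'_int//.
  have E n : smoothed_saw n u = 0.
    have Eu x : saw n (x + u) = saw n x.
      have -> : u = (Num.floor (u + 2^-1))%:~R by apply/eqP; rewrite -subr_eq0; apply/eqP.
      by rewrite (periodic_int _ _ (saw_periodic n)).
    have := torus_reflection (@kap_saw_cont n u).
    rewrite -/(smoothed_saw n u).
    under eq_Rintegral do rewrite Eu kap_even /saw sawtooth_odd mulrN -(mulN1r (_ * _)).
    rewrite RintegralZl; [|exact: mtorus|].
      under eq_Rintegral do rewrite -/(saw n _) -Eu.
      by rewrite -/(smoothed_saw n u) mulN1r => h; apply/eqP; rewrite -[_ == 0](mulrn_eq0 _ 2); apply/eqP; rewrite mulr2n -{1}h addNr.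
    apply: continuous_torus_integrable => x.
    by apply: cvgM; [exact: kap_continuous|exact: saw_continuous].
  by under eq_fun do rewrite E; exact: cvg_cst.
move: (hk) => /andP[hk1 hk2].
pose d := Num.min (u - k%:~R) (k%:~R + 1 - u) / 2.
have m0 : 0 < Num.min (u - k%:~R) (k%:~R + 1 - u).
  by rewrite lt_min; apply/andP; split; lra.
have d0 : 0 < d by rewrite divr_gt0.
have d1 : d < u - k%:~R.
  have : Num.min (u - k%:~R) (k%:~R + 1 - u) <= u - k%:~R by rewrite ge_min lexx.
  by rewrite /d; lra.
have d2 : d < k%:~R + 1 - u.
  have : Num.min (u - k%:~R) (k%:~R + 1 - u) <= k%:~R + 1 - u by rewrite ge_min lexx orbT.
  by rewrite /d; lra.
pose c := k%:~R + 2^-1 : R.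
pose G n x := x - saw n x : R.
pose e n := `|G n (u - d) - c| + `|G n (u + d) - c|.
have e0 : e n @[n --> \oo] --> (0 : R).
  have h x : k%:~R < x < k%:~R + 1 -> `|G n x - c| @[n --> \oo] --> (0 : R).
    move=> hx; rewrite -(@normr0 _ R); apply: cvg_norm.
    have -> : 0 = x - (x - k%:~R - 2^-1) - c by rewrite /c; ring.
    apply: cvgB; last exact: cvg_cst.
    apply: cvgB; first exact: cvg_cst.
    by rewrite -(W'_cell hx); exact: cvg_sawtooth.
  rewrite -[X in _ --> X]addr0; apply: cvgD; apply: h; apply/andP; split; lra.
pose nu n := \int[leb]_(x in torus R) (kap n x * `|x|).
have key n x : `|saw n (x + u) - W' u| <= e n + (1 + d^-1) * `|x|.
  have en0 : 0 <= e n by rewrite addr_ge0.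
  have x0 : 0 <= `|x| by [].
  have [xd|xd] := leP `|x| d; last first.
    have : `|saw n (x + u) - W' u| <= 1.
      rewrite (le_trans (ler_normB _ _))//.
      have := saw_bound n (x + u); have := W'_bound u; lra.
    have : 1 <= d^-1 * `|x| by rewrite ler_pdivlMl// mulr1 ltW.
    by rewrite mulrDl mul1r; lra.
  move: (xd); rewrite ler_norml => /andP[xd1 xd2].
  have g1 : G n (u - d) <= G n (x + u) by apply: saw_stair_mono; lra.
  have g2 : G n (x + u) <= G n (u + d) by apply: saw_stair_mono; lra.
  have E : saw n (x + u) - W' u = x - (G n (x + u) - c).
    by rewrite (W'_cell hk) /G /c; ring.
  have h : `|G n (x + u) - c| <= e n.
    rewrite /e ler_norml; apply/andP; split.
      have := ler_norm (c - G n (u - d)); rewrite distrC.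
      have : 0 <= `|G n (u + d) - c| by []. lra.
    have := ler_norm (G n (u + d) - c).
    have : 0 <= `|G n (u - d) - c| by []. lra.
  rewrite E (le_trans (ler_normB _ _))//.
  have : 0 <= d^-1 * `|x| by rewrite mulr_ge0// invr_ge0 ltW.
  by rewrite mulrDl mul1r; lra.
have bd n : `|smoothed_saw n u - W' u| <= e n + (1 + d^-1) * nu n.
  have mT := @mtorus R.
  have ik := continuous_torus_integrable (kap_continuous (n := n)).
  have is_ := continuous_torus_integrable (@kap_saw_cont n u).
  have im : leb.-integrable (torus R) (EFin \o (fun x => kap n x * `|x|)).
    apply: continuous_torus_integrable => x; apply: cvgM; first exact: kap_continuous.
    exact: norm_continuous.
  have -> : smoothed_saw n u - W' u =
      \int[leb]_(x in torus R) (kap n x * saw n (x + u) - W' u * kap n x).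
    rewrite RintegralB//; last exact: integrable_scale.
    by rewrite RintegralZl// kap_integral mulr1.
  have i : leb.-integrable (torus R) (EFin \o (fun x => kap n x * saw n (x + u) - W' u * kap n x)).
    by apply: integrable_sub => //; exact: integrable_scale.
  rewrite (le_trans (le_normr_Rintegral mT i))//.
  have -> : e n + (1 + d^-1) * nu n =
      \int[leb]_(x in torus R) (e n * kap n x + (1 + d^-1) * (kap n x * `|x|)).
    rewrite RintegralD//; [|exact: integrable_scale|exact: integrable_scale].
    by rewrite (RintegralZl (e n) mT (ik _)) (RintegralZl _ mT im) kap_integral mulr1.
  apply: le_Rintegral => //; first exact: integrable_norm.
    by apply: integrable_add => //; exact: integrable_scale.
  move=> x _; rewrite [W' u * _]mulrC -mulrBr normrM ger0_norm ?kap_ge0//.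
  rewrite (le_trans (ler_wpM2l (kap_ge0 n x) (key n x)))//.
  by rewrite le_eqVlt; apply/orP; left; apply/eqP; ring.
apply/subr_cvg0; apply/norm_cvg0P.
apply: (@squeeze_cvgr _ _ _ _ (fun=> 0) (fun n => e n + (1 + d^-1) * nu n)).
- by apply: nearW => n; rewrite normr_ge0 bd.
- exact: cvg_cst.
- rewrite -[X in _ --> X]addr0; apply: cvgD => //.
  by rewrite -[X in _ --> X](mulr0 (1 + d^-1)); apply: cvgMr; exact: kap_moment.
Qed.

End smoothed_sawtooth.

(** * Stability of the interaction force *)

Section field_stability.
Context {R : realType}.
Local Notation leb := (@lebesgue_measure R).
Implicit Types (mu nu : probability (R * R)%type R) (x y u : R) (n : nat).

Lemma conv_Fubini mu (psi h : R -> R) (A C : R) :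
  measurable_fun setT psi -> measurable_fun setT h ->
  (forall x, `|psi x| <= A) -> (forall x, `|h x| <= C) ->
  \int[leb]_(x in torus R) (psi x * conv mu h x) =
  \int[mu]_z \int[leb]_(x in torus R) (psi x * h (x - z.1)).
Proof.
move=> mpsi mh psiA hC.
have A0 : 0 <= A by apply: le_trans (psiA 0).
pose F (z : measurableTypeR R * (R * R)) := psi z.1 * h (z.1 - z.2.1).
have mF : measurable_fun setT F.
  apply: measurable_funM; first exact: (measurableT_comp mpsi).
  apply: (measurableT_comp mh); apply: measurable_funB => //.
  exact: (measurableT_comp measurable_fst).
have FC z : `|F z| <= A * C by rewrite /F normrM ler_pM.
rewrite -(Rintegral_Fubini (@mtorus R) measurableT torus_lty (prob_lty mu) mF FC).
apply: eq_Rintegral => x _; rewrite /conv -RintegralZl//.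
exact: conv_integrable hC.
Qed.

Lemma measurable_torus_param mu (psi h : R -> R) (A C : R) :
  measurable_fun setT psi -> measurable_fun setT h ->
  (forall x, `|psi x| <= A) -> (forall x, `|h x| <= C) ->
  measurable_fun setT
    (fun z : R * R => \int[leb]_(x in torus R) (psi x * h (x - z.1))).
Proof.
move=> mpsi mh psiA hC.
have A0 : 0 <= A by apply: le_trans (psiA 0).
pose F (z : measurableTypeR R * (R * R)) := psi z.1 * h (z.1 - z.2.1).
have mF : measurable_fun setT F.
  apply: measurable_funM; first exact: (measurableT_comp mpsi).
  apply: (measurableT_comp mh); apply: measurable_funB => //.
  exact: (measurableT_comp measurable_fst).
have FC z : `|F z| <= A * C by rewrite /F normrM ler_pM.
exact: (measurable_Rintegral21 (@mtorus R) measurableT torus_lty (prob_lty mu) mF FC).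
Qed.

(** A bound on the density that makes sense for every measure, and that passes to limits in [w1]
    since it only involves integrals of Lipschitz functions. *)
Definition dens_le mu (r : R) := forall n x, conv mu (kap n) x <= r.

Lemma conv_kap_ge0 mu n x : 0 <= conv mu (kap n) x.
Proof. by apply: Rintegral_ge0 => z _; exact: kap_ge0. Qed.

Lemma dens_le_ge0 mu r : dens_le mu r -> 0 <= r.
Proof. by move=> h; apply: le_trans (h 0%N 0); exact: conv_kap_ge0. Qed.

Lemma conv_lipschitz mu (h : R -> R) (C L : R) : measurable_fun setT h ->
  (forall x, `|h x| <= C) -> (forall x y, `|h x - h y| <= L * `|x - y|) ->
  forall x y, `|conv mu h x - conv mu h y| <= L * `|x - y|.
Proof.
move=> mh hC hL x y; rewrite /conv -RintegralB//; try exact: conv_integrable hC.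
apply: prob_norm_le => [|z].
  by apply: measurable_funB; exact: measurable_shift_fst.
by rewrite (le_trans (hL _ _))// (_ : x - z.1 - (y - z.1) = x - y)//; ring.
Qed.

Lemma lipschitz_continuous (f : R -> R) (L : R) :
  (forall x y, `|f x - f y| <= L * `|x - y|) -> continuous f.
Proof.
move=> hL x; apply/cvgrPdist_le => /= e e0.
have L0 : 0 <= L.
  by have := hL 1 0; rewrite subr0 normr1 mulr1; exact: le_trans.
near=> y; rewrite (le_trans (hL _ _))//.
apply: (@le_trans _ _ (L * (e / (L + 1)))); last first.
  by rewrite mulrCA ger_pMr// ler_pdivrMr ?mul1r ?lerDl// ltr_wpDl.
rewrite ler_wpM2l//; near: y.
have d0 : 0 < e / (L + 1) by rewrite divr_gt0// ltr_wpDl.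
by apply/nbhs_ballP; exists (e / (L + 1)) => //= y; rewrite /ball/= => /ltW.
Unshelve. all: by end_near. Qed.

Lemma conv_kap_lipschitz mu n : exists C, forall x y,
  `|conv mu (kap n) x - conv mu (kap n) y| <= C * `|x - y|.
Proof.
have [C hC] := kap_bounded (R := R) n; have [L hL] := kap_lipschitz (R := R) n.
exists L; apply: conv_lipschitz hC hL; exact: kap_measurable.
Qed.

Lemma is_derive_conv_saw mu n x :
  is_derive x (1 : R) (conv mu (saw n)) (1 - conv mu (kap n) x).
Proof.
have [C hC] := kap_bounded (R := R) n; have [L hL] := kap_lipschitz (R := R) n.
have -> : 1 - conv mu (kap n) x = conv mu (fun y => 1 - kap n y) x.
  rewrite /conv RintegralB//.
  - by rewrite prob_cst.
  - exact: finite_measure_integrable_cst.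
  - by apply: conv_integrable hC; exact: kap_measurable.
apply: (@conv_derive _ _ _ _ 2^-1 (1 + C) L).
- exact: is_derive_saw.
- exact: saw_bound.
- by move=> z; rewrite (le_trans (ler_normB _ _))// normr1 lerD2l.
- move=> z w; rewrite (_ : 1 - kap n z - (1 - kap n w) = kap n w - kap n z).
    by rewrite distrC.
  by ring.
- by move=> z; apply: cvgB; [exact: cvg_cst|exact: kap_continuous].
Qed.

Lemma conv_saw_lipschitz mu r n : dens_le mu r -> forall x y,
  `|conv mu (saw n) x - conv mu (saw n) y| <= (1 + r) * `|x - y|.
Proof.
move=> hr; apply: (derive_bound_lipschitz (is_derive_conv_saw mu n)) => z.
have := conv_kap_ge0 mu n z; have := hr n z => h1 h2.
by rewrite ler_norml; apply/andP; split; lra.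
Qed.

Lemma cvg_conv_saw mu x : conv mu (saw n) x @[n --> \oo] --> conv mu (@W' R) x.
Proof.
apply: (conv_cvg (C := 2^-1)).
- exact: saw_measurable.
- exact: W'_measurable.
- exact: saw_bound.
- exact: cvg_sawtooth.
Qed.

Lemma conv_W'_lipschitz mu r : dens_le mu r -> forall x y,
  `|conv mu (@W' R) x - conv mu (@W' R) y| <= (1 + r) * `|x - y|.
Proof.
move=> hr x y.
have h : `|conv mu (saw n) x - conv mu (saw n) y| @[n --> \oo] -->
    `|conv mu (@W' R) x - conv mu (@W' R) y|.
  by apply: cvg_norm; apply: cvgB; exact: cvg_conv_saw.
rewrite -(cvg_lim _ h)//; apply: limr_le; first by apply/cvg_ex; eexists; exact: h.
by apply: nearW => n; exact: conv_saw_lipschitz.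
Qed.

Lemma conv_W'_bound mu x : `|conv mu (@W' R) x| <= 2^-1.
Proof. by apply: conv_bound; [exact: W'_measurable|exact: W'_bound]. Qed.

Lemma conv_W'_measurable mu : measurable_fun setT (conv mu (@W' R)).
Proof.
apply: (measurable_fun_cvg (h := fun n => conv mu (saw n))).
  move=> n; apply: continuous_measurable_fun.
  exact: derive_continuous (is_derive_conv_saw mu n).
by move=> x _; exact: cvg_conv_saw.
Qed.

Definition saw_diff mu nu n x := conv mu (saw n) x - conv nu (saw n) x.

Lemma saw_diff_continuous mu nu n : continuous (saw_diff mu nu n).
Proof.
move=> x; apply: cvgB; exact: (derive_continuous (is_derive_conv_saw _ n)).
Qed.

Lemma saw_diff_bound mu nu n x : `|saw_diff mu nu n x| <= 1.
Proof.
rewrite (le_trans (ler_normB _ _))//.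
have b mu' : `|conv mu' (saw n) x| <= 2^-1.
  by apply: conv_bound; [exact: saw_measurable|exact: saw_bound].
by have := b mu; have := b nu; lra.
Qed.

(** For [y' <= y], monotonicity of [x - saw n x] gives [D <= y - y'] for the difference [D] of the
    two translates. Hence [|D| <= 2 (y - y') - D], and [D] has integral 0 over a period. *)
Lemma saw_L1_translation n y y' :
  \int[leb]_(x in torus R) `|saw n (x - y) - saw n (x - y')| <= 2 * `|y - y'|.
Proof.
wlog yy' : y y' / y' <= y.
  move=> wl; have [h|h] := leP y' y; first exact: wl.
  rewrite distrC; under eq_Rintegral do rewrite distrC; exact/wl/ltW.
have ci w : leb.-integrable (torus R) (EFin \o (fun x => saw n (x - w))).
  apply: (torus_integrable (C := 2^-1)); last by move=> x; exact: saw_bound.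
  by apply: (measurableT_comp (saw_measurable n)); exact: measurable_funB.
have mT := @mtorus R.
have tr w : \int[leb]_(x in torus R) saw n (x - w) = \int[leb]_(x in torus R) saw n x.
  exact: (torus_translation (- w) (saw_measurable n) (saw_bound n) (saw_periodic n)).
have key x : `|saw n (x - y) - saw n (x - y')| <=
    2 * (y - y') - (saw n (x - y') - saw n (x - y)).
  have : x - y - saw n (x - y) <= x - y' - saw n (x - y') by apply: saw_stair_mono; lra.
  by rewrite ler_norml => h; apply/andP; split; lra.
have i0 := integrable_sub mT (ci y) (ci y').
have i1 := integrable_sub mT (ci y') (ci y).
have ic : leb.-integrable (torus R) (EFin \o (fun=> 2 * (y - y'))).
  by apply: continuous_torus_integrable => x; exact: cvg_cst.
apply: (@le_trans _ _ (\int[leb]_(x in torus R) (2 * (y - y') - (saw n (x - y') - saw n (x - y))))).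
  apply: le_Rintegral => //; first exact: integrable_norm.
  exact: integrable_sub.
rewrite (RintegralB mT ic i1) (RintegralB mT (ci y') (ci y)) !tr subrr subr0.
by rewrite Rintegral_torus_cst ger0_norm// subr_ge0.
Qed.

(** With [s] the sign of [saw_diff], Fubini's theorem turns the norm into the difference of the
    integrals of one test function, the integral of [s x * saw n (x - z.1)] in [x], which is
    2-Lipschitz by [saw_L1_translation]. *)
Lemma saw_diff_L1 mu nu n : in_P1 mu -> in_P1 nu ->
  \int[leb]_(x in torus R) `|saw_diff mu nu n x| <= 2 * w1 mu nu.
Proof.
move=> P1 P2.
pose s x : R := if 0 <= saw_diff mu nu n x then 1 else -1.
have ms : measurable_fun setT s.
  apply: measurable_fun_ifT => //.
  apply: measurable_fun_ler; first exact: measurable_cst.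
  exact: continuous_measurable_fun (saw_diff_continuous (n:=n)).
have s1 x : `|s x| <= 1 by rewrite /s; case: ifP => _; rewrite ?normrN normr1.
have b mu' x : `|conv mu' (saw n) x| <= 2^-1.
  by apply: conv_bound; [exact: saw_measurable|exact: saw_bound].
have i mu' : leb.-integrable (torus R) (EFin \o (fun x => s x * conv mu' (saw n) x)).
  apply: (torus_integrable (C := 1 * 2^-1)); last by move=> x; rewrite normrM ler_pM.
  apply: measurable_funM => //; apply: continuous_measurable_fun.
  exact: derive_continuous (is_derive_conv_saw mu' n).
have mT := @mtorus R.
have -> : \int[leb]_(x in torus R) `|saw_diff mu nu n x| =
  \int[leb]_(x in torus R) (s x * conv mu (saw n) x - s x * conv nu (saw n) x).
  apply: eq_Rintegral => x _; rewrite -mulrBr -/(saw_diff mu nu n x) /s.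
  by case: leP => h; [rewrite mul1r ger0_norm|rewrite mulN1r ltr0_norm].
rewrite (RintegralB mT (i mu) (i nu)).
rewrite !(conv_Fubini _ ms (saw_measurable n) s1 (saw_bound n)).
apply: w1_ub => //; split.
  move=> v x; apply: eq_Rintegral => y _ /=.
  by rewrite opprD addrA -(saw_periodic n (y - x - 1)) subrK.
move=> z w.
have iz z' : leb.-integrable (torus R) (EFin \o (fun x => s x * saw n (x - z'))).
  apply: (torus_integrable (C := 1 * 2^-1)); last first.
    by move=> x; rewrite normrM ler_pM// saw_bound.
  apply: measurable_funM => //.
  by apply: (measurableT_comp (saw_measurable n)); exact: measurable_funB.
rewrite -(RintegralB mT (iz _) (iz _)).
rewrite (le_trans (le_normr_Rintegral mT (integrable_sub mT (iz _) (iz _))))//.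
apply: (@le_trans _ _ (2 * `|z.1 - w.1|)); last first.
  by rewrite ler_wpM2l// euclidean_dist_ge1.
apply: le_trans (saw_L1_translation n z.1 w.1).
have ci w' : leb.-integrable (torus R) (EFin \o (fun x => saw n (x - w'))).
  apply: (torus_integrable (C := 2^-1)); last by move=> x; exact: saw_bound.
  by apply: (measurableT_comp (saw_measurable n)); exact: measurable_funB.
apply: le_Rintegral => //.
- by apply: integrable_norm; exact: integrable_sub.
- by apply: integrable_norm; exact: integrable_sub.
- by move=> x _; rewrite -mulrBr normrM ler_piMl.
Qed.

Lemma is_derive_sqr_sign (s : R) :
  is_derive s (1 : R) (fun t => t * `|t| / 2) `|s|.
Proof.
apply: (@is_derive_quad _ _ _ _ _ _ 1) => h _; rewrite /GRing.scale/= mulr1 mul1r.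
rewrite ler_norml.
have [hs|hs] := leP 0 (h + s); have [s0|s0] := leP 0 s.
- by rewrite !ger0_norm//; apply/andP; split; nra.
- by rewrite (ger0_norm hs) (ltr0_norm s0); apply/andP; split; nra.
- by rewrite (ltr0_norm hs) (ger0_norm s0); apply/andP; split; nra.
- by rewrite (ltr0_norm hs) (ltr0_norm s0); apply/andP; split; nra.
Qed.

End field_stability.

Section field_stability2.
Context {R : realType}.
Local Notation leb := (@lebesgue_measure R).
Implicit Types (mu nu : probability (R * R)%type R) (x y u : R) (n : nat).

(** The smoothing by [kap n] is moved onto the sawtooth, where convergence is known at every point;
    an atom of a marginal at [y] does no harm. *)
Lemma cvg_kap_saw_diff mu nu y :
  \int[leb]_(x in torus R) (kap n (x - y) * saw_diff mu nu n x) @[n --> \oo] -->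
  conv mu (@W' R) y - conv nu (@W' R) y.
Proof.
have mT := @mtorus R.
have E n : \int[leb]_(x in torus R) (kap n (x - y) * saw_diff mu nu n x) =
    conv mu (smoothed_saw n) y - conv nu (smoothed_saw n) y.
  have [C hC] := kap_bounded (R := R) n.
  have mk w : measurable_fun setT (fun x => kap n (x + w)).
    by apply: (measurableT_comp (kap_measurable n)); exact: measurable_funD.
  have bs mu' x : `|conv mu' (saw n) x| <= 2^-1.
    by apply: conv_bound; [exact: saw_measurable|exact: saw_bound].
  have i mu' : leb.-integrable (torus R) (EFin \o (fun x => kap n (x - y) * conv mu' (saw n) x)).
    apply: (torus_integrable (C := C * 2^-1)); last by move=> x; rewrite normrM ler_pM.
    apply: measurable_funM; first exact: mk.
    apply: continuous_measurable_fun.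
    exact: derive_continuous (is_derive_conv_saw mu' n).
  have h mu' : \int[leb]_(x in torus R) (kap n (x - y) * conv mu' (saw n) x) =
      conv mu' (smoothed_saw n) y.
    rewrite (conv_Fubini mu' (mk (- y)) (saw_measurable n) (fun x => hC _) (saw_bound n)).
    apply: eq_Rintegral => z _; rewrite /smoothed_saw.
    have mf : measurable_fun setT (fun x => kap n x * saw n (x + (y - z.1))).
      apply: measurable_funM; first exact: kap_measurable.
      by apply: (measurableT_comp (saw_measurable n)); exact: measurable_funD.
    rewrite -(@torus_translation _ _ (- y) (C * 2^-1) mf).
    - apply: eq_Rintegral => x _; congr (_ * saw n _); ring.
    - by move=> x; rewrite normrM ler_pM// saw_bound.
    - move=> x; rewrite kap_periodic; congr (_ * _).
      by rewrite addrAC saw_periodic.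
  rewrite -!h -(RintegralB mT (i mu) (i nu)).
  by apply: eq_Rintegral => x _; rewrite -mulrBr.
under eq_fun do rewrite E.
have ms n : measurable_fun setT (smoothed_saw (R := R) n).
  have [L _ hL] := smoothed_saw_lipschitz (R := R) n.
  exact: continuous_measurable_fun (lipschitz_continuous hL).
by apply: cvgB; apply: (conv_cvg (C := 2^-1)) => //;
  [exact: W'_measurable|exact: smoothed_saw_bound|exact: cvg_smoothed_saw|
   exact: W'_measurable|exact: smoothed_saw_bound|exact: cvg_smoothed_saw].
Qed.

(* Integrating the derivative of [g * `|g| / 2] over the period, where
   [g = saw_diff mu nu n] satisfies [g' = (nu - mu) * kap n]. *)
Lemma saw_diff_energy mu nu n :
  \int[leb]_(x in torus R) (`|saw_diff mu nu n x| * conv nu (kap n) x) =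
  \int[leb]_(x in torus R) (`|saw_diff mu nu n x| * conv mu (kap n) x).
Proof.
have mT := @mtorus R.
set g := saw_diff mu nu n.
have ck mu' : continuous (conv mu' (kap n)).
  by have [L hL] := conv_kap_lipschitz mu' n; exact: lipschitz_continuous hL.
have cg : continuous g := saw_diff_continuous (n := n).
have cgn : continuous (fun x => `|g x|).
  by move=> x; apply: cvg_norm; exact: cg.
have cM mu' : continuous (fun x => `|g x| * conv mu' (kap n) x).
  by move=> x; apply: cvgM; [exact: cgn|exact: ck].
have dg x : is_derive x (1 : R) g (conv nu (kap n) x - conv mu (kap n) x).
  apply: (is_derive_eq (is_deriveB (is_derive_conv_saw mu n x) (is_derive_conv_saw nu n x))).
  by ring.
have dG x : is_derive x (1 : R) (fun y => g y * `|g y| / 2)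
    (`|g x| * conv nu (kap n) x - `|g x| * conv mu (kap n) x).
  have := @is_derive1_comp _ (fun t : R => t * `|t| / 2) g x _ _ (is_derive_sqr_sign _) (dg x).
  by rewrite mulrBr.
apply/eqP; rewrite -subr_eq0 -RintegralB//; last 2 first.
- exact: continuous_torus_integrable.
- exact: continuous_torus_integrable.
rewrite (torus_FTC2 dG); last first.
  by move=> x; apply: cvgB; exact: cM.
have pg : periodic g 1.
  by move=> x; rewrite /g /saw_diff !(conv_periodic _ (saw_periodic n)).
have -> : g (- 2^-1) = g 2^-1 by rewrite -(pg (- 2^-1)); congr g; lra.
by rewrite subrr.
Qed.

Lemma conv_W'_stability mu nu r : in_P1 mu -> in_P1 nu -> dens_le mu r ->
  \int[nu]_z `|conv mu (@W' R) z.1 - conv nu (@W' R) z.1| <= 2 * r * w1 mu nu.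
Proof.
move=> P1 P2 hr; have r0 := dens_le_ge0 hr.
have mT := @mtorus R.
pose m n y := \int[leb]_(x in torus R) (kap n (x - y) * saw_diff mu nu n x).
have mdiff n : measurable_fun setT (saw_diff mu nu n).
  exact: continuous_measurable_fun (saw_diff_continuous (n := n)).
have mk n y : measurable_fun setT (fun x => kap n (x - y)).
  by apply: (measurableT_comp (kap_measurable n)); exact: measurable_funB.
have kint n y : \int[leb]_(x in torus R) kap n (x - y) = 1.
  have [C hC] := kap_bounded (R := R) n.
  by rewrite (torus_translation (- y) (kap_measurable n) hC (kap_periodic n)) kap_integral.
have ik n y : leb.-integrable (torus R) (EFin \o (fun x => kap n (x - y))).
  have [C hC] := kap_bounded (R := R) n.
  exact: (torus_integrable (C := C)).
have b n x : `| `|saw_diff mu nu n x| | <= 1 by rewrite normr_id saw_diff_bound.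
have mabs n : measurable_fun setT (fun x => `|saw_diff mu nu n x|).
  exact: measurableT_comp.
have ikd n y : leb.-integrable (torus R) (EFin \o (fun x => kap n (x - y) * saw_diff mu nu n x)).
  have [C hC] := kap_bounded (R := R) n.
  apply: (torus_integrable (C := C * 1)); first exact: measurable_funM.
  by move=> x; rewrite normrM ler_pM// saw_diff_bound.
have ika n y : leb.-integrable (torus R) (EFin \o (fun x => `|saw_diff mu nu n x| * kap n (x - y))).
  have [C hC] := kap_bounded (R := R) n.
  apply: (torus_integrable (C := 1 * C)); first exact: measurable_funM.
  by move=> x; rewrite normrM ler_pM.
have bm n y : `|m n y| <= 1.
  rewrite /m (le_trans (le_normr_Rintegral mT (ikd n y)))// -(kint n y).
  apply: le_Rintegral => //; first exact: integrable_norm.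
  by move=> x _; rewrite normrM ger0_norm ?kap_ge0// ler_piMr ?kap_ge0// saw_diff_bound.
have step n : \int[nu]_z `|m n z.1| <= 2 * r * w1 mu nu.
  have [C hC] := kap_bounded (R := R) n.
  have kN : kap n = fun x => kap n (- x) by apply/funext => x; rewrite kap_even.
  apply: (@le_trans _ _ (\int[nu]_z \int[leb]_(x in torus R) (`|saw_diff mu nu n x| * kap n (x - z.1)))).
    have mm : measurable_fun setT (fun z : R * R => m n z.1).
      have := measurable_torus_param nu (mdiff n) (kap_measurable n)
        (saw_diff_bound mu nu n) hC.
      apply: eq_measurable_fun => z _.
      by apply: eq_Rintegral => x _; rewrite mulrC.
    apply: le_Rintegral => //.
    - by apply: integrable_norm; apply: (prob_integrable nu mm (C := 1)).
    - apply: (prob_integrable nu (C := 1)).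
        exact: (measurable_torus_param nu (mabs n) (kap_measurable n) (b n) hC).
      move=> z; rewrite (le_trans (le_normr_Rintegral mT (ika n z.1)))// -(kint n z.1).
      apply: le_Rintegral => //; first exact: integrable_norm.
      by move=> x _; rewrite normrM mulrC (ger0_norm (kap_ge0 _ _)) ler_piMr ?kap_ge0.
    move=> z _; rewrite /m (le_trans (le_normr_Rintegral mT (ikd n z.1)))//.
    apply: le_Rintegral => //; first exact: integrable_norm.
    by move=> x _; rewrite normrM mulrC (ger0_norm (kap_ge0 _ _)).
  (* [nu], which may have atoms, is exchanged here for [mu], whose smoothed density is at most
     [r]. *)
  rewrite -(conv_Fubini nu (mabs n) (kap_measurable n) (b n) hC) saw_diff_energy.
  have ia : leb.-integrable (torus R) (EFin \o (fun x => `|saw_diff mu nu n x|)).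
    exact: (torus_integrable (C := 1)).
  have ck : measurable_fun setT (conv mu (kap n)).
    have [L hL] := conv_kap_lipschitz mu n.
    exact: continuous_measurable_fun (lipschitz_continuous hL).
  apply: (@le_trans _ _ (r * \int[leb]_(x in torus R) `|saw_diff mu nu n x|)).
    rewrite -(RintegralZl r mT ia); apply: le_Rintegral => //.
    - apply: (torus_integrable (C := 1 * r)); first exact: measurable_funM.
      by move=> x; rewrite normrM ler_pM// ger0_norm ?conv_kap_ge0.
    - exact: integrable_scale.
    by move=> x _; rewrite mulrC ler_wpM2r.
  rewrite (_ : 2 * r * w1 mu nu = r * (2 * w1 mu nu)); last by ring.
  by rewrite ler_wpM2l//; exact: saw_diff_L1.
have h : \int[nu]_z `|m n z.1| @[n --> \oo] -->
    \int[nu]_z `|conv mu (@W' R) z.1 - conv nu (@W' R) z.1|.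
  apply: (Rintegral_cvg measurableT (prob_lty nu) (C := 1)).
  - move=> n; apply: measurableT_comp => //.
    have [C hC] := kap_bounded (R := R) n.
    have := measurable_torus_param nu (mdiff n) (kap_measurable n)
      (saw_diff_bound mu nu n) hC.
    apply: eq_measurable_fun => z _.
    by apply: eq_Rintegral => x _; rewrite mulrC.
  - apply: measurableT_comp => //; apply: measurable_funB.
      exact: (measurableT_comp (conv_W'_measurable mu)).
    exact: (measurableT_comp (conv_W'_measurable nu)).
  - by move=> n z _; rewrite normr_id.
  - by move=> z _; apply: cvg_norm; exact: cvg_kap_saw_diff.
rewrite -(cvg_lim _ h)//; apply: limr_le; first by apply/cvg_ex; eexists; exact: h.
exact: nearW.
Qed.

(* A function with Lipschitz constant [2 * (1 + r)] and [L^1] norm at most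
   [2 * w1 mu nu] exceeds [p] minus the first term on a window of length
   [2 * lam]. *)
Lemma conv_W'_sup_stability mu nu r lam x : in_P1 mu -> in_P1 nu ->
  dens_le mu r -> dens_le nu r -> 0 < lam <= 2^-1 ->
  `|conv mu (@W' R) x - conv nu (@W' R) x| <=
  2 * (1 + r) * lam + w1 mu nu / lam.
Proof.
move=> P1 P2 hmu hnu /andP[l0 l2]; have mT := @mtorus R.
have r0 := dens_le_ge0 hmu.
have h : `|saw_diff mu nu n x| @[n --> \oo] -->
    `|conv mu (@W' R) x - conv nu (@W' R) x|.
  by apply: cvg_norm; apply: cvgB; exact: cvg_conv_saw.
rewrite -(cvg_lim _ h)//; apply: limr_le; first by apply/cvg_ex; eexists; exact: h.
apply: nearW => n; set p := `|_|.
have hl y : `|saw_diff mu nu n x - saw_diff mu nu n (y + x)| <= 2 * (1 + r) * `|y|.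
  have h1 := conv_saw_lipschitz n hmu x (y + x).
  have h2 := conv_saw_lipschitz n hnu x (y + x).
  have e : x - (y + x) = - y by ring.
  rewrite e normrN in h1 h2.
  rewrite /saw_diff (_ : _ - _ = (conv mu (saw n) x - conv mu (saw n) (y + x)) -
    (conv nu (saw n) x - conv nu (saw n) (y + x))); last by ring.
  by rewrite (le_trans (ler_normB _ _))// mulrAC; lra.
have md : measurable_fun setT (fun y => `|saw_diff mu nu n y|).
  apply: measurableT_comp => //.
  exact: continuous_measurable_fun (saw_diff_continuous (n := n)).
have bd y : `| `|saw_diff mu nu n y| | <= 1 by rewrite normr_id saw_diff_bound.
have pd : periodic (fun y => `|saw_diff mu nu n y|) 1.
  by move=> y; rewrite /saw_diff !(conv_periodic _ (saw_periodic n)).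
pose I := (`[- lam, lam[%classic : set (measurableTypeR R)).
pose c := p - 2 * (1 + r) * lam.
have mI : measurable I by exact: measurable_itv.
have md' : measurable_fun setT (fun y => `|saw_diff mu nu n (y + x)|).
  by apply: (measurableT_comp md); exact: measurable_funD.
have id' : leb.-integrable (torus R) (EFin \o (fun y => `|saw_diff mu nu n (y + x)|)).
  exact: (torus_integrable (C := 1)).
have ITE : I = torus R `&` I.
  by apply/seteqP; split => [y Iy|y []//]; split => //; move: Iy; rewrite /I /torus/= !in_itv/=;
    move=> /andP[? ?]; apply/andP; split; lra.
have LI : leb `[- lam, lam[%classic = (2 * lam)%:E.
  rewrite lebesgue_measure_itv/= ifT; last by rewrite lte_fin; lra.
  by rewrite -EFinB; congr EFin; ring.
have : c * (2 * lam) <= 2 * w1 mu nu.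
  apply: le_trans (saw_diff_L1 n P1 P2).
  rewrite -(torus_translation x md bd pd).
  apply: (@le_trans _ _ (\int[leb]_(y in I) `|saw_diff mu nu n (y + x)|)).
    have -> : c * (2 * lam) = \int[leb]_(y in I) c.
      rewrite Rintegral_cst//; congr (_ * _).
      rewrite -[LHS]/(fine (2 * lam)%:E); congr fine.
      exact/esym/LI.
    apply: le_Rintegral => //.
    - apply: (@bounded_integrable _ _ _ leb _ mI _ (cst c) `|c|) => //.
      by rewrite -[X in (X < _)%E]/(leb `[- lam, lam[%classic) LI ltry.
    - by apply: integrableS id' => //; rewrite ITE => y [].
    move=> y; rewrite /I/= in_itv/= => /andP[y1 y2].
    have yl : `|y| <= lam by rewrite ler_norml; apply/andP; split; lra.
    have := hl y; have : 2 * (1 + r) * `|y| <= 2 * (1 + r) * lam.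
      by rewrite ler_wpM2l// mulr_ge0// addr_ge0.
    rewrite /c /p; set a := saw_diff _ _ _ x; set b := saw_diff _ _ _ _.
    have : `|a| <= `|a - b| + `|b| by rewrite -{1}(subrK b a) ler_normD.
    lra.
  rewrite ITE Rintegral_mkcondr; apply: le_Rintegral => //.
    rewrite -restrict_EFin; apply/integrable_restrict => //.
    have TI : measurable (torus R `&` I) := measurableI _ _ mT mI.
    by apply: (integrableS mT TI _ id') => y [].
  by move=> y _; rewrite patchE; case: ifP => _; [exact: lexx|exact: normr_ge0].
have -> : 2 * (1 + r) * lam = p - c by rewrite /c; ring.
move=> hc; rewrite -lerBlDl opprB addrC subrK ler_pdivlMr//; lra.
Qed.

End field_stability2.

(** * The Boltzmann potential *)

Section marginal.
Context {R : realType}.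
Implicit Types (mu nu : probability (R * R)%type R) (h : R -> R).

Lemma Rintegral_xmarginal mu h (C x : R) : in_P1 mu -> measurable_fun setT h ->
  (forall y, `|h y| <= C) ->
  \int[xmarginal mu]_(y in torus R) h (x - y) = conv mu h x.
Proof.
move=> [mu1 _] mh hC; rewrite /conv /Rintegral; congr fine.
have mh' : measurable_fun setT (fun y : R => h (x - y)).
  by apply: (measurableT_comp mh); exact: measurable_funB.
have mX : measurable (@xproj R @^-1` torus R).
  by rewrite -[X in measurable X]setTI; exact: measurable_fst (measurable_torus R).
have mXE : @xproj R @^-1` torus R = torus R `*` [set: R].
  by apply/seteqP; split => [z ?|z []//]; split.
have ih : mu.-integrable setT (EFin \o (fun z : R * R => h (x - z.1))).
  exact: conv_integrable hC.
have N0 : mu (~` (@xproj R @^-1` torus R)) = 0%E.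
  by rewrite probability_setC// mXE mu1 subee.
rewrite (@integral_pushforward _ _ _ _ _ (@xproj R) measurable_fst mu (torus R)
    (fun y => (h (x - y))%:E)) //; first last.
- exact: measurable_torus.
- by apply: (integrableS measurableT mX _ ih).
- exact/measurable_EFinP.
rewrite [RHS](@negligible_integral _ _ _ mu setT (~` (@xproj R @^-1` torus R)))//.
- by rewrite setTD setCK.
- exact: measurableC.
Qed.

Lemma W_continuous : continuous (@W R).
Proof. exact: lipschitz_continuous (@W_lipschitz R). Qed.

Lemma W_norm (x : R) : `|W x| <= 8^-1.
Proof. by have /andP[? ?] := W_bounds x; rewrite ler_norml; apply/andP; split; lra. Qed.

Lemma EbarE mu eps x : in_P1 mu ->
  Ebar eps (xmarginal mu) x = - (eps ^- 2 * conv mu (@W' R) x).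
Proof.
by move=> P1; rewrite /Ebar (Rintegral_xmarginal x P1 (@W'_measurable R) (@W'_bound R)).
Qed.

Lemma UbarE mu eps x : in_P1 mu ->
  Ubar eps (xmarginal mu) x = eps ^- 2 * conv mu (@W R) x.
Proof.
move=> P1; rewrite /Ubar (Rintegral_xmarginal x P1 _ W_norm)//.
exact: continuous_measurable_fun W_continuous.
Qed.

Lemma Ubar_bounds mu eps x : in_P1 mu -> 0 < eps ->
  - (8 * eps ^+ 2)^-1 <= Ubar eps (xmarginal mu) x <= 0.
Proof.
move=> P1 e0; rewrite UbarE//.
have e2 : 0 < eps ^+ 2 by rewrite exprn_gt0.
have mW := continuous_measurable_fun W_continuous.
have b : `|conv mu (@W R) x| <= 8^-1 by apply: conv_bound => //; exact: W_norm.
have n0 : conv mu (@W R) x <= 0.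
  rewrite -(prob_cst mu 0); apply: le_Rintegral => //.
  - by apply: conv_integrable mW _; exact: W_norm.
  - exact: finite_measure_integrable_cst.
  - by move=> z _; have /andP[] := W_bounds (x - z.1).
apply/andP; split; last by rewrite mulr_ge0_le0// invr_ge0 ltW.
rewrite invfM mulrC -mulrN ler_wpM2l ?invr_ge0 ?(ltW e2)//.
by move: b; rewrite ler_norml => /andP[].
Qed.

Lemma Ubar_stability mu nu eps x : in_P1 mu -> in_P1 nu -> 0 < eps ->
  `|Ubar eps (xmarginal mu) x - Ubar eps (xmarginal nu) x| <=
  (2 * eps ^+ 2)^-1 * w1 mu nu.
Proof.
move=> P1 P2 e0; rewrite !UbarE// -mulrBr normrM.
rewrite ger0_norm ?invr_ge0 ?exprn_ge0 ?(ltW e0)//.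
rewrite [leRHS](_ : _ = eps ^- 2 * (2^-1 * w1 mu nu)); last by rewrite invfM; ring.
rewrite ler_wpM2l ?invr_ge0 ?exprn_ge0 ?(ltW e0)//.
by apply: conv_w1 => //; [exact: W_periodic|exact: W_lipschitz].
Qed.

End marginal.

(** * Maximum principle for periodic functions *)

Section maximum_principle.
Context {R : realType}.
Implicit Types f df ddf : R -> R.

Lemma periodic_max f : continuous f -> periodic f 1 ->
  exists x0, forall x, f x <= f x0.
Proof.
move=> cf pf.
have [||x0 _ hx0] := @EVT_max R f (- 2^-1) 2^-1; first lra.
  exact: continuous_subspaceT.
exists x0 => x; rewrite -(periodic_repr x pf); apply: hx0.
have /andP[? ?] := torus_repr_itv x.
by rewrite in_itv/=; apply/andP; split; lra.
Qed.

Lemma derive_at_max f df x0 : (forall x, is_derive x (1 : R) f (df x)) ->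
  (forall x, f x <= f x0) -> df x0 = 0.
Proof.
move=> hf hmax.
have := @derive1_at_max R f (x0 - 1) (x0 + 1) x0 ltac:(lra).
move=> /(_ (fun t _ => @ex_derive _ _ _ _ _ _ _ (hf t))).
have h0 : x0 \in `](x0 - 1), (x0 + 1)[%R by rewrite in_itv/=; apply/andP; split; lra.
move=> /(_ h0 (fun t _ => hmax t)) h.
by rewrite -(@derive_val _ _ _ _ _ _ _ (hf x0)) (@derive_val _ _ _ _ _ _ _ h).
Qed.

(** Were the second derivative positive, [df] would be positive just after [x0], and the mean value
    theorem would push [f] above its maximum. *)
Lemma second_derive_at_max f df ddf x0 :
  (forall x, is_derive x (1 : R) f (df x)) ->
  (forall x, is_derive x (1 : R) df (ddf x)) ->
  (forall x, f x <= f x0) -> ddf x0 <= 0.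
Proof.
move=> hf hdf hmax; rewrite leNgt; apply/negP => c0.
have d0 := derive_at_max hf hmax.
have L : h^-1 *: (df (h *: 1 + x0) - df x0) @[h --> (0:R)^'] --> ddf x0.
  have [+ <-] := hdf x0; exact.
have : \forall h \near (0:R)^', 0 < h^-1 *: (df (h *: 1 + x0) - df x0).
  exact: (cvgr_gt _ L).
rewrite /dnbhs/within/= => /nbhs_ballP[e /= e0 he].
pose k := e / 2.
have k0 : 0 < k by rewrite divr_gt0.
have pos t : 0 < t <= k -> 0 < df (x0 + t).
  move=> /andP[t0 tk].
  have : 0 < t^-1 *: (df (t *: 1 + x0) - df x0).
    apply: he; last by rewrite gt_eqF.
    rewrite /ball/= sub0r normrN gtr0_norm//; rewrite /k in tk; lra.
  by rewrite d0 subr0 /GRing.scale/= mulr1 addrC pmulr_rgt0// invr_gt0.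
have [||c + E] := @MVT R f df x0 (x0 + k); first lra.
  exact/continuous_subspaceT/(derive_continuous hf).
rewrite in_itv/= => /andP[c1 c2].
have := hmax (x0 + k); rewrite -subr_le0 E [x0 + k - x0]addrAC subrr add0r.
apply/negP; rewrite -ltNge mulr_gt0//.
by rewrite -(subrKC x0 c); apply: pos; apply/andP; split; lra.
Qed.

(** By the mean value theorem [df] vanishes somewhere in the period after [x], at distance at most
    one. *)
Lemma periodic_derive_bound f df (L : R) :
  (forall x, is_derive x (1 : R) f (df x)) -> periodic f 1 ->
  (forall x y, `|df x - df y| <= L * `|x - y|) -> forall x, `|df x| <= L.
Proof.
move=> hf pf hL x.
have L0 : 0 <= L.
  by have := hL 1 0; rewrite subr0 normr1 mulr1; exact: le_trans.
have [||c + E] := @MVT R f df x (x + 1); first lra.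
  exact/continuous_subspaceT/(derive_continuous hf).
rewrite in_itv/= => /andP[c1 c2].
have dc : df c = 0.
  by move: E; rewrite pf subrr [x + 1 - x]addrAC subrr add0r mulr1.
have := hL x c; rewrite dc subr0 => /le_trans; apply.
by rewrite ler_piMr// ler_norml; apply/andP; split; lra.
Qed.

Lemma periodic_derive f df : (forall x, is_derive x (1 : R) f (df x)) ->
  periodic f 1 -> periodic df 1.
Proof.
move=> hf pf x.
have h : is_derive x (1 : R) (fun y => y + 1) 1.
  by apply: (is_derive_eq (is_deriveD (is_derive_id x (1:R)) (is_derive_cst (1:R) x (1:R)))); rewrite addr0.
have := @is_derive1_comp _ f _ x _ _ (hf (x + 1)) h.
rewrite mulr1 (_ : f \o _ = f); last by apply/funext => y; exact: pf.
move=> h'; rewrite -(@derive_val _ _ _ _ _ _ _ h').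
exact: (@derive_val _ _ _ _ _ _ _ (hf x)).
Qed.

End maximum_principle.

(** * Bounds and stability for the nonlinear Poisson equation *)

Section Uhat.
Context {R : realType}.
Implicit Types (mu nu : probability (R * R)%type R) (u : R -> R) (eps : R).

(** A bound for [e^(Ubar + Uhat)]: the values of [Ubar] lie in an interval of length
    [1 / (8 eps^2)], because those of [W] lie in [[-1/8, 0]]. *)
Definition expU eps : R := expR ((8 * eps ^+ 2)^-1).

Lemma is_Uhat_derive eps (rho : probability R R) u : is_Uhat eps rho u ->
  (forall x, is_derive x (1 : R) u (derive1 u x)) /\
  (forall x, is_derive x (1 : R) (derive1 u) (derive1n 2 u x)).
Proof.
move=> [_ h1 h2 _]; split => x.
  by rewrite derive1E; exact/derivableP.
by rewrite derive1nS derive1n1 derive1E; exact/derivableP.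
Qed.

(** At a maximum [x0] of [u] the equation forces [Ubar + u <= 0]; passing from [x0] to [x] then
    costs at most the oscillation of [Ubar]. *)
Lemma is_Uhat_le mu eps u x : in_P1 mu -> 0 < eps ->
  is_Uhat eps (xmarginal mu) u -> Ubar eps (xmarginal mu) x + u x <= (8 * eps ^+ 2)^-1.
Proof.
move=> P1 e0 hu; have [h1 h2] := is_Uhat_derive hu; have [pu _ _ eq] := hu.
have [x0 hx0] := periodic_max (derive_continuous h1) pu.
have := second_derive_at_max h1 h2 hx0.
rewrite -(pmulr_rle0 _ (exprn_gt0 2 e0)) eq subr_le0 expR_le1 => h.
have /andP[b1 b2] := Ubar_bounds x0 P1 e0.
have /andP[b3 b4] := Ubar_bounds x P1 e0.
have := hx0 x; lra.
Qed.

Lemma is_Uhat_derive2_bound mu eps u x : in_P1 mu -> 0 < eps ->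
  is_Uhat eps (xmarginal mu) u -> `|derive1n 2 u x| <= (eps ^+ 2)^-1 * expU eps.
Proof.
move=> P1 e0 hu; have [_ _ _ eq] := hu.
have e2 := exprn_gt0 2 e0.
rewrite -(ler_pM2l e2) mulrA mulfV ?gt_eqF// mul1r -[X in X * _](gtr0_norm e2) -normrM eq.
have h : expR (Ubar eps (xmarginal mu) x + u x) <= expU eps.
  by rewrite /expU ler_expR is_Uhat_le.
have h0 := expR_gt0 (Ubar eps (xmarginal mu) x + u x).
have h1 : 1 <= expU eps.
  by rewrite /expU -[leLHS]expR0 ler_expR invr_ge0 mulr_ge0// ltW.
by rewrite ler_norml; apply/andP; split; lra.
Qed.

Lemma is_Uhat_derive_lipschitz mu eps u : in_P1 mu -> 0 < eps ->
  is_Uhat eps (xmarginal mu) u ->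
  forall x y, `|derive1 u x - derive1 u y| <= (eps ^+ 2)^-1 * expU eps * `|x - y|.
Proof.
move=> P1 e0 hu; have [h1 h2] := is_Uhat_derive hu.
by apply: (derive_bound_lipschitz h2) => z; exact: is_Uhat_derive2_bound hu.
Qed.

Lemma is_Uhat_derive_bound mu eps u x : in_P1 mu -> 0 < eps ->
  is_Uhat eps (xmarginal mu) u -> `|derive1 u x| <= (eps ^+ 2)^-1 * expU eps.
Proof.
move=> P1 e0 hu; have [h1 h2] := is_Uhat_derive hu; have [pu _ _ _] := hu.
exact: (periodic_derive_bound h1 pu (is_Uhat_derive_lipschitz P1 e0 hu)).
Qed.

Lemma expR_lipschitz (B a b : R) : a <= B -> b <= B ->
  `|expR a - expR b| <= expR B * `|a - b|.
Proof.
move=> aB bB; wlog ab : a b aB bB / b <= a.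
  move=> wl; have [h|h] := leP b a; first exact: wl.
  by rewrite distrC (distrC a); apply: wl => //; exact: ltW.
have [|c + ->] := @MVT_segment R expR expR b a ab (fun x _ => is_derive_expR x).
  exact/continuous_subspaceT/continuous_expR.
rewrite in_itv/= => /andP[_ ca].
by rewrite normrM ler_wpM2r// ger0_norm ?expR_ge0// ler_expR (le_trans ca).
Qed.

(** At a maximum of [u1 - u2] the two equations give [Ubar1 + u1 <= Ubar2 + u2], so that [u1 - u2]
    is bounded by a difference of the explicit potentials. *)
Lemma is_Uhat_diff_le mu nu eps u1 u2 x : in_P1 mu -> in_P1 nu -> 0 < eps ->
  is_Uhat eps (xmarginal mu) u1 -> is_Uhat eps (xmarginal nu) u2 ->
  u1 x - u2 x <= (2 * eps ^+ 2)^-1 * w1 mu nu.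
Proof.
move=> P1 P2 e0 hu1 hu2.
have [h11 h12] := is_Uhat_derive hu1; have [h21 h22] := is_Uhat_derive hu2.
have [p1 _ _ eq1] := hu1; have [p2 _ _ eq2] := hu2.
pose w y := u1 y - u2 y.
have w1' y : is_derive y (1 : R) w (derive1 u1 y - derive1 u2 y).
  exact: is_deriveB (h11 y) (h21 y).
have w2' y : is_derive y (1 : R) (fun t => derive1 u1 t - derive1 u2 t)
    (derive1n 2 u1 y - derive1n 2 u2 y).
  exact: is_deriveB (h12 y) (h22 y).
have pw : periodic w 1 by move=> y; rewrite /w p1 p2.
have [x0 hx0] := periodic_max (derive_continuous w1') pw.
have := second_derive_at_max w1' w2' hx0.
have e1 := eq1 x0; have e2 := eq2 x0.
rewrite -(pmulr_rle0 _ (exprn_gt0 2 e0)) mulrBr e1 e2 opprB addrA subrK {e1 e2}.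
rewrite subr_le0 ler_expR => h.
have := hx0 x; rewrite /w.
have := ler_norm (Ubar eps (xmarginal nu) x0 - Ubar eps (xmarginal mu) x0).
have := Ubar_stability x0 P1 P2 e0; rewrite distrC.
lra.
Qed.

(** The second derivatives differ by [eps^-2] times a difference of exponentials, Lipschitz with
    constant [expU eps]. The arguments differ by two contributions of [w1 / (2 eps^2)], one from
    [Ubar] and one from [Uhat]. Periodicity transfers the bound to the first derivatives. *)
Lemma is_Uhat_stability mu nu eps u1 u2 x : in_P1 mu -> in_P1 nu -> 0 < eps ->
  is_Uhat eps (xmarginal mu) u1 -> is_Uhat eps (xmarginal nu) u2 ->
  `|derive1 u1 x - derive1 u2 x| <= (eps ^+ 4)^-1 * expU eps * w1 mu nu.
Proof.
move=> P1 P2 e0 hu1 hu2.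
have [h11 h12] := is_Uhat_derive hu1; have [h21 h22] := is_Uhat_derive hu2.
have [p1 _ _ eq1] := hu1; have [p2 _ _ eq2] := hu2.
have e2 := exprn_gt0 2 e0.
pose L := (eps ^+ 4)^-1 * expU eps * w1 mu nu.
have b y : `|derive1n 2 u1 y - derive1n 2 u2 y| <= L.
  have q1 := eq1 y; have q2 := eq2 y.
  rewrite -(ler_pM2l e2) -[X in X * `|_|](gtr0_norm e2) -normrM mulrBr q1 q2 opprB addrA subrK.
  have b1 := is_Uhat_le y P1 e0 hu1; have b2 := is_Uhat_le y P2 e0 hu2.
  apply: (le_trans (expR_lipschitz b1 b2)).
  have -> : eps ^+ 2 * L = expU eps * ((2 * eps ^+ 2)^-1 * w1 mu nu + (2 * eps ^+ 2)^-1 * w1 mu nu).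
    by rewrite /L; field; rewrite gt_eqF.
  rewrite ler_wpM2l ?expR_ge0// opprD addrACA (le_trans (ler_normD _ _))// lerD//.
    exact: Ubar_stability.
  rewrite ler_norml (is_Uhat_diff_le _ P1 P2 e0 hu1 hu2) andbT lerNl opprB w1_sym//.
  exact: is_Uhat_diff_le.
have hl : forall y z, `|(derive1 u1 y - derive1 u2 y) - (derive1 u1 z - derive1 u2 z)| <= L * `|y - z|.
  exact: (derive_bound_lipschitz (fun y => is_deriveB (h12 y) (h22 y)) b).
apply: (@periodic_derive_bound _ (fun t => u1 t - u2 t) (fun t => derive1 u1 t - derive1 u2 t) L) => //.
by move=> y; rewrite p1 p2.
Qed.

End Uhat.

(** * Mollified test functions *)

Section quadratic_differentiable.
Context {R : realType}.

Lemma quad_linear_differentiable (V W : normedModType R) (F : V -> W)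
    (L : {linear V -> W}) (z : V) (C : R) : continuous L ->
  (forall h, `|F (h + z) - F z - L h| <= C * `|h| ^+ 2) -> differentiable F z.
Proof.
move=> cl H.
have dl : F \o shift z = cst (F z) + L +o_ 0 id.
  apply/eqaddoP => e e0.
  have D0 : 0 < `|C| + 1 by rewrite ltr_wpDl.
  near=> h.
  have := H h; rewrite !fctE /= opprD addrA => /le_trans; apply.
  rewrite expr2 mulrA ler_wpM2r// (@le_trans _ _ ((`|C| + 1) * `|h|))//.
    by rewrite ler_wpM2r// (le_trans (ler_norm C))// lerDl.
  rewrite mulrC -ler_pdivlMr//; near: h.
  apply/nbhs_ballP; exists (e / (`|C| + 1)) => /=; first by rewrite divr_gt0.
  by move=> y; rewrite -ball_normE /ball_/= sub0r normrN => /ltW.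
by apply/diff_locallyP; rewrite (diff_unique cl dl).
Unshelve. all: by end_near. Qed.

(** [smooth] asks for differentiability in the three variables jointly; a quadratic remainder gives
    it together with all directional derivatives. *)
Lemma quad_differentiable (F : R * R * R -> R) (z : R * R * R) (a b c C : R) :
  (forall h : R * R * R,
     `|F (h + z) - F z - (a * h.1.1 + b * h.1.2 + c * h.2)| <= C * `|h| ^+ 2) ->
  differentiable F z /\
  forall h, is_derive z h F (a * h.1.1 + b * h.1.2 + c * h.2).
Proof.
move=> H; split; last first.
  move=> h; apply: (@is_derive_quad _ _ _ _ _ _ (C * `|h| ^+ 2)) => k _.
  have -> : k * (a * h.1.1 + b * h.1.2 + c * h.2) =
      a * (k *: h).1.1 + b * (k *: h).1.2 + c * (k *: h).2.
    by rewrite /= /GRing.scale/=; ring.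
  have := H (k *: h); rewrite normrZ exprMn real_normK ?num_real// => /le_trans; apply.
  by rewrite le_eqVlt; apply/orP; left; apply/eqP; ring.
pose l (h : R * R * R) : R := a * h.1.1 + b * h.1.2 + c * h.2.
have linl : linear l.
  by move=> k u v; rewrite /l /= /GRing.scale/=; ring.
pose lM := GRing.isLinear.Build _ _ _ _ _ linl.
pose L : {linear (R * R * R)%type -> R} := HB.pack l lM.
have cl : continuous L.
  move=> h; apply: cvgD; first apply: cvgD.
  - by apply: cvgMr; apply: (cvg_comp _ _ (cvg_fst (F := nbhs h.1) (G := nbhs h.2))); exact: cvg_fst.
  - by apply: cvgMr; apply: (cvg_comp _ _ (cvg_fst (F := nbhs h.1) (G := nbhs h.2))); exact: cvg_snd.
  - by apply: cvgMr; exact: cvg_snd.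
exact: (@quad_linear_differentiable _ _ _ L z C cl).
Qed.

(** Once the increments are expanded, each of the seven remaining terms contains either a
    second-order remainder or at least two increments. *)
Lemma triple_product_taylor (p q r dp dq dr : R -> R) :
  bsmooth p -> bsmooth q -> bsmooth r ->
  (forall x, is_derive x (1 : R) p (dp x)) ->
  (forall x, is_derive x (1 : R) q (dq x)) ->
  (forall x, is_derive x (1 : R) r (dr x)) ->
  exists C, forall t x v a b c,
    `|p (t + a) * q (x + b) * r (v + c) - p t * q x * r v -
      (dp t * q x * r v * a + p t * dq x * r v * b + p t * q x * dr v * c)| <=
    C * (`|a| + `|b| + `|c|) ^+ 2.
Proof.
move=> bp bq br hp hq hr.
have bounds f df : bsmooth f -> (forall x, is_derive x (1 : R) f (df x)) ->
    exists M, 0 <= M /\ forall x h, [/\ `|f x| <= M,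
      `|f (x + h) - f x| <= M * `|h| & `|f (x + h) - f x - h * df x| <= M * `|h| ^+ 2].
  move=> bf hf; have [C1 h1] := bsmooth_taylor bf hf.
  have [C2 h2] := Cb_bounded (bf 0%N).
  have [df' [hf' bdf]] := bsmooth_derive bf.
  have [C3 h3] := Cb_bounded (bdf 0%N).
  have C20 : 0 <= C2 by apply: le_trans (h2 0).
  have C30 : 0 <= C3 by apply: le_trans (h3 0).
  exists (`|C1| + C2 + C3); split; first by rewrite !addr_ge0.
  move=> x h; split.
  - by rewrite (le_trans (h2 x))// -addrA addrCA lerDl addr_ge0.
  - rewrite (le_trans (derive_bound_lipschitz hf' h3 _ _))// [x + h - x]addrAC subrr add0r.
    by rewrite ler_wpM2r// lerDr addr_ge0.
  - rewrite (le_trans (h1 x h))// real_normK ?num_real// ler_wpM2r ?sqr_ge0//.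
    by rewrite -addrA (le_trans (ler_norm C1))// lerDl addr_ge0.
have [M1 [M10 H1]] := bounds p dp bp hp.
have [M2 [M20 H2]] := bounds q dq bq hq.
have [M3 [M30 H3]] := bounds r dr br hr.
pose M := M1 + M2 + M3.
exists (8 * M ^+ 3) => t x v a b c.
have [p1 p2 p3] := H1 t a; have [q1 q2 q3] := H2 x b; have [r1 r2 r3] := H3 v c.
have up f g M' : M' <= M -> 0 <= g -> f <= M' * g -> f <= M * g.
  by move=> MM g0 /le_trans; apply; rewrite ler_wpM2r.
have MM1 : M1 <= M by rewrite /M; lra.
have MM2 : M2 <= M by rewrite /M; lra.
have MM3 : M3 <= M by rewrite /M; lra.
have M0 : 0 <= M by rewrite /M !addr_ge0.
have {p1}p1 := le_trans p1 MM1; have {q1}q1 := le_trans q1 MM2; have {r1}r1 := le_trans r1 MM3.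
have {p2}p2 := up _ _ _ MM1 (normr_ge0 a) p2; have {q2}q2 := up _ _ _ MM2 (normr_ge0 b) q2.
have {r2}r2 := up _ _ _ MM3 (normr_ge0 c) r2.
have {p3}p3 := up _ _ _ MM1 (exprn_ge0 2 (normr_ge0 a)) p3.
have {q3}q3 := up _ _ _ MM2 (exprn_ge0 2 (normr_ge0 b)) q3.
have {r3}r3 := up _ _ _ MM3 (exprn_ge0 2 (normr_ge0 c)) r3.
(* In the product of three increments one factor is merely bounded, which keeps that term of order
   two. *)
have r4 : `|r (v + c) - r v| <= 2 * M.
  by rewrite (le_trans (ler_normB _ _))//; have [+ _ _] := H3 (v + c) 0; lra.
move: p1 p2 p3 q1 q2 q3 r1 r2 r3 r4.
set P := p t; set Q := q x; set S := r v.
set al := p (t + a) - P; set be := q (x + b) - Q; set ga := r (v + c) - S.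
move=> p1 p2 p3 q1 q2 q3 r1 r2 r3 r4.
have -> : p (t + a) * q (x + b) * r (v + c) - P * Q * S -
      (dp t * Q * S * a + P * dq x * S * b + P * Q * dr v * c) =
  (al - a * dp t) * Q * S + P * (be - b * dq x) * S + P * Q * (ga - c * dr v) +
  al * be * S + al * Q * ga + P * be * ga + al * be * ga.
  by rewrite /al /be /ga; ring.
have m3 (x1 x2 x3 y1 y2 y3 : R) : `|x1| <= y1 -> `|x2| <= y2 -> `|x3| <= y3 ->
    `|x1 * x2 * x3| <= y1 * y2 * y3.
  by move=> h1 h2 h3; rewrite !normrM; apply: ler_pM => //; apply: ler_pM.
have T1 := m3 _ _ _ _ _ _ p3 q1 r1.
have T2 := m3 _ _ _ _ _ _ p1 q3 r1.
have T3 := m3 _ _ _ _ _ _ p1 q1 r3.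
have T4 := m3 _ _ _ _ _ _ p2 q2 r1.
have T5 := m3 _ _ _ _ _ _ p2 q1 r2.
have T6 := m3 _ _ _ _ _ _ p1 q2 r2.
have T7 := m3 _ _ _ _ _ _ p2 q2 r4.
have tri7 (x1 x2 x3 x4 x5 x6 x7 : R) : `|x1 + x2 + x3 + x4 + x5 + x6 + x7| <=
   `|x1| + `|x2| + `|x3| + `|x4| + `|x5| + `|x6| + `|x7|.
  by do 6 (apply: (le_trans (ler_normD _ _)); rewrite lerD2r).
apply: (le_trans (tri7 _ _ _ _ _ _ _)).
have a0 := normr_ge0 a; have b0 := normr_ge0 b; have c0 := normr_ge0 c.
have ab : 0 <= `|a| * `|b| by rewrite mulr_ge0.
have bc : 0 <= `|b| * `|c| by rewrite mulr_ge0.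
have ac : 0 <= `|a| * `|c| by rewrite mulr_ge0.
apply: (@le_trans _ _ (M ^+ 3 * (`|a| ^+ 2 + `|b| ^+ 2 + `|c| ^+ 2 + 3 * (`|a| * `|b|) + `|a| * `|c| + `|b| * `|c|))).
  have -> : M ^+ 3 * (`|a| ^+ 2 + `|b| ^+ 2 + `|c| ^+ 2 + 3 * (`|a| * `|b|) + `|a| * `|c| + `|b| * `|c|) =
    M * `|a| ^+ 2 * M * M + M * (M * `|b| ^+ 2) * M + M * M * (M * `|c| ^+ 2) +
    M * `|a| * (M * `|b|) * M + M * `|a| * M * (M * `|c|) + M * (M * `|b|) * (M * `|c|) +
    M * `|a| * (M * `|b|) * (2 * M) by ring.
  by do 6 (apply: lerD => //).
rewrite [leRHS](_ : _ = M ^+ 3 * (8 * (`|a| + `|b| + `|c|) ^+ 2)); last by ring.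
rewrite ler_wpM2l ?exprn_ge0//.
have := sqr_ge0 `|a|; have := sqr_ge0 `|b|; have := sqr_ge0 `|c|.
by rewrite !sqrrD; lra.
Qed.

End quadratic_differentiable.

(** * Smooth steps and bumps *)

Section mollifiers.
Context {R : realType}.
Local Notation leb := (@lebesgue_measure R).
Local Notation flat0 := (@flat R 0).

Lemma flat0_ge (s : R) : 2^-1 <= s -> expR (- 2) <= flat0 s.
Proof.
move=> s2; rewrite /flat ifT; last lra.
rewrite expr0 mul1r ler_expR lerN2 -[leRHS]invrK lef_pV2 ?posrE//; lra.
Qed.

Lemma flat_le0 k (s : R) : s <= 0 -> flat k s = 0.
Proof. by move=> s0; rewrite /flat ltNge s0. Qed.

Lemma smooth_step : exists th dth : R -> R,
  [/\ bsmooth th, (forall s, is_derive s (1 : R) th (dth s)), bsmooth dth,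
      (forall s, s <= 0 -> th s = 0) /\ (forall s, 1 <= s -> th s = 1) &
      forall s, s < 0 \/ 1 < s -> dth s = 0].
Proof.
pose den s := flat0 s + flat0 (-1 * s + 1).
(* One of [s] and [1 - s] is at least [1/2]. *)
have d0 s : expR (-2) <= den s.
  have [h|h] := leP 2^-1 s.
    by rewrite /den (le_trans (flat0_ge h))// lerDl flat_ge0.
  rewrite /den (le_trans (@flat0_ge (-1 * s + 1) _))//; first lra.
  by rewrite lerDr flat_ge0.
pose th s := flat0 s * (den s)^-1.
have bth : bsmooth th.
  move=> n; apply: CbM; first exact: bsmooth_flat.
  apply: (@Cb_inv _ _ _ (expR (-2))) => //.
  by apply: CbD; [exact: bsmooth_flat|apply: Cb_affine; exact: bsmooth_flat].
have [dth [h1 h2]] := bsmooth_derive bth.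
have th0 s : s <= 0 -> th s = 0 by move=> hs; rewrite /th flat_le0// mul0r.
suff th1 s : 1 <= s -> th s = 1.
  exists th, dth; split => // s hs.
  have dE (c : R) : (\forall y \near s, th y = c) -> dth s = 0.
    move=> hc; rewrite -(@derive_val _ _ _ _ _ _ _ (h1 s)).
    by rewrite (near_eq_derive (g := cst c)) ?derive_cst//; exact: hc.
  case: hs => hs; [apply: (dE 0)|apply: (dE 1)]; near=> y.
    by apply/th0/ltW; near: y; exact: lt_nbhsl.
  by apply/th1/ltW; near: y; exact: lt_nbhsr.
move=> hs.
have E : den s = flat0 s by rewrite /den (@flat_le0 0 (-1 * s + 1)) ?addr0//; lra.
have dp : 0 < den s := lt_le_trans (expR_gt0 _) (d0 s).
by rewrite /th E divff// -E gt_eqF.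
Unshelve. all: by end_near. Qed.

Lemma bump_mollifier (d : R) : 0 < d -> exists eta : R -> R,
  [/\ bsmooth eta, (forall w, eta (- w) = eta w), (forall w, 0 <= eta w),
      (forall w, d <= `|w| -> eta w = 0) & \int[leb]_(w in `[- d, d]) eta w = 1].
Proof.
move=> d0.
pose b w : R := flat0 (d^-1 * w + 1) * flat0 ((- d^-1) * w + 1).
have bb : bsmooth b.
  by move=> n; apply: CbM; apply: Cb_affine; exact: bsmooth_flat.
have b_ge0 w : 0 <= b w by rewrite mulr_ge0// flat_ge0.
have b_even w : b (- w) = b w.
  by rewrite /b mulrN mulrNN mulrC mulNr.
have b0 w : d <= `|w| -> b w = 0.
  rewrite ler_normr => /orP[] h.
    rewrite /b (@flat_le0 0 (- d^-1 * w + 1)) ?mulr0//.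
    by rewrite mulNr addrC subr_le0 ler_pdivlMl// mulr1.
  rewrite /b (@flat_le0 0 (d^-1 * w + 1)) ?mul0r//.
  by rewrite -[w]opprK mulrN addrC subr_le0 ler_pdivlMl// mulr1.
have [db [hdb _]] := bsmooth_derive bb.
have cb : continuous b := derive_continuous hdb.
pose I r := `[- r, r]%classic : set (measurableTypeR R).
have mI r : measurable (I r) by exact: measurable_itv.
have ib r : leb.-integrable (I r) (EFin \o b).
  by apply: continuous_compact_integrable; [exact: segment_compact|exact: continuous_subspaceT].
pose Z := \int[leb]_(w in `[- d, d]) b w.
have Z0 : 0 < Z.
  have LI : leb `[- (d / 2), d / 2]%classic = d%:E.
    rewrite lebesgue_measure_itv/= ifT; last by rewrite lte_fin; lra.
    by rewrite -EFinB; congr EFin; lra.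
  pose c := expR (-2) * expR (-2) : R.
  have c0 : 0 < c by rewrite mulr_gt0// expR_gt0.
  apply: (@lt_le_trans _ _ (c * d)); first by rewrite mulr_gt0.
  apply: (@le_trans _ _ (\int[leb]_(w in I (d / 2)) b w)).
    have -> : c * d = \int[leb]_(y in I (d / 2)) c.
      rewrite Rintegral_cst//; congr (_ * _).
      by rewrite -[LHS]/(fine d%:E); congr fine; exact/esym/LI.
    apply: le_Rintegral => //.
      by apply: continuous_compact_integrable; [exact: segment_compact|apply: continuous_subspaceT => x; exact: cvg_cst].
    move=> w; rewrite /I/= in_itv/= => /andP[w1 w2].
    have h1 : - 2^-1 <= d^-1 * w by rewrite ler_pdivlMl//; lra.
    have h2 : d^-1 * w <= 2^-1 by rewrite ler_pdivrMl//; lra.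
    rewrite /c /b; apply: ler_pM; rewrite ?expR_ge0//; apply: flat0_ge; first lra.
    by rewrite mulNr; lra.
  have IE : I (d / 2) = I d `&` I (d / 2).
    by apply/seteqP; split => [y Iy|y []//]; split => //; move: Iy; rewrite /I/= !in_itv/=;
      move=> /andP[? ?]; apply/andP; split; lra.
  rewrite IE Rintegral_mkcondr; apply: le_Rintegral => //.
    by rewrite -restrict_EFin; apply/integrable_restrict => //; rewrite -IE.
  by move=> y _; rewrite patchE; case: ifP => _; [exact: lexx|exact: b_ge0].
exists (fun w => Z^-1 * b w); split.
- by move=> n; apply: CbZ.
- by move=> w; rewrite b_even.
- by move=> w; rewrite mulr_ge0// invr_ge0 ltW.
- by move=> w /b0 ->; rewrite mulr0.
- rewrite (RintegralZl Z^-1 (mI d) (ib d)) mulVf// gt_eqF//.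
Qed.

End mollifiers.

Section bounded_measurable.
Context {R : realType} d {T : measurableType d}.
Implicit Types f g : T -> R.

Definition bmeas f := measurable_fun setT f /\ exists C, forall x, `|f x| <= C.

Lemma bmeasD f g : bmeas f -> bmeas g -> bmeas (fun x => f x + g x).
Proof.
move=> [mf [C hC]] [mg [C' hC']]; split; first exact: measurable_funD.
by exists (C + C') => x; rewrite (le_trans (ler_normD _ _))// lerD.
Qed.

Lemma bmeasM f g : bmeas f -> bmeas g -> bmeas (fun x => f x * g x).
Proof.
move=> [mf [C hC]] [mg [C' hC']]; split; first exact: measurable_funM.
by exists (C * C') => x; rewrite normrM ler_pM.
Qed.

Lemma bmeas_cst (c : R) : bmeas (fun=> c).
Proof. by split; [exact: measurable_cst|exists `|c|]. Qed.

Lemma bmeasZ f c : bmeas f -> bmeas (fun x => c * f x).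
Proof. by move=> bf; apply: bmeasM bf; exact: bmeas_cst. Qed.

Lemma bmeasB f g : bmeas f -> bmeas g -> bmeas (fun x => f x - g x).
Proof.
move=> bf bg; have := bmeasD bf (bmeasZ (-1) bg).
by congr bmeas; apply/funext => x; rewrite mulN1r.
Qed.

Lemma bmeas_integrable (mu : {measure set T -> \bar R}) (D : set T) f :
  measurable D -> (mu D < +oo)%E -> bmeas f -> mu.-integrable D (EFin \o f).
Proof.
move=> mD fD [mf [C hC]].
by apply: (bounded_integrable mD fD (C := C)) => //; exact: measurable_funTS.
Qed.

End bounded_measurable.

Lemma bmeas_comp {R : realType} d d' (T : measurableType d) (T' : measurableType d')
    (f : T -> R) (g : T' -> T) :
  bmeas f -> measurable_fun setT g -> bmeas (f \o g).
Proof. by move=> [mf [C hC]] mg; split; [exact: measurableT_comp|exists C => x; exact: hC]. Qed.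

Lemma bsmooth_bmeas {R : realType} (p : R -> R) : bsmooth p -> bmeas p.
Proof.
move=> bp; split; last exact: Cb_bounded (bp 0%N).
by have [dp [h _]] := bsmooth_derive bp; exact: continuous_measurable_fun (derive_continuous h).
Qed.

(** * Mollified functions as smooth test functions *)

Section smoothing.
Context {R : realType}.
Local Notation leb := (@lebesgue_measure R).
Variables (phi : R * R -> R) (Rad : R).
Hypothesis bphi : bmeas phi.
Local Notation leb2 := (leb \x leb)%E.

Definition box : set (measurableTypeR R * measurableTypeR R) :=
  torus R `*` `[- Rad, Rad]%classic.

(** The variables sit in the kernels, over a fixed box, so that derivatives in [x] and [v] fall on
    [q] and [r] and are again of the form [sm]. *)
Definition sm (q r : R -> R) (x v : R) : R :=
  \int[leb2]_(z in box) (phi z * (q (x - z.1) * r (v - z.2))).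

Let mI : measurable (`[- Rad, Rad]%classic : set (measurableTypeR R)).
Proof. exact: measurable_itv. Qed.

Let finI : (leb `[(- Rad)%R, Rad]%classic < +oo)%E.
Proof. by rewrite lebesgue_measure_itv; case: ifP => _ //=; rewrite -?EFinB ?ltry. Qed.

Lemma measurable_box : measurable box.
Proof. exact: measurableX mtorus mI. Qed.

Lemma box_lty : (leb2 box < +oo)%E.
Proof. exact: product_measureX_lty mtorus mI torus_lty finI. Qed.

Let bphi' : bmeas (phi : measurableTypeR R * measurableTypeR R -> R).
Proof. by case: bphi => mp hp; split. Qed.

Lemma bmeas_kernel (q r : R -> R) x v : bmeas q -> bmeas r ->
  bmeas (fun z : measurableTypeR R * measurableTypeR R => q (x - z.1) * r (v - z.2)).
Proof.
move=> bq br; apply: bmeasM.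
  apply: (bmeas_comp bq (g := fun z : measurableTypeR R * measurableTypeR R => (x - z.1 : R))).
  by apply: measurable_funB => //; exact: measurable_cst.
apply: (bmeas_comp br (g := fun z : measurableTypeR R * measurableTypeR R => (v - z.2 : R))).
by apply: measurable_funB => //; exact: measurable_cst.
Qed.

Let integ k : bmeas k -> leb2.-integrable box (EFin \o (fun z => phi z * k z)).
Proof.
by move=> bk; apply: (bmeas_integrable measurable_box box_lty); exact: bmeasM.
Qed.

Let intB k k' : bmeas k -> bmeas k' ->
  \int[leb2]_(z in box) (phi z * (k z - k' z)) =
  \int[leb2]_(z in box) (phi z * k z) - \int[leb2]_(z in box) (phi z * k' z).
Proof.
move=> bk bk'; rewrite -(RintegralB measurable_box (integ bk) (integ bk')).
by apply: eq_Rintegral => z _; rewrite mulrBr.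
Qed.

Let intD k k' : bmeas k -> bmeas k' ->
  \int[leb2]_(z in box) (phi z * (k z + k' z)) =
  \int[leb2]_(z in box) (phi z * k z) + \int[leb2]_(z in box) (phi z * k' z).
Proof.
move=> bk bk'; rewrite -(RintegralD measurable_box (integ bk) (integ bk')).
by apply: eq_Rintegral => z _; rewrite mulrDr.
Qed.

Let intZ k (c : R) : bmeas k ->
  \int[leb2]_(z in box) (phi z * (c * k z)) = c * \int[leb2]_(z in box) (phi z * k z).
Proof.
move=> bk; rewrite -(RintegralZl c measurable_box (integ bk)).
by apply: eq_Rintegral => z _; rewrite mulrCA.
Qed.

(** The quadratic remainder of the triple product is integrated against [phi]; the constant depends
    on [phi] through its bound [A] and the box alone. *)
Lemma sm_taylor_le (p q r dp dq dr : R -> R) :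
  bsmooth p -> bsmooth q -> bsmooth r -> bsmooth dq -> bsmooth dr ->
  forall C A, (forall t x v a b c,
    `|p (t + a) * q (x + b) * r (v + c) - p t * q x * r v -
      (dp t * q x * r v * a + p t * dq x * r v * b + p t * q x * dr v * c)| <=
    C * (`|a| + `|b| + `|c|) ^+ 2) ->
  (forall z, `|phi z| <= A) -> forall t x v a b c,
    `|p (t + a) * sm q r (x + b) (v + c) - p t * sm q r x v -
      (dp t * sm q r x v * a + p t * sm dq r x v * b + p t * sm q dr x v * c)| <=
    A * C * fine (leb2 box) * (`|a| + `|b| + `|c|) ^+ 2.
Proof.
move=> bp bq br bdq bdr C A hC hA t x v a b c.
have A0 : 0 <= A by apply: le_trans (hA 0).
have Q := bsmooth_bmeas bq; have S := bsmooth_bmeas br.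
have dQ := bsmooth_bmeas bdq; have dS := bsmooth_bmeas bdr.
pose k0 (z : measurableTypeR R * measurableTypeR R) : R := q (x - z.1) * r (v - z.2).
pose k1 (z : measurableTypeR R * measurableTypeR R) : R := q (x + b - z.1) * r (v + c - z.2).
pose k2 (z : measurableTypeR R * measurableTypeR R) : R := dq (x - z.1) * r (v - z.2).
pose k3 (z : measurableTypeR R * measurableTypeR R) : R := q (x - z.1) * dr (v - z.2).
have b0 : bmeas k0 by exact: bmeas_kernel.
have b1 : bmeas k1 by exact: bmeas_kernel.
have b2 : bmeas k2 by exact: bmeas_kernel.
have b3 : bmeas k3 by exact: bmeas_kernel.
have e0 c' := bmeasZ c' b0. have e1 c' := bmeasZ c' b1.
have e2 c' := bmeasZ c' b2. have e3 c' := bmeasZ c' b3.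
pose K z := p (t + a) * k1 z - p t * k0 z -
  (dp t * a * k0 z + p t * b * k2 z + p t * c * k3 z).
have bK : bmeas K.
  by apply: bmeasB; [exact: bmeasB|apply: bmeasD => //; exact: bmeasD].
have -> : p (t + a) * sm q r (x + b) (v + c) - p t * sm q r x v -
      (dp t * sm q r x v * a + p t * sm dq r x v * b + p t * sm q dr x v * c) =
    \int[leb2]_(z in box) (phi z * K z).
  rewrite /K intB; [|exact: bmeasB|by apply: bmeasD => //; exact: bmeasD].
  rewrite intB// intD//; last exact: bmeasD.
  rewrite intD// !intZ// /sm; ring.
have mK : measurable_fun setT (fun z => phi z * K z) by case: (bmeasM bphi' bK).
have bnd z : box z -> `|phi z * K z| <= A * C * (`|a| + `|b| + `|c|) ^+ 2.
  move=> _; rewrite normrM -mulrA; apply: ler_pM => //.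
  have := hC t (x - z.1) (v - z.2) a b c.
  rewrite /K /k1 /k0 /k2 /k3 (_ : x - z.1 + b = x + b - z.1); last by ring.
  rewrite (_ : v - z.2 + c = v + c - z.2); last by ring.
  apply: le_trans; rewrite le_eqVlt; apply/orP; left; apply/eqP; congr `|_|; ring.
apply: (le_trans (Rintegral_norm_le measurable_box box_lty (measurable_funTS mK) bnd)).
by rewrite le_eqVlt; apply/orP; left; apply/eqP; rewrite mulrAC.
Qed.

Lemma sm_taylor (p q r dp dq dr : R -> R) :
  bsmooth p -> bsmooth q -> bsmooth r -> bsmooth dq -> bsmooth dr ->
  (forall x, is_derive x (1 : R) p (dp x)) ->
  (forall x, is_derive x (1 : R) q (dq x)) ->
  (forall x, is_derive x (1 : R) r (dr x)) ->
  exists C, forall t x v a b c,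
    `|p (t + a) * sm q r (x + b) (v + c) - p t * sm q r x v -
      (dp t * sm q r x v * a + p t * sm dq r x v * b + p t * sm q dr x v * c)| <=
    C * (`|a| + `|b| + `|c|) ^+ 2.
Proof.
move=> bp bq br bdq bdr hp hq hr.
have [C hC] := triple_product_taylor bp bq br hp hq hr.
have [_ [A hA]] := bphi.
by exists (A * C * fine (leb2 box)); exact: sm_taylor_le.
Qed.

Lemma sm_abs (q r : R -> R) x v : bmeas q -> bmeas r ->
  (forall w, `|w| <= Rad -> r (v - w) = 0) -> sm q r x v = 0.
Proof.
move=> bq br h; rewrite /sm -[RHS](mul0r (fine (leb2 box))) -Rintegral_cst; last exact: measurable_box.
apply: eq_Rintegral => z; rewrite inE => -[_]/=; rewrite in_itv/= => hz.
by rewrite h ?mulr0 ?ler_norml.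
Qed.

Lemma sm_bound (q r : R -> R) : bmeas q -> bmeas r ->
  exists C, forall x v, `|sm q r x v| <= C.
Proof.
move=> bq br; have [_ [A hA]] := bphi; have [_ [B hB]] := bq; have [_ [C hC]] := br.
exists (A * (B * C) * fine (leb2 box)) => x v.
have [mK _] := bmeasM bphi' (bmeas_kernel x v bq br).
apply: (Rintegral_norm_le measurable_box box_lty (measurable_funTS mK)) => z _.
have A0 : 0 <= A by apply: le_trans (hA 0).
by rewrite normrM ler_pM// normrM ler_pM.
Qed.

Definition tprod (p q r : R -> R) (z : R * R * R) : R :=
  p z.1.1 * sm q r z.1.2 z.2.

(** A directional derivative of one product is a sum of three such products. Finite sums are thus
    closed under ['D_h], which gives the iterated derivatives required by [smooth]. *)
Inductive tclass : (R * R * R -> R) -> Prop :=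
| tclass0 : tclass (fun=> 0)
| tclassS p q r F : bsmooth p -> bsmooth q -> bsmooth r -> tclass F ->
    tclass (fun z => tprod p q r z + F z).

Lemma sm_derive (p q r dp dq dr : R -> R) :
  bsmooth p -> bsmooth q -> bsmooth r -> bsmooth dq -> bsmooth dr ->
  (forall x, is_derive x (1 : R) p (dp x)) ->
  (forall x, is_derive x (1 : R) q (dq x)) ->
  (forall x, is_derive x (1 : R) r (dr x)) ->
  forall z : R * R * R, differentiable (tprod p q r) z /\ forall h : R * R * R, is_derive z h (tprod p q r)
    (dp z.1.1 * sm q r z.1.2 z.2 * h.1.1 + p z.1.1 * sm dq r z.1.2 z.2 * h.1.2 +
     p z.1.1 * sm q dr z.1.2 z.2 * h.2).
Proof.
move=> bp bq br bdq bdr hp hq hr z.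
have [C hC] := sm_taylor bp bq br bdq bdr hp hq hr.
apply: (@quad_differentiable _ _ _ _ _ _ (`|C| * 9)) => h.
have := hC z.1.1 z.1.2 z.2 h.1.1 h.1.2 h.2.
rewrite /tprod /= (addrC z.1.1) (addrC z.1.2) (addrC z.2) => /le_trans; apply.
have h1 : `|h.1.1| <= `|h| by rewrite !prod_normE !le_max lexx.
have h2 : `|h.1.2| <= `|h| by rewrite !prod_normE !le_max lexx orbT.
have h3 : `|h.2| <= `|h| by rewrite !prod_normE !le_max lexx orbT.
apply: (@le_trans _ _ (`|C| * (`|h.1.1| + `|h.1.2| + `|h.2|) ^+ 2)).
  by rewrite ler_wpM2r ?sqr_ge0// ler_norm.
rewrite -mulrA ler_wpM2l//.
have -> : 9 * `|h| ^+ 2 = (`|h| + `|h| + `|h|) ^+ 2 by ring.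
by rewrite lerXn2r ?nnegrE ?addr_ge0// !lerD.
Qed.

Lemma tclass_derive F (h : R * R * R) : tclass F ->
  (forall z, differentiable F z) /\ tclass (fun z => 'D_h F z).
Proof.
elim=> [|p q r F' bp bq br hF' [ih1 ih2]].
  split=> [z|]; first exact: differentiable_cst.
  rewrite (_ : (fun z => _) = fun=> 0); first exact: tclass0.
  by apply/funext => z; rewrite derive_cst.
have [dp [hp bdp]] := bsmooth_derive bp.
have [dq [hq bdq]] := bsmooth_derive bq.
have [dr [hr bdr]] := bsmooth_derive br.
have D := sm_derive bp bq br bdq bdr hp hq hr.
split=> [z|]; first by apply: differentiableD => //; have [] := D z.
have scal (c : R) (f : R -> R) : bsmooth f -> bsmooth (fun x => f x * c).
  by move=> bf n; apply: CbM => //; exact: Cb_cst.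
have := tclassS (scal h.1.1 _ bdp) bq br (tclassS (scal h.1.2 _ bp) bdq br
  (tclassS (scal h.2 _ bp) bq bdr ih2)).
congr tclass; apply/funext => z.
have [_ /(_ h) Dz] := D z.
have dF : derivable F' z h by exact: diff_derivable.
have E := is_deriveD Dz (derivableP dF).
rewrite (@derive_val _ _ _ _ _ _ _ E) /tprod; ring.
Qed.

Lemma tclass_smooth F : tclass F -> smooth F.
Proof.
move=> hF s z; suff : tclass (foldr (fun v (g : R * R * R -> R) => 'D_v g) F s).
  by move=> /(tclass_derive 0)[].
by elim: s => //= v s ih; have [] := tclass_derive v ih.
Qed.

End smoothing.

Section smoothing_convolution.
Context {R : realType}.
Local Notation leb := (@lebesgue_measure R).
Local Notation leb2 := (leb \x leb)%E.
Variables (kp et : R -> R) (d : R).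
Hypotheses (bkp : bsmooth kp) (pkp : periodic kp 1) (ekp : forall x, kp (- x) = kp x)
  (kp0 : forall x, 0 <= kp x) (ikp : \int[leb]_(x in torus R) kp x = 1).
Hypotheses (d0 : 0 < d) (bet : bsmooth et) (eet : forall w, et (- w) = et w)
  (et0 : forall w, 0 <= et w) (set_ : forall w, d <= `|w| -> et w = 0)
  (iet : \int[leb]_(w in `[- d, d]) et w = 1).

Let mI r : measurable (`[- r, r]%classic : set (measurableTypeR R)).
Proof. exact: measurable_itv. Qed.

Let finI (a b : R) : (leb (`[a, b]%classic) < +oo)%E.
Proof. by rewrite lebesgue_measure_itv/=; case: ifP => _; rewrite ltry. Qed.

Lemma eq_Rintegral_support (f : R -> R) (A B : set (measurableTypeR R)) :
  (forall x, ~ A x -> f x = 0) -> (forall x, ~ B x -> f x = 0) ->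
  \int[leb]_(x in A) f x = \int[leb]_(x in B) f x.
Proof.
move=> hA hB; rewrite Rintegral_mkcond [RHS]Rintegral_mkcond.
apply: eq_Rintegral => x _; rewrite !patchE.
case: ifPn => xA; case: ifPn => xB //.
  by apply: hB => Bx; rewrite mem_set in xB.
by apply/esym/hA => Ax; rewrite mem_set in xA.
Qed.

Lemma bmeas_shift2 (f : R * R -> R) (x v : R) : bmeas f ->
  bmeas (fun z : R * R => f (z.1 + x, z.2 + v)).
Proof.
move=> bf; apply: (bmeas_comp bf (g := fun z : R * R => (z.1 + x, z.2 + v))).
apply: measurable_fun_pair => /=.
  by apply: measurable_funD => //; exact: measurable_cst.
by apply: measurable_funD => //; exact: measurable_cst.
Qed.

Lemma bmeas_fst (q : R -> R) : bmeas q -> bmeas (fun z : R * R => q z.1).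
Proof. by move=> bq; exact: (bmeas_comp bq measurable_fst). Qed.

Lemma bmeas_snd (q : R -> R) : bmeas q -> bmeas (fun z : R * R => q z.2).
Proof. by move=> bq; exact: (bmeas_comp bq measurable_snd). Qed.

Lemma bmeas_affine (q : R -> R) (x : R) : bmeas q -> bmeas (fun y : R => q (x - y)).
Proof.
move=> bq; apply: (bmeas_comp bq (g := fun y : R => x - y)).
by apply: measurable_funB => //; exact: measurable_cst.
Qed.

Let bmk : bmeas kp := bsmooth_bmeas bkp.
Let bme : bmeas et := bsmooth_bmeas bet.

Lemma box_prod12 (f : R * R -> R) (r : R) : bmeas f ->
  \int[leb2]_(z in box r) f z =
  \int[leb]_(y in torus R) \int[leb]_(w in `[- r, r]) f (y, w).
Proof.
move=> [mf [C hC]].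
exact: (Rintegral_prod12 mtorus (mI r) torus_lty (finI _ _) (F := f) mf hC).
Qed.

Lemma box_prod21 (f : R * R -> R) (r : R) : bmeas f ->
  \int[leb]_(y in torus R) \int[leb]_(w in `[- r, r]) f (y, w) =
  \int[leb]_(w in `[- r, r]) \int[leb]_(y in torus R) f (y, w).
Proof.
move=> [mf [C hC]].
exact: (Rintegral_Fubini mtorus (mI r) torus_lty (finI _ _) (F := f) mf hC).
Qed.

(** The translation is moved from the kernels to [phi], on which Lipschitz bounds are known: in [v]
    the supports allow a change of interval, in [x] the integrand is periodic, and evenness of the
    kernels removes the signs. *)
Lemma sm_conv (phi : R * R -> R) (Rad x v : R) : bmeas phi ->
  (forall w, periodic (fun y => phi (y, w)) 1) ->
  (forall z, Rad < `|z.2| -> phi z = 0) ->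
  sm phi Rad kp et x v =
  \int[leb2]_(z in box d) (phi (z.1 + x, z.2 + v) * (kp z.1 * et z.2)).
Proof.
move=> bphi pphi sphi.
have b1 : bmeas (fun z : R * R => phi z * (kp (x - z.1) * et (v - z.2))).
  apply: bmeasM => //; apply: bmeasM.
    exact: (bmeas_fst (bmeas_affine x bmk)).
  exact: (bmeas_snd (bmeas_affine v bme)).
have b2 : bmeas (fun z : R * R => phi (z.1, z.2 + v) * (kp (x - z.1) * et z.2)).
  apply: bmeasM.
    have := bmeas_shift2 0 v bphi; congr bmeas; apply/funext => z.
    by rewrite addr0.
  by apply: bmeasM; [exact: (bmeas_fst (bmeas_affine x bmk))|exact: bmeas_snd].
have b3 : bmeas (fun z : R * R => phi (z.1 + x, z.2 + v) * (kp z.1 * et z.2)).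
  apply: bmeasM; first exact: bmeas_shift2.
  by apply: bmeasM; [exact: bmeas_fst|exact: bmeas_snd].
rewrite /sm box_prod12//.
transitivity (\int[leb]_(y in torus R) \int[leb]_(w in `[- d, d])
    (phi (y, w + v) * (kp (x - y) * et w))).
  apply: eq_Rintegral => y _.
  have [ms [C hC]] := b1.
  pose g w := phi (y, w) * (kp (x - y) * et (v - w)).
  have mg : measurable_fun setT g.
    exact: (measurableT_comp ms (measurable_pair1 y)).
  have gC w : `|g w| <= C by exact: (hC (y, w)).
  have mD : measurable (`[v - d, v + d]%classic : set (measurableTypeR R)) by exact: measurable_itv.
  rewrite (@eq_Rintegral_support g _ `[v - d, v + d]%classic); first last.
  - move=> w hw; rewrite /g set_ ?mulr0//.
    rewrite leNgt; apply/negP; rewrite ltr_norml => /andP[h1 h2].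
    by apply: hw; rewrite /= in_itv/=; apply/andP; split; lra.
  - move=> w hw; rewrite /g sphi ?mul0r//= ltNge; apply/negP; rewrite ler_norml.
    by move=> h; apply: hw; rewrite /= in_itv.
  rewrite -(Rintegral_translation v mD mg gC (finI _ _)).
  transitivity (\int[leb]_(w in `[- d, d]) g (w + v)).
    congr Rintegral; apply/seteqP; split => w /=; rewrite !in_itv/= => /andP[h1 h2];
      apply/andP; split; lra.
  apply: eq_Rintegral => w _; rewrite /g.
  by rewrite (_ : v - (w + v) = - w) ?eet//; ring.
rewrite (box_prod21 d b2) [RHS]box_prod12// (box_prod21 d b3).
apply: eq_Rintegral => w _.
have [ms [C hC]] := b2.
pose g y := phi (y, w + v) * (kp (x - y) * et w).
have mg : measurable_fun setT g by exact: (measurableT_comp ms (measurable_pair2 w)).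
have gC y : `|g y| <= C by exact: (hC (y, w)).
have pg : periodic g 1.
  move=> y; rewrite /g (pphi (w + v) y); congr (_ * (_ * _)).
  by rewrite opprD addrA -(pkp (x - y - 1)) subrK.
rewrite -(torus_translation x mg gC pg); apply: eq_Rintegral => y _; rewrite /g.
by rewrite (_ : x - (y + x) = - y) ?ekp//; ring.
Qed.

Definition tdist (x : R) : R := `|torus_repr x|.

Lemma tdist_bmeas : bmeas tdist.
Proof.
split; last by exists 2^-1 => x; rewrite /tdist normr_id torus_repr_norm.
apply: continuous_measurable_fun; apply: (@lipschitz_continuous _ _ 1) => x y.
by rewrite mul1r; exact: torus_repr_lipschitz.
Qed.

Definition kmoment : R := \int[leb]_(x in torus R) (kp x * tdist x).

Lemma kmoment_ge0 : 0 <= kmoment.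
Proof. by apply: Rintegral_ge0 => x _; rewrite /tdist mulr_ge0. Qed.

Lemma sm_weight (A B : R) :
  \int[leb2]_(z in box d) ((A + B * tdist z.1) * (kp z.1 * et z.2)) = A + B * kmoment.
Proof.
have bq : bmeas (fun x => (A + B * tdist x) * kp x).
  apply: bmeasM => //; apply: bmeasD; first exact: bmeas_cst.
  exact: bmeasZ tdist_bmeas.
have b1 : bmeas (fun z : R * R => (A + B * tdist z.1) * (kp z.1 * et z.2)).
  have := bmeasM (bmeas_fst bq) (bmeas_snd bme); congr bmeas; apply/funext => z.
  by rewrite mulrA.
have ie : leb.-integrable `[- d, d] (EFin \o et).
  exact: (bmeas_integrable (mI d) (finI _ _) bme).
have it f : bmeas f -> leb.-integrable (torus R) (EFin \o f).
  by move=> bf; exact: (bmeas_integrable mtorus torus_lty bf).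
have ik := it _ bmk.
have im := it _ (bmeasM bmk tdist_bmeas).
rewrite box_prod12//.
transitivity (\int[leb]_(y in torus R) (A * kp y + B * (kp y * tdist y))).
  apply: eq_Rintegral => y _.
  transitivity (\int[leb]_(w in `[- d, d]) (((A + B * tdist y) * kp y) * et w)).
    by apply: eq_Rintegral => w _ /=; ring.
  by rewrite (RintegralZl _ (mI d) ie) iet; ring.
rewrite (RintegralD mtorus (integrable_scale mtorus A ik) (integrable_scale mtorus B im)).
by rewrite (RintegralZl A mtorus ik) (RintegralZl B mtorus im) ikp mulr1.
Qed.

Lemma sm_average (G : R * R -> R) (A B : R) : bmeas G ->
  (forall z, `|z.1| <= 2^-1 -> `|z.2| <= d -> `|G z| <= A + B * tdist z.1) ->
  `|\int[leb2]_(z in box d) (G z * (kp z.1 * et z.2))| <= A + B * kmoment.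
Proof.
move=> bG hG; rewrite -sm_weight.
have bk : bmeas (fun z : R * R => kp z.1 * et z.2).
  by apply: bmeasM; [exact: bmeas_fst|exact: bmeas_snd].
have mB := measurable_box d; have fB := box_lty d.
have i1 := bmeas_integrable mB fB (bmeasM bG bk).
have i2 : leb2.-integrable (box d) (EFin \o (fun z => (A + B * tdist z.1) * (kp z.1 * et z.2))).
  apply: (bmeas_integrable mB fB); apply: bmeasM => //.
  apply: (@bmeasD _ _ _ (fun=> A)); first exact: bmeas_cst.
  by apply: bmeasZ; exact: (bmeas_fst tdist_bmeas).
rewrite (le_trans (le_normr_Rintegral mB i1))//.
apply: le_Rintegral => //; first exact: integrable_norm.
move=> z [zt zI]; rewrite normrM [X in _ * X]ger0_norm ?mulr_ge0//.
rewrite ler_wpM2r ?mulr_ge0//; apply: hG.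
  move: zt; rewrite /torus/= in_itv/= => /andP[h1 h2].
  by rewrite ler_norml; apply/andP; split; lra.
by move: zI; rewrite /= in_itv/= ler_norml.
Qed.

Lemma tdist_torus (x : R) : - 2^-1 <= x < 2^-1 -> tdist x = `|x|.
Proof. by move=> h; rewrite /tdist (@torus_reprE _ 0) ?subr0. Qed.

End smoothing_convolution.

(** * Weak formulation in time *)

Section bounded_lipschitz.
Context {R : realType}.
Implicit Types (f g : R * R -> R) (q r : R -> R).

Definition plipb g := (exists2 L, 0 <= L & plip L g) /\ exists C, forall z, `|g z| <= C.

Lemma plipb_bmeas g : plipb g -> bmeas g.
Proof. by move=> [[L L0 hg] bg]; split => //; exact: plip_measurable hg. Qed.

Lemma plipbM f g : plipb f -> plipb g -> plipb (fun z => f z * g z).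
Proof.
move=> [[L L0 [pf hf]] [C hC]] [[L' L'0 [pg hg]] [C' hC']].
have C0 : 0 <= C by apply: le_trans (hC (0, 0)).
have C'0 : 0 <= C' by apply: le_trans (hC' (0, 0)).
split; last first.
  by exists (C * C') => z; rewrite normrM ler_pM.
exists (C' * L + C * L'); first by rewrite addr_ge0// mulr_ge0.
split=> [v x /=|z w]; first by rewrite (pf v x) (pg v x).
rewrite (_ : f z * g z - f w * g w = g z * (f z - f w) + f w * (g z - g w)); last by ring.
rewrite (le_trans (ler_normD _ _))// !normrM mulrDl -!mulrA lerD// ler_pM//.
Qed.

Lemma plipb_clamp (M : R) : 0 <= M ->
  plipb (fun z => Num.max (- M) (Num.min M z.2)).
Proof.
move=> M0; split; last first.
  exists M => z; rewrite ler_norml le_max lexx/=.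
  by rewrite ge_max ge_min lexx/=; apply/andP; split; lra.
exists 1 => //; split=> // z w; rewrite mul1r.
apply: le_trans (euclidean_dist_ge2 z w).
have mm (a b : R) : Num.max (- M) (Num.min M a) - Num.max (- M) (Num.min M b) <= `|a - b|.
  have := ler_norm (a - b); have := normr_ge0 (a - b).
  rewrite !maxEle !minEle; do 4 case: ifP; move=> *; lra.
by rewrite ler_norml mm andbT lerNl opprB distrC mm.
Qed.

Lemma clamp_id (M v : R) : `|v| <= M -> Num.max (- M) (Num.min M v) = v.
Proof.
by rewrite ler_norml => /andP[h1 h2]; rewrite (min_idPr h2) (max_idPr h1).
Qed.

Lemma sm_plipb (phi : R * R -> R) (Rad : R) q r : bmeas phi ->
  bsmooth q -> bsmooth r -> periodic q 1 -> plipb (fun z => sm phi Rad q r z.1 z.2).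
Proof.
move=> bphi bq br pq.
have [dq [hq bdq]] := bsmooth_derive bq; have [dr [hr bdr]] := bsmooth_derive br.
have Q := bsmooth_bmeas bq; have S := bsmooth_bmeas br.
have dQ := bsmooth_bmeas bdq; have dS := bsmooth_bmeas bdr.
have [C0 h0] := sm_bound Rad bphi Q S.
have [C1 h1] := sm_bound Rad bphi dQ S; have [C2 h2] := sm_bound Rad bphi Q dS.
split; last by exists C0 => z.
have b1 : bsmooth (fun=> 1 : R) by move=> n; exact: Cb_cst.
have d1 x : is_derive x (1 : R) (fun=> 1 : R) 0 by exact: is_derive_cst.
have [C hC] := sm_taylor Rad bphi b1 bq br bdq bdr d1 hq hr.
have dx x v : is_derive x (1 : R) (fun y => sm phi Rad q r y v) (sm phi Rad dq r x v).
  apply: (@is_derive_quad _ _ _ _ _ _ C) => h _; rewrite /GRing.scale/= mulr1.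
  have := hC 0 x v 0 h 0; rewrite !normr0 !addr0 !add0r !mul1r !mulr0 ?mul0r ?add0r ?addr0.
  by rewrite real_normK ?num_real// (addrC x) (mulrC _ h).
have dv x v : is_derive v (1 : R) (fun w => sm phi Rad q r x w) (sm phi Rad q dr x v).
  apply: (@is_derive_quad _ _ _ _ _ _ C) => h _; rewrite /GRing.scale/= mulr1.
  have := hC 0 x v 0 0 h; rewrite !normr0 !addr0 !add0r !mul1r !mulr0 ?mul0r ?add0r ?addr0.
  by rewrite real_normK ?num_real// (addrC v) (mulrC _ h).
have C10 : 0 <= C1 by apply: le_trans (h1 0 0).
have C20 : 0 <= C2 by apply: le_trans (h2 0 0).
exists (C1 + C2); first exact: addr_ge0.
split=> [v x /=|z w].
  by apply: eq_Rintegral => y _; rewrite addrAC pq.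
have e1 := derive_bound_lipschitz (fun x => dx x z.2) (fun x => h1 x z.2) z.1 w.1.
have e2 := derive_bound_lipschitz (fun v => dv w.1 v) (fun v => h2 w.1 v) z.2 w.2.
have := euclidean_dist_ge1 z w; have := euclidean_dist_ge2 z w => l2 l1.
rewrite -(subrKA (sm phi Rad q r w.1 z.2)) (le_trans (ler_normD _ _))// mulrDl lerD//.
  by rewrite (le_trans e1)// ler_wpM2l.
by rewrite (le_trans e2)// ler_wpM2l.
Qed.

End bounded_lipschitz.

(** * Curves uniformly continuous for [w1] *)

Section curve.
Context {R : realType}.
Local Notation leb := (@lebesgue_measure R).
Variables (T : R) (f : R -> probability (R * R)%type R).

Definition w1_unif_cont := forall eta : R, 0 < eta -> exists2 del, 0 < del &
  forall s t, 0 <= s <= T -> 0 <= t <= T -> `|s - t| < del -> w1 (f s) (f t) <= eta.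

Hypothesis Pf : forall t, 0 <= t <= T -> in_P1 (f t).
Hypothesis cf : w1_unif_cont.

Lemma curve_continuous (H : R -> R) (L : R) :
  (forall s t, 0 <= s <= T -> 0 <= t <= T -> `|H s - H t| <= L * w1 (f s) (f t)) ->
  {within `[0, T], continuous H}.
Proof.
move=> hH; apply/subspace_continuousP => s; rewrite /= in_itv/= => hs.
apply/cvgrPdist_le => /= e e0.
pose L' := `|L| + 1.
have L'0 : 0 < L' by rewrite ltr_wpDl.
have [del d0 hd] := cf (divr_gt0 e0 L'0).
rewrite near_withinE; near=> t; rewrite /= in_itv/= => ht.
have wst : w1 (f s) (f t) <= e / L'.
  apply: hd => //; near: t; apply/nbhs_ballP; exists del => //.
have w0 := w1_ge0 (Pf hs) (Pf ht).
rewrite (le_trans (hH s t hs ht))// (@le_trans _ _ (L' * w1 (f s) (f t)))//.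
  by rewrite ler_wpM2r// /L' (le_trans (ler_norm L))// lerDl.
by rewrite mulrC -ler_pdivlMr.
Unshelve. all: by end_near. Qed.

Lemma plip_curve (g : R * R -> R) (L : R) : 0 <= L -> plip L g ->
  forall s t, 0 <= s <= T -> 0 <= t <= T ->
  `|\int[f s]_z g z - \int[f t]_z g z| <= L * w1 (f s) (f t).
Proof. by move=> L0 hg s t hs ht; apply: w1_norm => //; exact: Pf. Qed.

Lemma curve_measurable (H : R -> R) (L : R) :
  (forall s t, 0 <= s <= T -> 0 <= t <= T -> `|H s - H t| <= L * w1 (f s) (f t)) ->
  measurable_fun `[0, T] H.
Proof.
by move=> /curve_continuous h; apply: subspace_continuous_measurable_fun => //.
Qed.

End curve.

Section weak_formulation.
Context {R : realType}.
Local Notation leb := (@lebesgue_measure R).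
Variables (T : R) (f : R -> probability (R * R)%type R) (E : R -> R -> R) (B : R).
Hypothesis T0 : 0 < T.
Hypothesis Pf : forall t, 0 <= t <= T -> in_P1 (f t).
Hypothesis cf : w1_unif_cont T f.
Hypothesis mE : forall t, 0 <= t <= T -> measurable_fun setT (E t).
Hypothesis EB : forall t x, 0 <= t <= T -> `|E t x| <= B.
Hypothesis mG : forall g, plipb g ->
  measurable_fun `[0, T] (fun t => \int[f t]_z (E t z.1 * g z)).
Hypothesis hv : vlasov T f E.

Variables (phi : R * R -> R) (Rad d : R) (q r dq dr : R -> R).
Hypothesis bphi : bmeas phi.
Hypotheses (bq : bsmooth q) (br : bsmooth r) (bdq : bsmooth dq) (bdr : bsmooth dr).
Hypothesis hq : forall x, is_derive x (1 : R) q (dq x).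
Hypothesis hr : forall x, is_derive x (1 : R) r (dr x).
Hypothesis pq : periodic q 1.
Hypothesis rsupp : forall w, d <= `|w| -> r w = 0.

Let Q := bsmooth_bmeas bq.
Let S := bsmooth_bmeas br.
Let u z := sm phi Rad q r z.1 z.2.
Let ux z := sm phi Rad dq r z.1 z.2.
Let uv z := sm phi Rad q dr z.1 z.2.

Let pdq : periodic dq 1 := periodic_derive hq pq.
Let pu : plipb u := sm_plipb Rad bphi bq br pq.
Let pux : plipb ux := sm_plipb Rad bphi bdq br pdq.
Let puv : plipb uv := sm_plipb Rad bphi bq bdr pq.

Lemma sm_support q' x v : bmeas q' -> `|Rad| + d <= `|v| -> sm phi Rad q' r x v = 0.
Proof.
move=> bq' h; apply: sm_abs => // w wR; apply: rsupp.
have : `|v| <= `|v - w| + `|w| by rewrite -{1}(subrK w v) ler_normD.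
have := ler_norm Rad; lra.
Qed.

Let clampM := `|Rad| + `|d|.

Definition transport_term (z : R * R) : R := z.2 * ux z.

(** The velocity is unbounded, but [ux] vanishes for [|v|] beyond [|Rad| + d], so that [z.2] may be
    replaced by its clamped value. *)
Lemma transport_plipb : plipb transport_term.
Proof.
have M0 : 0 <= clampM by rewrite addr_ge0.
have := plipbM (plipb_clamp M0) pux; congr plipb; apply/funext => z.
rewrite /transport_term; have [h|h] := leP `|z.2| clampM; first by rewrite clamp_id.
rewrite /ux sm_support ?mulr0//; first exact: bsmooth_bmeas.
by move: h; rewrite /clampM; have := ler_norm d; lra.
Qed.

Definition moment t := \int[f t]_z u z.
Definition flux t := \int[f t]_z (transport_term z + E t z.1 * uv z).

Let integr t g : plipb g -> (f t).-integrable setT (EFin \o g).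
Proof. by move=> /plipb_bmeas bg; exact: (bmeas_integrable measurableT (prob_lty _)). Qed.

Let integrE t g : 0 <= t <= T -> plipb g -> (f t).-integrable setT (EFin \o (fun z => E t z.1 * g z)).
Proof.
move=> ht /plipb_bmeas bg; apply: (bmeas_integrable measurableT (prob_lty _)).
apply: bmeasM => //; split; last by exists B => z; exact: EB.
exact: (measurableT_comp (mE ht) measurable_fst).
Qed.

Lemma flux_bounded : exists2 M, 0 <= M & forall t, 0 <= t <= T -> `|flux t| <= M.
Proof.
have [_ [A hA]] := transport_plipb; have [_ [C hC]] := puv.
have A0 : 0 <= A by apply: le_trans (hA (0, 0)).
have C0 : 0 <= C by apply: le_trans (hC (0, 0)).
have B0 : 0 <= B.
  have h0 : 0 <= (0 : R) <= T by rewrite lexx ltW.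
  exact: le_trans (normr_ge0 _) (EB 0 h0).
exists (A + B * C); first by rewrite addr_ge0// mulr_ge0.
move=> t ht; apply: prob_norm_le.
  apply: measurable_funD; first by have [] := plipb_bmeas transport_plipb.
  apply: measurable_funM; last by have [] := plipb_bmeas puv.
  exact: (measurableT_comp (mE ht) measurable_fst).
move=> z; rewrite (le_trans (ler_normD _ _))// lerD// normrM ler_pM//.
exact: EB.
Qed.

Lemma flux_measurable : measurable_fun `[0, T] flux.
Proof.
apply: (eq_measurable_fun (fun t => \int[f t]_z transport_term z + \int[f t]_z (E t z.1 * uv z))).
  move=> t; rewrite inE/= in_itv/= => ht.
  rewrite /flux RintegralD//; [exact/integr/transport_plipb|exact: integrE].
apply: measurable_funD; last exact: mG.
have [[L L0 hL] _] := transport_plipb.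
exact: (curve_measurable Pf cf (plip_curve Pf L0 hL)).
Qed.

Lemma moment_lipschitz : exists2 L, 0 <= L & forall s t, 0 <= s <= T -> 0 <= t <= T ->
  `|moment s - moment t| <= L * w1 (f s) (f t).
Proof. by have [[L L0 hL] _] := pu; exists L => //; exact: (plip_curve Pf L0 hL). Qed.

Lemma moment_bounded : exists2 M, 0 <= M & forall t, `|moment t| <= M.
Proof.
have [_ [A hA]] := pu; exists A; first by apply: le_trans (hA (0, 0)).
move=> t; apply: prob_norm_le => //; first by have [] := plipb_bmeas pu.
Qed.

Lemma moment_measurable : measurable_fun `[0, T] moment.
Proof. by have [L _ hL] := moment_lipschitz; exact: (curve_measurable Pf cf hL). Qed.

(** Test functions of the form [p(t) u(x, v)] reduce the Vlasov equation to the statement that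
    [moment] has distributional derivative [flux] on []0, T[]. *)
Lemma vlasov_product (p dp : R -> R) (a b : R) : bsmooth p -> bsmooth dp ->
  (forall t, is_derive t (1 : R) p (dp t)) -> 0 < a -> b < T ->
  (forall t, p t != 0 -> a <= t <= b) ->
  \int[leb]_(t in `[0, T]) (dp t * moment t + p t * flux t) = 0.
Proof.
move=> bp bdp hp a0 bT sp.
have D := sm_derive Rad bphi bp bq br bdq bdr hp hq hr.
have tF : tclass phi Rad (tprod phi Rad p q r).
  have := tclassS bp bq br (tclass0 phi Rad); congr tclass.
  by apply/funext => z; rewrite addr0.
have test : test_function T (tprod phi Rad p q r).
  split; first exact: tclass_smooth tF.
    by move=> t v x; rewrite /tprod/=; congr (_ * _); apply: eq_Rintegral => y _; rewrite addrAC pq.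
  exists a, b, (`|Rad| + d); split => // t x v; rewrite /tprod/= => h; split.
    by apply: sp; apply: contra_neq h => ->; rewrite mul0r.
  rewrite leNgt; apply/negP => hv'; move/eqP: h; apply.
  by rewrite sm_support ?mulr0// ltW.
rewrite /Rintegral -[RHS]/(fine 0%E); congr fine; rewrite -[RHS](hv test).
apply: eq_integral => t; rewrite inE/= in_itv/= => ht.
have i1 := integr t pu. have i2 := integr t transport_plipb.
have i3 := integrE ht puv.
have i4 := integrable_add measurableT i2 i3.
have i5 := integrable_scale measurableT (dp t) i1.
have i6 := integrable_scale measurableT (p t) i4.
rewrite /moment /flux -(RintegralZl _ measurableT i1) -(RintegralZl _ measurableT i4).
rewrite -(RintegralD measurableT i5 i6) /Rintegral fineK; last first.
  by apply: integrable_fin_num => //; exact: (integrable_add measurableT i5 i6).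
apply: eq_integral => z _; congr EFin.
have [_ Dz] := D (t, z.1, z.2).
rewrite !(@derive_val _ _ _ _ _ _ _ (Dz _)) /= /transport_term /ux /uv /u; ring.
Qed.

End weak_formulation.

(** * From weak time derivatives to increments *)

Section du_bois_reymond.
Context {R : realType}.
Local Notation leb := (@lebesgue_measure R).

Lemma Rintegral_subset_support (F : R -> R) (A B : set (measurableTypeR R)) :
  B `<=` A -> (forall x, A x -> ~ B x -> F x = 0) ->
  \int[leb]_(x in A) F x = \int[leb]_(x in B) F x.
Proof.
move=> BA h; rewrite Rintegral_mkcond [RHS]Rintegral_mkcond.
apply: eq_Rintegral => x _; rewrite !patchE.
case: ifPn => xA; case: ifPn => xB //.
- by apply: h; [rewrite inE in xA|move=> Bx; rewrite mem_set in xB].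
- by move: xA; rewrite inE in xB; rewrite mem_set//; exact: BA.
Qed.

Lemma itvcc_lty (a b : R) : (leb (`[a, b]%classic) < +oo)%E.
Proof. by rewrite lebesgue_measure_itv/=; case: ifP => _; rewrite ltry. Qed.

Lemma itvoc_lty (a b : R) : (leb (`]a, b]%classic) < +oo)%E.
Proof. by rewrite lebesgue_measure_itv/=; case: ifP => _; rewrite ltry. Qed.

Lemma Rintegral_itvcc_norm_le (F : R -> R) (a b C : R) : a <= b ->
  measurable_fun (`[a, b]%classic : set (measurableTypeR R)) F ->
  (forall x, a <= x <= b -> `|F x| <= C) ->
  `|\int[leb]_(x in `[a, b]) F x| <= C * (b - a).
Proof.
move=> ab mF hF.
have mD : measurable (`[a, b]%classic : set (measurableTypeR R)) by exact: measurable_itv.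
apply: (le_trans (Rintegral_norm_le mD (itvcc_lty a b) mF (C := C) _)).
  by move=> x /=; rewrite in_itv/=; exact: hF.
rewrite le_eqVlt; apply/orP; left; apply/eqP; congr (_ * _).
rewrite -[RHS]/(fine (b - a)%:E); congr fine.
have [e|ab'] := eqVneq a b.
  rewrite e subrr; transitivity (leb `[b, b]%classic) => //; rewrite lebesgue_measure_itv/= ltxx//.
have -> : (b - a)%:E = leb `[a, b]%classic.
  by rewrite lebesgue_measure_itv/= lte_fin lt_neqAle ab' ab EFinB.
by [].
Qed.

Variables (T M : R) (I G : R -> R).
Hypotheses (T0 : 0 < T) (mI : measurable_fun `[0, T] I) (mG : measurable_fun `[0, T] G).
Hypotheses (bI : forall t : R, 0 <= t <= T -> `|I t| <= M) (bG : forall t : R, 0 <= t <= T -> `|G t| <= M).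
Hypothesis cI : forall c : R, 0 < c < T -> forall e : R, 0 < e -> exists2 del, 0 < del &
  forall t : R, 0 <= t <= T -> `|t - c| < del -> `|I t - I c| <= e.
Hypothesis weak : forall (p dp : R -> R) (a b : R), bsmooth p -> bsmooth dp ->
  (forall t, is_derive t (1 : R) p (dp t)) -> 0 < a -> b < T ->
  (forall t, p t != 0 -> a <= t <= b) ->
  \int[leb]_(t in `[0, T]) (dp t * I t + p t * G t) = 0.

Let mcc (a b : R) : measurable (`[a, b]%classic : set (measurableTypeR R)).
Proof. exact: measurable_itv. Qed.

Let integrT (g : R -> R) (C : R) : measurable_fun `[0, T] g -> (forall t : R, 0 <= t <= T -> `|g t| <= C) ->
  leb.-integrable `[0, T] (EFin \o g).
Proof.
move=> mg hg; apply: (@bounded_integrable _ _ _ leb _ (mcc 0 T) (itvcc_lty 0 T) g C mg) => t.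
by rewrite /= in_itv/=; exact: hg.
Qed.

(** The kernel has integral one and lives on [[c, c + 1/N]]. As no sign is imposed on [dth], its
    [L^1] norm is only bounded by [C], whence the tolerance [e / (C + 1)] on [I]. *)
Lemma approximate_delta (th dth : R -> R) (c : R) : 0 < c < T ->
  bsmooth dth -> (forall s, is_derive s (1 : R) th (dth s)) ->
  (forall s, s <= 0 -> th s = 0) -> (forall s, 1 <= s -> th s = 1) ->
  (forall s, s < 0 \/ 1 < s -> dth s = 0) ->
  \int[leb]_(t in `[0, T]) (n.+1%:R * dth (n.+1%:R * t + - (n.+1%:R * c)) * I t)
    @[n --> \oo] --> I c.
Proof.
move=> hc bdth hth th0 th1 dth0; have /andP[c0 cT] := hc.
have [C hC] := Cb_bounded (bdth 0%N).
have C0 : 0 <= C by apply: le_trans (hC 0).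
have cdth : continuous dth by have [ddth [h _]] := bsmooth_derive bdth; exact: derive_continuous h.
apply/cvgrPdist_le => /= e e0.
have eC : 0 < e / (C + 1) by rewrite divr_gt0// ltr_wpDl.
have [del del0 hdel] := cI hc eC.
have Tc : 0 < T - c by rewrite subr_gt0.
near=> n.
have Nd : n.+1%:R^-1 < del by near: n; exact: near_infty_natSinv_lt (PosNum del0).
have NT : n.+1%:R^-1 < T - c by near: n; exact: near_infty_natSinv_lt (PosNum Tc).
set N : R := n.+1%:R in Nd NT *.
have N0 : 0 < N by rewrite ltr0n.
pose k t := N * dth (N * t + - (N * c)).
have ck : continuous k.
  move=> t; apply: cvgM; first exact: cvg_cst.
  apply: continuous_cvg; first exact: cdth.
  by apply: cvgD; [apply: cvgM; [exact: cvg_cst|exact: cvg_id]|exact: cvg_cst].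
have hk t : is_derive t (1 : R) (fun y => th (N * y + - (N * c))) (k t).
  have h : is_derive t (1 : R) (fun y => N * y + - (N * c)) N.
    apply: (is_derive_eq (is_deriveD (is_deriveZ N (is_derive_id t (1:R))) (is_derive_cst (- (N * c) : R) t (1 : R)))).
    by rewrite addr0 /GRing.scale/= mulr1.
  by apply: (is_derive_eq (@is_derive1_comp _ th _ t _ _ (hth _) h)); rewrite /k mulrC.
have kb t : `|k t| <= N * C by rewrite /k normrM (gtr0_norm N0) ler_wpM2l// ltW.
have mk : measurable_fun `[0, T] k by exact: continuous_measurable.
have int1 : \int[leb]_(t in `[0, T]) k t = 1.
  rewrite (Rintegral_FTC2 T0 hk ck) th1; last first.
    by rewrite -mulrN -mulrDr -ler_pdivrMl// mulr1 ltW.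
  rewrite th0 ?subr0// mulr0 add0r oppr_le0 mulr_ge0// ltW//.
have i1 := integrT mk (fun t _ => kb t).
have i2 : leb.-integrable `[0, T] (EFin \o (fun t => k t * I t)).
  apply: (@integrT _ (N * C * M)); first exact: measurable_funM.
  by move=> t ht; rewrite normrM ler_pM// bI.
have -> : I c - \int[leb]_(t in `[0, T]) (k t * I t) =
    \int[leb]_(t in `[0, T]) (I c * k t - k t * I t).
  rewrite (RintegralB (mcc 0 T) (integrable_scale (mcc 0 T) (I c) i1) i2).
  by rewrite (RintegralZl _ (mcc 0 T) i1) int1 mulr1.
rewrite (@Rintegral_subset_support _ _ `[c, c + N^-1]%classic); last 2 first.
- move=> t /=; rewrite !in_itv/= => /andP[t1 t2]; apply/andP; split; first lra.
  by rewrite (le_trans t2)//; move: NT; set m := N^-1; lra.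
- move=> t _; rewrite /= in_itv/= => ht.
  suff -> : k t = 0 by rewrite mulr0 mul0r subr0.
  rewrite /k dth0 ?mulr0//.
  have [tc|tc] := ltP t c; [left|right].
    by rewrite -mulrN -mulrDr pmulr_rlt0// subr_lt0.
  have : c + N^-1 < t by rewrite ltNge; apply/negP => h; apply: ht; rewrite tc.
  by rewrite -mulrN -mulrDr -ltr_pdivrMl// mulr1 ltrBrDl.
have cN : c <= c + N^-1 by rewrite lerDl invr_ge0 ltW.
apply: (@le_trans _ _ (N * C * (e / (C + 1)) * (c + N^-1 - c))).
  apply: Rintegral_itvcc_norm_le => //.
    apply: (measurable_funS (mcc 0 T)).
      move=> t /=; rewrite !in_itv/= => /andP[t1 t2]; apply/andP; split; first lra.
      by rewrite (le_trans t2)//; move: NT; set m := N^-1; lra.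
    apply: measurable_funB; last exact: measurable_funM.
    by apply: measurable_funM => //; exact: measurable_cst.
  move=> t /andP[t1 t2]; rewrite (mulrC (I c)) -mulrBr normrM ler_pM//.
  rewrite distrC; apply: hdel; first by move: NT t2; set m := N^-1 => *; apply/andP; split; lra.
  by rewrite ger0_norm ?subr_ge0//; move: Nd t2; set m := N^-1; lra.
rewrite [c + N^-1 - c]addrAC subrr add0r.
rewrite (_ : N * C * (e / (C + 1)) * N^-1 = C * (e / (C + 1))); last first.
  by field; apply/andP; split; rewrite gt_eqF// ltr_wpDl.
by rewrite mulrCA ger_pMr// ler_pdivrMr ?mul1r ?lerDl// ltr_wpDl.
Unshelve. all: by end_near. Qed.

(** [p n] climbs right after [a] and descends right after [b]: it converges at every point to the
    indicator of []a, b]], and its support stays inside []0, T[] for large [n]. *)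
Lemma weak_increment (a b : R) : 0 < a -> a < b -> b < T ->
  I b - I a = \int[leb]_(t in `]a, b]) G t.
Proof.
move=> a0 ab bT.
have [th [dth [bth hth bdth [th0 th1] dth0]]] := smooth_step (R := R).
have [C hC] := Cb_bounded (bth 0%N).
have ha : 0 < a < T by apply/andP; split; lra.
have hb : 0 < b < T by apply/andP; split; lra.
have La := approximate_delta ha bdth hth th0 th1 dth0.
have Lb := approximate_delta hb bdth hth th0 th1 dth0.
pose p n t : R := th (n.+1%:R * t + - (n.+1%:R * a)) - th (n.+1%:R * t + - (n.+1%:R * b)).
pose ka n t : R := n.+1%:R * dth (n.+1%:R * t + - (n.+1%:R * a)).
pose kb n t : R := n.+1%:R * dth (n.+1%:R * t + - (n.+1%:R * b)).
have bka n : bsmooth (ka n) by move=> m; apply: CbZ; exact: Cb_affine.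
have bkb n : bsmooth (kb n) by move=> m; apply: CbZ; exact: Cb_affine.
have bp n : bsmooth (p n).
  move=> m; have := CbD (Cb_affine n.+1%:R (- (n.+1%:R * a)) (bth m))
    (CbZ (-1) (Cb_affine n.+1%:R (- (n.+1%:R * b)) (bth m))).
  by congr Cb; apply/funext => t; rewrite mulN1r.
have hp n t : is_derive t (1 : R) (p n) (ka n t - kb n t).
  have hk c : is_derive t (1 : R) (fun y => th (n.+1%:R * y + - (n.+1%:R * c)))
      (n.+1%:R * dth (n.+1%:R * t + - (n.+1%:R * c))).
    have h : is_derive t (1 : R) (fun y => n.+1%:R * y + - (n.+1%:R * c)) n.+1%:R.
      apply: (is_derive_eq (is_deriveD (is_deriveZ (n.+1%:R : R) (is_derive_id t (1:R)))
        (is_derive_cst (- (n.+1%:R * c) : R) t (1 : R)))).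
      by rewrite addr0 /GRing.scale/= mulr1.
    by apply: (is_derive_eq (@is_derive1_comp _ th _ t _ _ (hth _) h)); rewrite mulrC.
  exact: is_deriveB (hk a) (hk b).
have bdp n : bsmooth (fun t => ka n t - kb n t).
  move=> m; have := CbD (bka n m) (CbZ (-1) (bkb n m)).
  by congr Cb; apply/funext => t; rewrite mulN1r.
have mb (h : R -> R) : bsmooth h -> measurable_fun `[0, T] h.
  by move=> /bsmooth_bmeas[mh _]; exact: measurable_funTS.
have i1 n c : leb.-integrable `[0, T] (EFin \o (fun t =>
    n.+1%:R * dth (n.+1%:R * t + - (n.+1%:R * c)) * I t)).
  have bk : bsmooth (fun t : R => n.+1%:R * dth (n.+1%:R * t + - (n.+1%:R * c))).
    by move=> m; apply: CbZ; exact: Cb_affine.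
  have [D hD] := Cb_bounded (bk 0%N).
  apply: (@integrT _ (D * M)); first by apply: measurable_funM => //; exact: mb.
  by move=> t ht; rewrite normrM ler_pM// bI.
have pC n t : `|p n t| <= C + C by rewrite (le_trans (ler_normB _ _))// lerD.
have i2 n : leb.-integrable `[0, T] (EFin \o (fun t => p n t * G t)).
  apply: (@integrT _ ((C + C) * M)); first by apply: measurable_funM => //; exact: mb.
  by move=> t ht; rewrite normrM ler_pM// bG.
pose G1 t := if a < t <= b then G t else 0.
have G1E : G1 = (G \_ `]a, b]%classic).
  apply/funext => t; rewrite patchE /G1; case: ifPn => ht.
    by rewrite mem_set//= in_itv/=.
  by rewrite memNset//= in_itv/=; apply/negP.
have sub : `]a, b]%classic `<=` (`[0, T]%classic : set R).
  by move=> t /=; rewrite !in_itv/= => /andP[t1 t2]; apply/andP; split; lra.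
have LG : \int[leb]_(t in `[0, T]) (p n t * G t) @[n --> \oo] -->
    \int[leb]_(t in `[0, T]) G1 t.
  apply: (Rintegral_cvg (mcc 0 T) (itvcc_lty 0 T) (C := (C + C) * M)).
  - by move=> n; apply: measurable_funM => //; exact: mb.
  - rewrite G1E; apply: (measurable_restrict _ (measurable_itv _) (mcc 0 T)).1.
    by apply: (measurable_funS (mcc 0 T)) mG => t [].
  - by move=> n t /=; rewrite in_itv/= => ht; rewrite normrM ler_pM// bG.
  move=> t /=; rewrite in_itv/= => ht.
  have ev c : c < t -> \forall n \near \oo, th (n.+1%:R * t + - (n.+1%:R * c)) = 1.
    move=> ct; have tc : 0 < t - c by rewrite subr_gt0.
    near=> n; apply: th1; rewrite -mulrN -mulrDr -ler_pdivrMl// mulr1 ltW//.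
    near: n; exact: near_infty_natSinv_lt (PosNum tc).
  have z c n : t <= c -> th (n.+1%:R * t + - (n.+1%:R * c)) = 0.
    by move=> tc; apply: th0; rewrite -mulrN -mulrDr pmulr_rle0// subr_le0.
  rewrite /G1; have [ta|ta] := ltP a t; last first.
    rewrite /=; apply: cvg_near_cst; near=> n.
    by rewrite /p !z ?subr0 ?mul0r//; lra.
  have [tb|tb] := leP t b => /=.
    apply: cvg_near_cst; near=> n.
    by rewrite /p (z b)// (near (ev a ta) n)// subr0 mul1r.
  apply: cvg_near_cst; near=> n.
  by rewrite /p (near (ev a ta) n)// (near (ev b tb) n)// subrr mul0r.
have IG : \int[leb]_(t in `[0, T]) G1 t = \int[leb]_(t in `]a, b]) G t.
  rewrite (@Rintegral_subset_support G1 _ `]a, b]%classic)//.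
    by apply: eq_Rintegral => t; rewrite inE/= in_itv/= /G1 => ->.
  by move=> t _; rewrite /= in_itv/= /G1 => /negP/negbTE ->.
have W : \forall n \near \oo,
    \int[leb]_(t in `[0, T]) (ka n t * I t) - \int[leb]_(t in `[0, T]) (kb n t * I t) +
    \int[leb]_(t in `[0, T]) (p n t * G t) = 0.
  have Tb : 0 < T - b by rewrite subr_gt0.
  near=> n.
  have iab := integrable_sub (mcc 0 T) (i1 n a) (i1 n b).
  rewrite -(RintegralB (mcc 0 T) (i1 n a) (i1 n b)) -(RintegralD (mcc 0 T) iab (i2 n)).
  have bn : b + n.+1%:R^-1 < T by rewrite -ltrBrDl; near: n; exact: near_infty_natSinv_lt (PosNum Tb).
  transitivity (\int[leb]_(t in `[0, T]) ((ka n t - kb n t) * I t + p n t * G t)).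
    by apply: eq_Rintegral => t _; rewrite (mulrBl (I t) (ka n t) (kb n t)).
  apply: (weak (bp n) (bdp n) (hp n) a0 bn).
  move=> t; apply: contra_neqT => ht; rewrite /p.
  have N0 : 0 < n.+1%:R :> R by rewrite ltr0n.
  have [ta|ta] := ltP t a.
    by rewrite !th0 ?subrr// -mulrN -mulrDr pmulr_rle0// subr_le0; lra.
  have tb : b + n.+1%:R^-1 < t by rewrite ltNge; apply/negP => h; move: ht; rewrite ta h.
  have i0 : 0 < n.+1%:R^-1 :> R by rewrite invr_gt0.
  move: tb i0; set m := n.+1%:R^-1 => tb i0.
  by rewrite !th1 ?subrr// -mulrN -mulrDr -ler_pdivrMl// mulr1 -/m; lra.
have L : \int[leb]_(t in `[0, T]) (ka n t * I t) - \int[leb]_(t in `[0, T]) (kb n t * I t) +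
    \int[leb]_(t in `[0, T]) (p n t * G t) @[n --> \oo] --> I a - I b + \int[leb]_(t in `]a, b]) G t.
  by rewrite -IG; apply: cvgD => //; exact: cvgB.
have : I a - I b + \int[leb]_(t in `]a, b]) G t = 0.
  by apply: cvg_unique L _ => //; exact: cvg_near_cst.
lra.
Unshelve. all: by end_near. Qed.

End du_bois_reymond.

(** * Transport of mollified test functions *)

Section mollified_test.
Context {R : realType}.
Local Notation leb := (@lebesgue_measure R).
Local Notation leb2 := (leb \x leb)%E.

Record mollifier (kp dkp et det : R -> R) (d : R) : Prop := Mollifier {
  mol_kp : bsmooth kp; mol_dkp : bsmooth dkp;
  mol_et : bsmooth et; mol_det : bsmooth det;
  mol_kpD : forall x, is_derive x (1 : R) kp (dkp x);
  mol_etD : forall x, is_derive x (1 : R) et (det x);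
  mol_per : periodic kp 1;
  mol_kpN : forall x, kp (- x) = kp x; mol_etN : forall w, et (- w) = et w;
  mol_kp0 : forall x, 0 <= kp x; mol_et0 : forall w, 0 <= et w;
  mol_int : \int[leb]_(x in torus R) kp x = 1;
  mol_d0 : 0 < d;
  mol_supp : forall w, d <= `|w| -> et w = 0;
  mol_iet : \int[leb]_(w in `[- d, d]) et w = 1 }.

Definition cutlip (Rho : R) (phi : R * R -> R) :=
  plip 1 phi /\ forall z, Rho <= `|z.2| -> phi z = 0.

(** Moving in [v] only, the zero set is reached within distance [Rho]. *)
Lemma cutlip_bound Rho phi : 0 <= Rho -> cutlip Rho phi -> forall z, `|phi z| <= Rho.
Proof.
move=> Rho0 [[_ hphi] sphi] [x v].
have [h|h] := leP Rho `|v|; first by rewrite sphi// normr0.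
have e : phi (x, Rho) = 0 by apply: sphi; rewrite /= ger0_norm.
have e' : phi (x, - Rho) = 0 by apply: sphi; rewrite /= normrN ger0_norm.
have hd w : `|phi (x, v) - phi (x, w)| <= `|v - w|.
  apply: le_trans (hphi _ _) _; rewrite mul1r (le_trans (euclidean_dist_le_sum _ _))//=.
  by rewrite subrr normr0 add0r.
move: h; rewrite ltr_norml => /andP[h1 h2].
have [v0|v0] := leP 0 v.
  have := hd Rho; rewrite e subr0 => /le_trans; apply.
  by rewrite ler_norml; apply/andP; split; lra.
have := hd (- Rho); rewrite e' subr0 => /le_trans; apply.
by rewrite ler_norml; apply/andP; split; lra.
Qed.

Lemma cutlip_bmeas Rho phi : 0 <= Rho -> cutlip Rho phi -> bmeas phi.
Proof.
move=> Rho0 h; split; last by exists Rho; exact: cutlip_bound.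
by have [hp _] := h; exact: plip_measurable hp.
Qed.

Lemma cutlipW Rho Rho' phi : Rho <= Rho' -> cutlip Rho phi -> cutlip Rho' phi.
Proof. by move=> h [h1 h2]; split => // z hz; apply: h2; exact: le_trans hz. Qed.

Variables (kp dkp et det : R -> R) (d Rad B : R).
Hypothesis mol : mollifier kp dkp et det d.
Hypotheses (Rad0 : 0 <= Rad) (B0 : 0 <= B).

Let bkp := mol_kp mol. Let bet := mol_et mol.
Let bdk := mol_dkp mol. Let bde := mol_det mol.
Let d0 := mol_d0 mol.

Let admissible (phi : R * R -> R) := [/\ bmeas phi, forall w, periodic (fun x => phi (x, w)) 1 &
  forall z : R * R, Rad < `|z.2| -> phi z = 0].

Let cutlip_admissible phi : cutlip Rad phi -> admissible phi.
Proof.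
move=> hphi; have [[pp _] sp] := hphi; split=> //; first exact: cutlip_bmeas hphi.
by move=> z /ltW; exact: sp.
Qed.

Let conv_form phi x v : admissible phi -> sm phi Rad kp et x v =
  \int[leb2]_(z in box d) (phi (z.1 + x, z.2 + v) * (kp z.1 * et z.2)).
Proof.
move=> [bphi pp sp].
exact: (sm_conv bkp (mol_per mol) (mol_kpN mol) bet (mol_etN mol) (mol_supp mol)).
Qed.

Let boxint G : bmeas G -> leb2.-integrable (box d) (EFin \o (fun z => G z * (kp z.1 * et z.2))).
Proof.
move=> bG; apply: (bmeas_integrable (measurable_box d) (box_lty d)); apply: bmeasM => //.
by apply: bmeasM; [exact: bmeas_fst (bsmooth_bmeas bkp)|exact: bmeas_snd (bsmooth_bmeas bet)].
Qed.

(* By convolution, a pointwise comparison of two test functions is transferred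
   to their mollifications, up to the first moment of the kernel. *)
Let sm_compare phi psi x v x' v' (A C : R) : admissible phi -> admissible psi ->
  (forall y w, `|y| <= 2^-1 -> `|w| <= d ->
    `|phi (y + x, w + v) - psi (y + x', w + v')| <= A + C * tdist y) ->
  `|sm phi Rad kp et x v - sm psi Rad kp et x' v'| <= A + C * kmoment kp.
Proof.
move=> hphi hpsi h; rewrite !conv_form//.
have [bphi _ _] := hphi; have [bpsi _ _] := hpsi.
have b1 := bmeas_shift2 x v bphi; have b2 := bmeas_shift2 x' v' bpsi.
rewrite -(RintegralB (measurable_box d) (boxint b1) (boxint b2)).
under eq_Rintegral => z _ do rewrite -mulrBl.
apply: (sm_average bkp (mol_kp0 mol) (mol_int mol) bet (mol_et0 mol) (mol_iet mol)).
  exact: bmeasB.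
by move=> z h1 h2; exact: h.
Qed.

Lemma sm_plip1 phi : cutlip Rad phi -> plip 1 (fun z => sm phi Rad kp et z.1 z.2).
Proof.
move=> hphi; have [[pp hp] sp] := hphi; split=> [v x /=|z w].
  by apply: eq_Rintegral => y _; rewrite addrAC (mol_per mol).
rewrite mul1r (_ : euclidean_dist z w = euclidean_dist z w + 0 * kmoment kp); last by rewrite mul0r addr0.
apply: sm_compare => [||y u _ _]; [exact: cutlip_admissible|exact: cutlip_admissible|].
rewrite mul0r addr0.
have := hp (y + z.1, u + z.2) (y + w.1, u + w.2); rewrite mul1r /euclidean_dist/=.
by rewrite !opprD !addrA !(addrAC _ _ (- y)) !(addrAC _ _ (- u)) !subrr !add0r.
Qed.

Lemma sm_approx phi x v : cutlip Rad phi ->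
  `|sm phi Rad kp et x v - phi (x, v)| <= d + kmoment kp.
Proof.
move=> hphi; have [[pp hp] sp] := hphi.
have b1 := bmeas_shift2 x v (cutlip_bmeas Rad0 hphi).
have b2 : bmeas (fun _ : R * R => phi (x, v)) by exact: bmeas_cst.
have e : phi (x, v) = \int[leb2]_(z in box d) (phi (x, v) * (kp z.1 * et z.2)).
  have := sm_weight bkp (mol_int mol) bet (mol_iet mol) (phi (x, v)) 0.
  rewrite mul0r addr0 => {1}<-; apply: eq_Rintegral => z _.
  by rewrite mul0r addr0.
rewrite [X in _ - X]e conv_form; last exact: cutlip_admissible.
rewrite -[kmoment kp]mul1r.
rewrite -(RintegralB (measurable_box d) (boxint b1) (boxint b2)).
under eq_Rintegral => z _ do rewrite -mulrBl.
apply: (sm_average bkp (mol_kp0 mol) (mol_int mol) bet (mol_et0 mol) (mol_iet mol)).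
  exact: bmeasB.
move=> z h1 h2.
have e1 : phi (z.1 + x, z.2 + v) = phi (torus_repr z.1 + x, z.2 + v).
  rewrite [RHS](periodic_repr (f := fun y => phi (y + x, z.2 + v)))// => y.
  by rewrite addrAC pp.
rewrite e1 (le_trans (hp _ _))// mul1r (le_trans (euclidean_dist_le_sum _ _))//=.
by rewrite !addrK mul1r addrC lerD.
Qed.

Lemma sm_scale (c : R) phi q r x v : bmeas phi -> bmeas q -> bmeas r ->
  sm (fun z => c * phi z) Rad q r x v = c * sm phi Rad q r x v.
Proof.
move=> [mp hp] bq br.
have bphi' : bmeas (phi : measurableTypeR R * measurableTypeR R -> R) by split.
have i := bmeas_integrable (measurable_box Rad) (box_lty Rad)
  (bmeasM bphi' (bmeas_kernel x v bq br)).
rewrite /sm -(RintegralZl c (measurable_box Rad) i).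
by apply: eq_Rintegral => z _; rewrite -mulrA.
Qed.

(** [C] has to be uniform over test functions, because the step length in [mollified_step] is fixed
    before the test function, which changes at each step. The common bound [Rad] on [phi] provides
    this. *)
Lemma sm_uniform_taylor : exists2 C, 0 <= C & forall phi, cutlip Rad phi -> forall x v b c,
  `|sm phi Rad kp et (x + b) (v + c) - sm phi Rad kp et x v -
    (sm phi Rad dkp et x v * b + sm phi Rad kp det x v * c)| <= C * (`|b| + `|c|) ^+ 2.
Proof.
have b1 : bsmooth (fun=> 1 : R) by move=> n; exact: Cb_cst.
have d1 x : is_derive x (1 : R) (fun=> 1 : R) 0 by exact: is_derive_cst.
have [C hC] := triple_product_taylor b1 bkp bet d1 (mol_kpD mol) (mol_etD mol).
exists (`|Rad * C * fine (leb2 (box Rad))|) => // phi hphi x v b c.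
have bphi := cutlip_bmeas Rad0 hphi.
have bnd := cutlip_bound Rad0 hphi.
have := sm_taylor_le Rad bphi b1 bkp bet bdk bde hC bnd 0 x v 0 b c.
rewrite normr0 add0r !mul1r !mul0r add0r => /le_trans; apply.
by rewrite ler_wpM2r ?sqr_ge0// ler_norm.
Qed.

(** The mollification is 1-Lipschitz, and the quadratic remainder disappears as the increment [c]
    tends to 0. *)
Lemma sm_dv_bound phi x v : cutlip Rad phi -> `|sm phi Rad kp det x v| <= 1.
Proof.
move=> hphi; have [C C0 hC] := sm_uniform_taylor.
have [_ hu] := sm_plip1 hphi.
set D := sm phi Rad kp det x v.
have key c : 0 < c -> `|D| <= 1 + C * c.
  move=> c0; have := hC phi hphi x v 0 c; rewrite addr0 mulr0 normr0 !add0r -/D (gtr0_norm c0).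
  have := hu (x, v + c) (x, v); rewrite mul1r => /le_trans /(_ (euclidean_dist_le_sum _ _)) /=.
  rewrite subrr normr0 add0r addrAC subrr add0r (gtr0_norm c0).
  set w := _ - _ => h1 h2.
  have : `|D * c| <= c + C * c ^+ 2.
    rewrite -(subKr w (D * c)) (le_trans (ler_normB _ _))// lerD//.
  by rewrite normrM (gtr0_norm c0) (_ : c + C * c ^+ 2 = (1 + C * c) * c) ?ler_pM2r//; ring.
apply/ler_addgt0Pr => e e0.
have C1 : 0 < C + 1 by rewrite ltr_wpDl.
apply: le_trans (key (e / (C + 1)) _) _; first exact: divr_gt0.
rewrite lerD2l mulrCA ger_pMr// ler_pdivrMr// mul1r lerDl//.
Qed.

(** The displacement [h * v] is not bounded, whence two cases: for moderate [v] the uniform Taylor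
    bound applies, with [K] bounding [|v| + |F|]; for larger [v] every term vanishes, even after the
    velocity has moved by at most [B]. *)
Lemma sm_transport_taylor : exists2 C, 0 <= C & forall phi, cutlip Rad phi ->
  forall F : R -> R, (forall x, `|F x| <= B) -> forall h, 0 <= h <= 1 -> forall x v,
  `|sm phi Rad kp et (x + h * v) (v + h * F x) - sm phi Rad kp et x v -
    h * (v * sm phi Rad dkp et x v + F x * sm phi Rad kp det x v)| <= C * h ^+ 2.
Proof.
have [C C0 hC] := sm_uniform_taylor.
have rs : forall w, d <= `|w| -> et w = 0 by exact: mol_supp mol.
have rs' : forall w, d < `|w| -> det w = 0.
  move=> w hw; have e0 : \near w, et w = 0.
    have hd : 0 < `|w| - d by rewrite subr_gt0.
    apply/nbhs_ballP; exists (`|w| - d) => // u /=; rewrite /ball/= => hu; apply: rs.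
    have : `|w| <= `|w - u| + `|u| by rewrite -{1}(subrK u w) ler_normD.
    lra.
  have h1 := near_eq_is_derive e0 (mol_etD mol w).
  have h2 : is_derive w (1 : R) (fun=> 0 : R) 0 by exact: is_derive_cst.
  by rewrite -(@derive_val _ _ _ _ _ _ _ h1) (@derive_val _ _ _ _ _ _ _ h2).
pose K := Rad + d + B + B.
exists (C * K ^+ 2); first by rewrite mulr_ge0// sqr_ge0.
move=> phi hphi F hF h /andP[h0 h1] x v.
have [hv|hv] := leP `|v| (Rad + d + B).
  have := hC phi hphi x v (h * v) (h * F x).
  rewrite (_ : _ * (h * v) + _ * (h * F x) = h * (v * sm phi Rad dkp et x v + F x * sm phi Rad kp det x v)); last by ring.
  move=> /le_trans; apply; rewrite -mulrA ler_wpM2l// -exprMn lerXn2r ?nnegrE ?addr_ge0//.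
    by rewrite mulr_ge0// /K !addr_ge0// ltW.
  by rewrite !normrM (ger0_norm h0) -mulrDr mulrC ler_wpM2r// /K lerD.
have sup r w : bsmooth r -> (forall w, d < `|w| -> r w = 0) -> `|Rad| + d < `|w| ->
    forall q y, bmeas q -> sm phi Rad q r y w = 0.
  move=> br hr hw q y bq; apply: sm_abs => //; first exact: bsmooth_bmeas.
  move=> u uR; apply: hr.
  have : `|w| <= `|w - u| + `|u| by rewrite -{1}(subrK u w) ler_normD.
  have := ler_norm Rad; lra.
have R1 : `|Rad| + d < `|v| by rewrite ger0_norm//; move: hv B0; lra.
have R2 : `|Rad| + d < `|v + h * F x|.
  have : `|v| <= `|v + h * F x| + `|h * F x| by rewrite -{1}(addrK (h * F x) v) ler_normB.
  have : `|h * F x| <= B by rewrite normrM (ger0_norm h0) -[B]mul1r ler_pM.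
  rewrite (ger0_norm Rad0); move: hv; lra.
have es w : d < `|w| -> et w = 0 by move/ltW; exact: rs.
have bk' := bsmooth_bmeas bkp; have bdk' := bsmooth_bmeas bdk.
rewrite !(sup et)// (sup det)// !mulr0 !addr0 mulr0 !subr0 normr0.
exact: mulr_ge0 (mulr_ge0 C0 (sqr_ge0 _)) (sqr_ge0 _).
Qed.

Lemma drift_lipschitz (F : R -> R) (l h : R) : 0 <= h -> 0 <= l ->
  (forall x y, `|F x - F y| <= l * `|x - y|) -> forall z w,
  euclidean_dist (z.1 + h * z.2, z.2 + h * F z.1) (w.1 + h * w.2, w.2 + h * F w.1) <=
  (1 + h * (1 + l)) * euclidean_dist z w.
Proof.
move=> h0 l0 lF z w.
have D0 := euclidean_dist_ge0 z w.
apply: (@euclidean_dist_le _ _ _ (`|z.1 - w.1| + h * `|z.2 - w.2|)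
  (`|z.2 - w.2| + h * (l * `|z.1 - w.1|))).
- by rewrite mulr_ge0// addr_ge0// mulr_ge0// addr_ge0.
- rewrite /= opprD addrACA (le_trans (ler_normD _ _))// lerD2l.
  by rewrite -mulrBr normrM ger0_norm.
- rewrite /= opprD addrACA (le_trans (ler_normD _ _))// lerD2l.
  by rewrite -mulrBr normrM ger0_norm// ler_wpM2l.
rewrite exprMn /euclidean_dist sqr_sqrtr; last by rewrite addr_ge0// sqr_ge0.
rewrite -(real_normK (num_real (z.1 - w.1))) -(real_normK (num_real (z.2 - w.2))).
move: (normr_ge0 (z.1 - w.1)) (normr_ge0 (z.2 - w.2)).
move: `|z.1 - w.1| `|z.2 - w.2| => p q p0 q0; rewrite -subr_ge0.
(* The gap is a combination of squares with nonnegative coefficients. *)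
have -> : (1 + h * (1 + l)) ^+ 2 * (p ^+ 2 + q ^+ 2) -
    ((p + h * q) ^+ 2 + (q + h * (l * p)) ^+ 2) =
    h * (1 + l) * ((p - q) ^+ 2 + (p ^+ 2 + q ^+ 2)) +
    h ^+ 2 * ((1 + 2 * l) * p ^+ 2 + (2 * l + l ^+ 2) * q ^+ 2) by ring.
have l2 := sqr_ge0 l; have p2 := sqr_ge0 p; have q2 := sqr_ge0 q; have h2 := sqr_ge0 h.
apply: addr_ge0; apply: mulr_ge0 => //.
- by apply: mulr_ge0 => //; exact: addr_ge0.
- by apply: addr_ge0; [exact: sqr_ge0|exact: addr_ge0].
- apply: addr_ge0; apply: mulr_ge0 => //; first by lra.
  by apply: addr_ge0 => //; lra.
Qed.

(** Shifting by [(y, w)] before or after the drift gives points that differ by [h * w] in [x] and by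
    [h * (F x - F (y + x))] in [v]. The error is proportional to [h], hence remains small once the
    steps are summed. The division restores the Lipschitz constant one. *)
Lemma sm_commutator phi (Rho l : R) (F : R -> R) h x v :
  0 <= h -> Rho + h * B <= Rad -> cutlip Rho phi ->
  (forall x, `|F x| <= B) -> periodic F 1 -> 0 <= l ->
  (forall x y, `|F x - F y| <= l * `|x - y|) ->
  cutlip (Rho + h * B) (fun z => (1 + h * (1 + l))^-1 * phi (z.1 + h * z.2, z.2 + h * F z.1)) /\
  `|sm phi Rad kp et (x + h * v) (v + h * F x) -
    (1 + h * (1 + l)) * sm (fun z => (1 + h * (1 + l))^-1 *
       phi (z.1 + h * z.2, z.2 + h * F z.1)) Rad kp et x v| <= h * (d + l * kmoment kp).
Proof.
move=> h0 hRho hphi hF pF l0 lF.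
have [[pp hp] sp] := hphi.
set c := 1 + h * (1 + l).
have c1 : 1 <= c by rewrite lerDl mulr_ge0// addr_ge0.
have c0 : 0 < c by apply: lt_le_trans c1.
pose S (z : R * R) := (z.1 + h * z.2, z.2 + h * F z.1).
have SL := drift_lipschitz h0 l0 lF : forall z w, euclidean_dist (S z) (S w) <= c * euclidean_dist z w.
have pphi : forall w, periodic (fun x => phi (S (x, w))) 1.
  move=> w y; rewrite /S/= pF addrAC; exact: pp.
have sphi z : Rho + h * B <= `|z.2| -> phi (S z) = 0.
  move=> hz; apply: sp; rewrite /S/=.
  have : `|z.2| <= `|z.2 + h * F z.1| + `|h * F z.1|.
    by rewrite -{1}(addrK (h * F z.1) z.2) ler_normB.
  have : `|h * F z.1| <= h * B by rewrite normrM (ger0_norm h0) ler_wpM2l.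
  lra.
have hpsi : cutlip (Rho + h * B) (fun z => c^-1 * phi (S z)).
  split; last by move=> z hz; rewrite sphi// mulr0.
  split=> [w y|z w]; first by rewrite pphi.
  rewrite -mulrBr normrM ger0_norm ?invr_ge0 ?(ltW c0)// mul1r ler_pdivrMl//.
  by rewrite (le_trans (hp _ _))// mul1r.
split=> //.
have bpsi := cutlip_bmeas Rad0 (cutlipW hRho hpsi).
have bS : bmeas (fun z => phi (S z)).
  have := bmeasZ c bpsi; congr bmeas; apply/funext => z.
  by rewrite mulrA divff ?gt_eqF// mul1r.
rewrite -sm_scale//; [|exact: bsmooth_bmeas..].
have -> : (fun z => c * (c^-1 * phi (z.1 + h * z.2, z.2 + h * F z.1))) = (fun z => phi (S z)).
  by apply/funext => z; rewrite mulrA divff ?gt_eqF// mul1r.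
rewrite mulrDr mulrA; apply: sm_compare.
- by apply: cutlip_admissible; apply: cutlipW hphi; apply: le_trans hRho; rewrite lerDl mulr_ge0.
- by split=> // z /ltW hz; apply: sphi; exact: le_trans hz.
move=> y w hy hw; rewrite (le_trans (hp _ _))// mul1r (le_trans (euclidean_dist_le_sum _ _))//=.
rewrite lerD//.
  rewrite (_ : _ - _ = - (h * w)); last by ring.
  by rewrite normrN normrM (ger0_norm h0) ler_wpM2l.
rewrite (_ : _ - _ = h * (F x - F (y + x))); last by ring.
rewrite normrM (ger0_norm h0) -mulrA ler_wpM2l//.
have -> : F (y + x) = F (torus_repr y + x).
  rewrite [RHS](periodic_repr (f := fun y => F (y + x)))// => u.
  by rewrite addrAC pF.
by rewrite (le_trans (lF _ _))// distrC addrK.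
Qed.

End mollified_test.

(** * Increments along Vlasov curves and differences of integrals *)

Section vlasov_curve.
Context {R : realType}.
Local Notation leb := (@lebesgue_measure R).
Local Notation prob := (probability (R * R)%type R).

Record vlasov_curve (T B : R) (f : R -> prob) (E : R -> R -> R) : Prop := VlasovCurve {
  vc_P1 : forall t, 0 <= t <= T -> in_P1 (f t);
  vc_cont : w1_unif_cont T f;
  vc_mE : forall t, 0 <= t <= T -> measurable_fun setT (E t);
  vc_EB : forall t x, 0 <= t <= T -> `|E t x| <= B;
  vc_mG : forall g, plipb g -> measurable_fun `[0, T] (fun t => \int[f t]_z (E t z.1 * g z));
  vc_vlasov : vlasov T f E }.

Lemma vlasov_increment T B f E (kp dkp et det : R -> R) (d Rad : R) phi a b :
  vlasov_curve T B f E -> mollifier kp dkp et det d -> bmeas phi ->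
  0 < a -> a < b -> b < T ->
  moment f phi Rad kp et b - moment f phi Rad kp et a =
  \int[leb]_(t in `]a, b]) flux f E phi Rad kp et dkp det t.
Proof.
move=> V mol bphi a0 ab bT.
have T0 : 0 < T by apply: lt_trans bT; exact: lt_trans ab.
have [bk bd] := (mol_kp mol, mol_dkp mol); have [be bde] := (mol_et mol, mol_det mol).
have [hk he] := (mol_kpD mol, mol_etD mol).
have [pk pf] := (mol_per mol, vc_P1 V).
have [M1 M10 h1] := moment_bounded f Rad bphi bk be pk.
have [M2 M20 h2] := flux_bounded f T0 (vc_mE V) (vc_EB V) Rad bphi bk be bd bde hk pk (mol_supp mol).
have m1 := moment_measurable pf (vc_cont V) Rad bphi bk be pk.
have m2 := flux_measurable pf (vc_cont V) (vc_mE V) (vc_EB V) (vc_mG V) Rad bphi bk be bd bde hk pk (mol_supp mol).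
have [L L0 hL] := moment_lipschitz pf Rad bphi bk be pk.
apply: (@weak_increment _ T (M1 + M2)) => //.
- by move=> t ht; rewrite (le_trans (h1 _))// lerDl.
- by move=> t ht; rewrite (le_trans (h2 _ ht))// lerDr.
- move=> c /andP[c0 cT] e e0; have L1 : 0 < L + 1 by rewrite ltr_wpDl.
  have [del del0 hdel] := vc_cont V (divr_gt0 e0 L1); exists del => // t ht tc.
  have hc : 0 <= c <= T by rewrite !ltW.
  rewrite (le_trans (hL t c ht hc))// (@le_trans _ _ ((L + 1) * w1 (f t) (f c)))//.
    by rewrite ler_wpM2r ?lerDl// w1_ge0//; exact: pf.
  by rewrite mulrC -ler_pdivlMr//; exact: hdel.
move=> p dp a' b' bp bdp hp a'0 b'T hs.
exact: (vlasov_product (vc_mE V) (vc_EB V) (vc_vlasov V) Rad bphi bk be bd bde hk he pk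
  (mol_supp mol) bp bdp hp a'0 b'T hs).
Qed.

Definition dif (mu nu : prob) (g : R * R -> R) := \int[mu]_z g z - \int[nu]_z g z.

Let bint (mu : prob) g : bmeas g -> mu.-integrable setT (EFin \o g).
Proof. by move=> bg; exact: (bmeas_integrable measurableT (prob_lty _)). Qed.

Lemma difD mu nu f g : bmeas f -> bmeas g ->
  dif mu nu (fun z => f z + g z) = dif mu nu f + dif mu nu g.
Proof.
move=> bf bg; rewrite /dif (RintegralD measurableT (bint mu bf) (bint mu bg)).
by rewrite (RintegralD measurableT (bint nu bf) (bint nu bg)) opprD addrACA.
Qed.

Lemma difZ mu nu (c : R) f : bmeas f -> dif mu nu (fun z => c * f z) = c * dif mu nu f.
Proof.
move=> bf; rewrite /dif (RintegralZl c measurableT (bint mu bf)).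
by rewrite (RintegralZl c measurableT (bint nu bf)) mulrBr.
Qed.

Lemma dif_close mu nu f g (e : R) : bmeas f -> bmeas g ->
  (forall z, `|f z - g z| <= e) -> dif mu nu f <= dif mu nu g + 2 * e.
Proof.
move=> bf bg h.
have b : bmeas (fun z => f z - g z) := bmeasB bf bg.
have -> : f = (fun z => g z + (f z - g z)) by apply/funext => z; rewrite addrC subrK.
rewrite difD// lerD2l /dif.
have [mb _] := b.
have := prob_norm_le mu mb h; have := prob_norm_le nu mb h.
rewrite !ler_norml => /andP[h1 h2] /andP[h3 h4]; lra.
Qed.

Lemma dif_plip mu nu mu' nu' g (L : R) : 0 <= L -> plip L g ->
  in_P1 mu -> in_P1 nu -> in_P1 mu' -> in_P1 nu' ->
  `|dif mu nu g - dif mu' nu' g| <= L * (w1 mu mu' + w1 nu nu').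
Proof.
move=> L0 hg p1 p2 p3 p4.
have := w1_norm L0 p1 p3 hg; have := w1_norm L0 p2 p4 hg; rewrite /dif => h2 h1.
rewrite (_ : _ - _ = (\int[mu]_z g z - \int[mu']_z g z) - (\int[nu]_z g z - \int[nu']_z g z)); last by ring.
by rewrite (le_trans (ler_normB _ _))// mulrDr lerD.
Qed.

End vlasov_curve.

(** * Truncation *)

Section truncation.
Context {R : realType}.
Local Notation leb := (@lebesgue_measure R).
Local Notation prob := (probability (R * R)%type R).
Implicit Types (phi : R * R -> R).

Definition cap (K a : R) : R := Num.max (- K) (Num.min K a).

Lemma cap_lipschitz (K K' a a' D : R) : 0 <= K -> 0 <= K' ->
  `|K - K'| <= D -> `|a - a'| <= D -> `|cap K a - cap K' a'| <= D.
Proof.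
move=> K0 K'0; rewrite !ler_norml => /andP[h1 h2] /andP[h3 h4].
rewrite /cap !maxEle !minEle.
do 4 case: ifPn; rewrite -?ltNge => *; apply/andP; split; lra.
Qed.

Lemma cap_norm (K a : R) : 0 <= K -> `|cap K a| <= `|a|.
Proof.
move=> K0; rewrite ler_norml; have := ler_norm a; have := ler_norm (- a); rewrite normrN.
have := normr_ge0 a; rewrite /cap !maxEle !minEle.
do 2 case: ifPn; rewrite -?ltNge => *; apply/andP; split; lra.
Qed.

Lemma cap_id (K a : R) : `|a| <= K -> cap K a = a.
Proof.
by rewrite ler_norml => /andP[h1 h2]; rewrite /cap (min_idPr h2) (max_idPr h1).
Qed.

(** Capping at the height [m - |v|], itself 1-Lipschitz, keeps the Lipschitz constant one, which
    multiplication by a cut-off need not do. Subtracting [phi (0, 0)] does not change differences of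
    integrals in the limit. *)
Definition truncate phi (m : nat) (z : R * R) : R :=
  cap (Num.max 0 (m%:R - `|z.2|)) (phi z - phi (0, 0)).

Let pos0 (x : R) : 0 <= Num.max 0 x. Proof. by rewrite le_max lexx. Qed.

Lemma truncate_cutlip phi m : plip 1 phi -> cutlip m%:R (truncate phi m).
Proof.
move=> [pp hp]; split; last first.
  move=> z hz; rewrite /truncate (_ : Num.max 0 _ = 0); last first.
    by apply/max_idPl; rewrite subr_le0.
  rewrite /cap oppr0; case: (leP 0 (phi z - phi (0, 0))) => h.
    by rewrite ?(min_idPl h) maxxx.
  exact/max_idPl/ltW.
split=> [v x /=|z w]; first by rewrite /truncate /= (pp v x).
rewrite mul1r; apply: cap_lipschitz => //; last first.
  by rewrite opprB addrA subrK -[leRHS]mul1r; exact: hp.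
apply: le_trans (euclidean_dist_ge2 z w).
apply: le_trans (ler_dist_dist _ _).
rewrite ler_norml; have := ler_norm (`|z.2| - `|w.2|); have := ler_norm (`|w.2| - `|z.2|).
rewrite (distrC `|w.2|); have := normr_ge0 (`|z.2| - `|w.2|).
by rewrite !maxEle; do 2 case: ifPn; rewrite -?ltNge => *; apply/andP; split; lra.
Qed.

Lemma truncate_cvg (mu : prob) phi : in_P1 mu -> plip 1 phi ->
  \int[mu]_z truncate phi m z @[m --> \oo] --> \int[mu]_z phi z - phi (0, 0).
Proof.
move=> Pmu hphi; have mphi := plip_measurable ler01 hphi.
have iphi := plip_integrable ler01 Pmu hphi.
have ic : mu.-integrable setT (EFin \o (fun=> phi (0, 0))).
  apply: (@growth_integrable _ _ _ `|phi (0, 0)| 0) => // z.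
  by rewrite mul0r addr0.
have -> : \int[mu]_z phi z - phi (0, 0) = \int[mu]_z (phi z - phi (0, 0)).
  by rewrite (RintegralB measurableT iphi ic) prob_cst.
have ib := integrable_sub measurableT iphi ic.
have mt m : measurable_fun setT (truncate phi m).
  by have [h _] := truncate_cutlip m hphi; exact: plip_measurable h.
have [] := @dominated_convergence _ _ _ mu _ measurableT
  (fun n => EFin \o truncate phi n) (EFin \o (fun z => phi z - phi (0, 0)))
  (fun z => `|phi z - phi (0, 0)|%:E).
- by move=> n; exact/measurable_EFinP.
- by apply/measurable_EFinP; apply: measurable_funB.
- apply: aeW => z _; apply: cvg_EFin; [exact: nearW|].
  apply: cvg_near_cst; near=> m.
  apply: cap_id; rewrite le_max; apply/orP; right.
  rewrite lerBrDr; near: m; exact: nbhs_infty_ger.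
- exact: (integrable_norm ib).
- by apply: aeW => z n _ /=; rewrite lee_fin cap_norm.
move=> fi _ h; apply: (@fine_cvg _ _ _ _ (fun n => \int[mu]_z (truncate phi n z)%:E)%E).
by rewrite fineK//; exact: integrable_fin_num.
Unshelve. all: by end_near. Qed.

Lemma mollifier_exists (e : R) : 0 < e -> exists kp dkp et det : R -> R,
  mollifier kp dkp et det e /\ kmoment kp <= e.
Proof.
move=> e0; have [et [bet eet et0 set_ iet]] := bump_mollifier e0.
have := @kap_moment R => /cvgrPdist_le /(_ e e0) [n _ /(_ n (leqnn n))].
rewrite sub0r normrN => hn.
have [dkp [hk bdk]] := bsmooth_derive (kap_bsmooth (R := R) n).
have [det [he bde]] := bsmooth_derive bet.
exists (kap n), dkp, et, det; split.
  split=> //; [exact: kap_bsmooth|exact: kap_periodic|exact: kap_even|exact: kap_ge0|exact: kap_integral].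
apply: le_trans hn; rewrite /kmoment ger0_norm; last first.
  by apply: Rintegral_ge0 => x _; rewrite mulr_ge0// kap_ge0.
rewrite le_eqVlt; apply/orP; left; apply/eqP; apply: eq_Rintegral => x.
by rewrite inE /torus/= in_itv/= => hx; rewrite tdist_torus.
Qed.

Lemma continuous_le_at0 (G : R -> R) (x : R) : {for 0, continuous G} ->
  (forall e, 0 < e -> x <= G e) -> x <= G 0.
Proof.
move=> cG h; have : G n.+1%:R^-1 @[n --> \oo] --> G 0.
  by apply: continuous_cvg => //; exact: cvg_harmonic.
by move=> /cvgr_to_ge; apply; apply: nearW => n; exact: h.
Qed.

Lemma partition_ind (P : R -> Prop) (a b del : R) : 0 < del -> a < b -> P a ->
  (forall s t, a <= s -> s < t -> t <= b -> t - s < del -> P s -> P t) -> P b.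
Proof.
move=> del0 ab Pa hP; have ba : 0 < b - a by rewrite subr_gt0.
have [N _ hN] : \forall N \near \oo, N.+1%:R^-1 < del / (b - a).
  exact: near_infty_natSinv_lt (PosNum (divr_gt0 del0 ba)).
pose h := (b - a) / N.+1%:R.
have h0 : 0 < h by rewrite divr_gt0.
have hdel : h < del by rewrite /h mulrC -ltr_pdivlMr//; exact: (hN N (leqnn N)).
pose t k : R := a + k%:R * h.
have tS k : t k.+1 = t k + h by rewrite /t -natr1; ring.
have tN : t N.+1 = b by rewrite /t /h mulrC mulfVK ?pnatr_eq0// addrC subrK.
rewrite -tN; have : (N.+1 <= N.+1)%N by [].
elim: {-2}N.+1 => [|k ih] kN; first by rewrite /t mul0r addr0.
apply: (hP (t k)) => //; last exact/ih/ltnW.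
- by rewrite /t lerDl mulr_ge0// ltW.
- by rewrite tS ltrDl.
- by rewrite -tN /t lerD2l ler_pM2r// ler_nat.
- by rewrite tS addrAC subrr add0r.
Qed.

(** One step of a discrete Gronwall inequality: growth is collected in the exponent and sources in
    the second factor. *)
Lemma exp_step (k l s Y : R) : 0 <= k -> 0 <= l -> 0 <= s -> 0 <= Y ->
  (1 + l) * (expR k * Y) + s <= expR (k + l) * (Y + s).
Proof.
move=> k0 l0 s0 Y0; rewrite expRD mulrDr lerD//.
  rewrite mulrA ler_wpM2r// mulrC ler_wpM2l ?expR_ge0//.
  exact: expR_ge1Dx.
rewrite ler_peMl// -expRD; apply: le_trans (expR_ge1Dx _).
by rewrite lerDl addr_ge0.
Qed.

End truncation.

(** * One time step of the duality argument *)

(* Stated for variables because [lra] is very slow in the contexts of use. *)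
Section step_arithmetic.
Context {R : realType}.

Lemma step_arith1 x ell : x <= 1 * (1 + ell) -> 1 + x + 1 <= 3 + ell :> R.
Proof. lra. Qed.

Lemma step_arith2 (x eta : R) : 16 * x <= eta -> 4 * x <= eta / 4.
Proof. lra. Qed.

Lemma step_arith3 (sG aG ga X e h : R) : aG <= h * ga + 2 * X -> sG <= aG + h * (e / 4) ->
  4 * X <= h * (e / 4) -> sG + 2 * X <= h * (ga + e / 2).
Proof. lra. Qed.

Lemma step_arith4 (a b c t : R) : a <= t -> t <= b -> a <= c -> c <= b -> `|t - c| <= b - a.
Proof. by move=> *; rewrite ler_norml; apply/andP; split; lra. Qed.

Lemma step_arith5 (S q A1 A2 D1 D2 I1 I2 e : R) : S <= q -> A1 - A2 <= D1 - D2 + 2 * (e / 8) ->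
  D1 - D2 <= I1 - I2 + e / 2 -> A1 - (A2 - S) <= I1 - I2 + e * 3 / 4 + q.
Proof. lra. Qed.

Lemma step_arith6 (x K sig c c' y : R) : x <= K + sig * (c + c' * y) ->
  x <= K + sig * c + sig * c' * y.
Proof. lra. Qed.

Lemma step_arith7 (l l' y h m e : R) : l' * (y * h) <= l' * (m + e * h) ->
  h * (l + l' * y) <= h * (l + l' * e) + l' * m.
Proof. lra. Qed.

Lemma step_arith8 (h x l l' e m : R) : h * x <= h * (l + l' * e) + l' * m ->
  1 + h * (1 + x) <= 1 + (h * (1 + l + l' * e) + l' * m).
Proof. lra. Qed.

Lemma step_arith9 (x y e : R) : x <= y -> 16 * y <= e -> 0 < e -> 2 * x <= e / 4.
Proof. lra. Qed.

Lemma step_arith10 (m A e sig c c' h mu ua S q P Lx Px w w' : R) :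
  m <= (A + e * 3 / 4 + sig * c) * h + sig * c' * mu ->
  ua + h * A <= S + 2 * q -> S <= P + 2 * (h * w) -> P <= Px -> Px <= Lx ->
  h * w <= h * w' -> 2 * q <= h * (e / 4) ->
  ua + m <= Lx + sig * (c * h + c' * mu) + h * (e + 2 * w').
Proof. lra. Qed.

End step_arithmetic.

Section stability_step.
Context {R : realType}.
Local Notation leb := (@lebesgue_measure R).
Local Notation prob := (probability (R * R)%type R).
Variables (T B M l0 l1 c0 c1 : R) (f1 f2 : R -> prob) (E1 E2 : R -> R -> R) (r : R -> R).
Hypotheses (B0 : 0 <= B) (l00 : 0 <= l0) (l10 : 0 <= l1) (c00 : 0 <= c0) (c10 : 0 <= c1).
Hypotheses (V1 : vlasov_curve T B f1 E1) (V2 : vlasov_curve T B f2 E2).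
Hypothesis pE : forall t, 0 <= t <= T -> periodic (E1 t) 1.
Hypothesis lE : forall t, 0 <= t <= T -> forall x y,
  `|E1 t x - E1 t y| <= (l0 + l1 * r t) * `|x - y|.
Hypothesis uE : forall eta : R, 0 < eta -> exists2 del, 0 < del &
  forall s t, 0 <= s <= T -> 0 <= t <= T -> `|s - t| < del -> forall x, `|E1 s x - E1 t x| <= eta.
Hypothesis src : forall t, 0 <= t <= T ->
  \int[f2 t]_z `|E1 t z.1 - E2 t z.1| <= (c0 + c1 * r t) * w1 (f1 t) (f2 t).
Hypotheses (mr : measurable_fun `[0, T] r) (r0 : forall t, 0 <= t <= T -> 0 <= r t)
  (rM : forall t, 0 <= t <= T -> r t <= M).

Let moc (a b : R) : measurable (`]a, b]%classic : set (measurableTypeR R)).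
Proof. exact: measurable_itv. Qed.

Let sub a b : 0 <= a -> b <= T -> `]a, b]%classic `<=` (`[0, T]%classic : set R).
Proof.
by move=> a0 bT t /=; rewrite !in_itv/= => /andP[t1 t2]; apply/andP; split; lra.
Qed.

Let mres a b (g : R -> R) : 0 <= a -> b <= T -> measurable_fun `[0, T] g -> measurable_fun `]a, b] g.
Proof. by move=> a0 bT; apply: measurable_funS; [exact: measurable_itv|exact: sub]. Qed.

Let ires a b (g : R -> R) C : 0 <= a -> b <= T -> measurable_fun `[0, T] g ->
  (forall t : R, 0 <= t <= T -> `|g t| <= C) -> leb.-integrable `]a, b] (EFin \o g).
Proof.
move=> a0 bT mg hg; apply: (@bounded_integrable _ _ _ leb _ (moc a b) (itvoc_lty a b) g C).
  exact: mres.
by move=> t /(sub a0 bT); rewrite /= in_itv/=; exact: hg.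
Qed.

Lemma Rintegral_itvoc_cst (a b c : R) : a <= b -> \int[leb]_(t in `]a, b]) c = c * (b - a).
Proof.
move=> ab; rewrite Rintegral_cst; last exact: moc.
congr (_ * _); rewrite -[RHS]/(fine (b - a)%:E); congr fine.
transitivity (leb `]a, b]%classic) => //; rewrite lebesgue_measure_itv/= lte_fin.
by case: ltP => h; [rewrite EFinB|congr EFin; lra].
Qed.

Definition mass (a b : R) := \int[leb]_(t in `]a, b]) r t.

Let ir a b : 0 <= a -> b <= T -> leb.-integrable `]a, b] (EFin \o r).
Proof.
by move=> a0 bT; apply: (@ires _ _ r M) => // t ht; rewrite ger0_norm ?r0// rM.
Qed.

Lemma mass_affine a b c c' : 0 <= a -> a <= b -> b <= T ->
  \int[leb]_(t in `]a, b]) (c + c' * r t) = c * (b - a) + c' * mass a b.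
Proof.
move=> a0 ab bT; have i := ir a0 bT.
have ic : leb.-integrable `]a, b] (EFin \o (fun=> c)).
  by apply: (@ires _ _ (fun=> c) `|c|) => //; exact: measurable_cst.
rewrite (RintegralD (moc a b) ic (integrable_scale (moc a b) c' i)).
by rewrite Rintegral_itvoc_cst// (RintegralZl c' (moc a b) i).
Qed.

Lemma mass_ge0 a b : 0 <= a -> b <= T -> 0 <= mass a b.
Proof.
move=> a0 bT; apply: Rintegral_ge0 => t /(sub a0 bT); rewrite /= in_itv/=; exact: r0.
Qed.

(** The mean of the measurable function [r] need not be attained, but it cannot be exceeded by [eta]
    everywhere. Freezing the field at this [c] bounds its Lipschitz constant times the step by the
    integral of [r], up to the slack. *)
Lemma good_time a b eta : 0 <= a -> a < b -> b <= T -> 0 < eta ->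
  exists2 c, a < c <= b & r c * (b - a) <= mass a b + eta * (b - a).
Proof.
move=> a0 ab bT eta0; apply: contrapT => hn.
have ba : 0 < b - a by rewrite subr_gt0.
have h c : a < c <= b -> mass a b / (b - a) + eta <= r c.
  move=> hc; rewrite leNgt; apply/negP => hr; apply: hn; exists c => //.
  rewrite -ler_pdivlMr//; apply: ltW; move: hr; congr (_ < _).
  by rewrite mulrDl -mulrA divff ?gt_eqF// mulr1.
have : \int[leb]_(t in `]a, b]) (mass a b / (b - a) + eta) <= mass a b.
  apply: le_Rintegral; [exact: moc| |exact: ir|].
    by apply: (@ires _ _ (fun=> _) `|mass a b / (b - a) + eta|) => //; exact: measurable_cst.
  by move=> t; rewrite /= in_itv/=; exact: h.
rewrite Rintegral_itvoc_cst ?(ltW ab)// mulrDl mulrVK ?unitfE ?gt_eqF//.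
by apply/negP; rewrite -ltNge ltrDl mulr_gt0.
Qed.

Variables (kp dkp et det : R -> R) (d Rad : R).
Hypotheses (mol : mollifier kp dkp et det d) (Rad0 : 0 <= Rad).
Let u phi (z : R * R) := sm phi Rad kp et z.1 z.2.

Let bE t : 0 <= t <= T -> bmeas (fun z : R * R => E1 t z.1).
Proof.
move=> ht; split; last by exists B => z; exact: vc_EB V1 _ _ ht.
exact: (measurableT_comp (vc_mE V1 ht) measurable_fst).
Qed.

Let bE' t : 0 <= t <= T -> bmeas (fun z : R * R => E2 t z.1).
Proof.
move=> ht; split; last by exists B => z; exact: vc_EB V2 _ _ ht.
exact: (measurableT_comp (vc_mE V2 ht) measurable_fst).
Qed.

(** [X] bounds the differences at time [a] over all test functions of slightly larger support; [sig]
    bounds the distance during the step and pays for replacing [E2] by [E1]. As [del] depends on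
    [eta] and the mollifier but not on [phi], steps can be iterated. *)
Lemma mollified_step eta : 0 < eta -> exists2 del, 0 < del &
  forall a b Rho sig X phi, 0 < a -> a < b -> b < T -> b - a < del ->
  0 <= Rho -> Rho + (b - a) * B <= Rad -> cutlip Rho phi ->
  (forall s, a <= s <= b -> w1 (f1 s) (f2 s) <= sig) -> 0 <= X ->
  (forall psi, cutlip (Rho + (b - a) * B) psi -> dif (f1 a) (f2 a) (u psi) <= X) ->
  dif (f1 b) (f2 b) (u phi) <=
    (1 + ((b - a) * (1 + l0 + l1 * eta) + l1 * mass a b)) * X +
    sig * (c0 * (b - a) + c1 * mass a b) +
    (b - a) * (eta + 2 * (d + (l0 + l1 * M) * kmoment kp)).
Proof.
move=> eta0.
have [bk bd] := (mol_kp mol, mol_dkp mol); have [be bde] := (mol_et mol, mol_det mol).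
have [hk he] := (mol_kpD mol, mol_etD mol); have pk := mol_per mol.
have [C C0 hC] := sm_transport_taylor mol Rad0 B0.
(* An auxiliary step fixed before [b - a]: it makes the Taylor error small, and it determines how
   close the measures must stay. *)
pose hp := Num.min 1 (eta / (16 * C + 1)).
have C16 : 0 < 16 * C + 1 by rewrite ltr_wpDl// mulr_ge0.
have hp0 : 0 < hp by rewrite lt_min ltr01 divr_gt0.
have hp1 : hp <= 1 by rewrite ge_min lexx.
have Chp : 16 * (C * hp) <= eta.
  rewrite mulrA (@le_trans _ _ ((16 * C + 1) * hp))//; first by rewrite ler_pM2r// lerDl.
  by rewrite mulrC -ler_pdivlMr// ge_min lexx orbT.
pose ell := l0 + l1 * `|M|.
have ell0 : 0 <= ell by rewrite addr_ge0// mulr_ge0.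
(* Chosen so that two errors [om], multiplied by the Lipschitz constant [3 + ell], amount to
   [hp * (eta / 4)]. *)
pose om := eta * hp / (8 * (3 + ell)).
have ell3 : 0 < 8 * (3 + ell) by rewrite mulr_gt0// ltr_wpDr.
have om0 : 0 < om by rewrite divr_gt0// mulr_gt0.
have [e1 e10 he1] := vc_cont V1 om0.
have [e2 e20 he2] := vc_cont V2 om0.
have eta8 : 0 < eta / 8 by rewrite divr_gt0.
have [e3 e30 he3] := uE eta8.
exists (Num.min hp (Num.min e1 (Num.min e2 e3))); first by rewrite lt_min hp0 lt_min e10 lt_min e20 e30.
move=> a b Rho sig X phi a0 ab bT.
rewrite lt_min => /andP[h1]; rewrite lt_min => /andP[h2]; rewrite lt_min => /andP[h3 h4].
move=> Rho0 hRho hphi hsig X0 hX.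
set h := b - a in h1 h2 h3 h4 hRho hX *.
have h0 : 0 < h by rewrite subr_gt0.
have [c /andP[ac cb] hc] := good_time (ltW a0) ab (ltW bT) eta0.
have inT s : a <= s <= b -> 0 <= s <= T.
  by move=> /andP[as_ sb]; rewrite (le_trans (ltW a0) as_) (le_trans sb (ltW bT)).
have hcT : 0 <= c <= T by apply: inT; rewrite (ltW ac).
have haT : 0 <= a <= T by apply: inT; rewrite lexx ltW.
have hphiR : cutlip Rad phi.
  by apply: cutlipW hphi; apply: le_trans hRho; rewrite lerDl mulr_ge0// ltW.
have bphi := cutlip_bmeas Rho0 hphi.
pose lc := l0 + l1 * r c.
have lc0 : 0 <= lc by rewrite addr_ge0// mulr_ge0// r0.
have rcM : r c <= `|M| by rewrite (le_trans (rM hcT))// ler_norm.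
have lcl : lc <= ell by rewrite lerD2l ler_wpM2l.
have Q := bsmooth_bmeas bk; have S := bsmooth_bmeas be.
have pu : plip 1 (u phi) := sm_plip1 mol Rad0 hphiR.
have bu : bmeas (u phi) := plipb_bmeas (sm_plipb Rad bphi bk be pk).
pose tt := transport_term phi Rad et dkp.
pose uv (z : R * R) := sm phi Rad kp det z.1 z.2.
have btt : bmeas tt := plipb_bmeas (transport_plipb Rad bphi be bd hk pk (mol_supp mol)).
have buv : bmeas uv := plipb_bmeas (sm_plipb Rad bphi bk bde pk).
have uv1 z : `|uv z| <= 1 by exact: (sm_dv_bound mol Rad0 z.1 z.2 hphiR).
pose g s z := tt z + E1 s z.1 * uv z.
have bg s : 0 <= s <= T -> bmeas (g s).
  by move=> hs; apply: bmeasD => //; apply: bmeasM => //; exact: bE.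
pose Sh k (z : R * R) := (z.1 + k * z.2, z.2 + k * E1 c z.1).
have EB c' : 0 <= c' <= T -> forall x, `|E1 c' x| <= B by move=> hc' x; exact: vc_EB V1 _ _ hc'.
have taylor k z : 0 <= k <= 1 -> `|u phi (Sh k z) - u phi z - k * g c z| <= C * k ^+ 2.
  by move=> hk1; exact: (hC phi hphiR (E1 c) (EB c hcT) k hk1 z.1 z.2).
have pSh k : 0 <= k -> plip (1 + k * (1 + lc)) (fun z => u phi (Sh k z)).
  move=> k0; have [pp hpp] := pu; split=> [v x /=|z w].
    rewrite /Sh/= (pE hcT) -(pp _ (x + k * v)); congr u; congr pair; ring.
  rewrite (le_trans (hpp _ _))// mul1r.
  exact: (drift_lipschitz k0 lc0 (lE hcT)).
have bSh k : 0 <= k -> bmeas (fun z => u phi (Sh k z)).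
  move=> k0; split.
    apply: (@plip_measurable _ (1 + k * (1 + lc)) _ _ (pSh k k0)).
    by rewrite addr_ge0// mulr_ge0// addr_ge0.
  by have [_ [K hK]] := bu; exists K => z; exact: hK.
(* [g c] is compared at the times [s] and [a] through the difference [G] over the fixed step [hp]:
   [G] is Lipschitz with constant [3 + ell] and approximates [hp * g c] up to [C * hp ^+ 2]. *)
have frozen s : a <= s <= b ->
    dif (f1 s) (f2 s) (g c) <= dif (f1 a) (f2 a) (g c) + eta / 2.
  move=> hs; have hsT := inT s hs; have /andP[as_ sb] := hs.
  pose G z := u phi (Sh hp z) + (-1) * u phi z.
  have bG : bmeas G by apply: bmeasD; [apply: bSh; exact: ltW|exact: bmeasZ].
  have pG : plip (3 + ell) G.
    have [p1 q1] := pSh hp (ltW hp0); have [p2 q2] := pu; split=> [v x /=|z w].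
      by rewrite /G (p1 v x) (p2 v x).
    rewrite /G opprD addrACA (le_trans (ler_normD _ _))//.
    rewrite -mulrBr normrM normrN1 mul1r (le_trans (lerD (q1 z w) (q2 z w)))//.
    rewrite -mulrDl ler_wpM2r ?euclidean_dist_ge0//.
    have : hp * (1 + lc) <= 1 * (1 + ell) by apply: ler_pM => //; [exact: ltW|exact: addr_ge0|rewrite lerD2l].
    exact: step_arith1.
  have sah : `|s - a| <= h by rewrite ger0_norm ?subr_ge0// lerB.
  have wa1 : w1 (f1 s) (f1 a) <= om by apply: he1 => //; exact: le_lt_trans h2.
  have wa2 : w1 (f2 s) (f2 a) <= om by apply: he2 => //; exact: le_lt_trans h3.
  have P1 := vc_P1 V1; have P2 := vc_P1 V2.
  have ell30 : 0 <= 3 + ell by rewrite addr_ge0.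
  have := dif_plip ell30 pG (P1 s hsT) (P2 s hsT) (P1 a haT) (P2 a haT).
  rewrite ler_norml => /andP[_ dG].
  have {}dG : dif (f1 s) (f2 s) G <= dif (f1 a) (f2 a) G + (3 + ell) * (om + om).
    rewrite -lerBlDl (le_trans dG)// ler_wpM2l// lerD//.
  have bhg : bmeas (fun z => hp * g c z) by apply: bmeasZ; exact: bg.
  have hpI : 0 <= hp <= 1 by rewrite ltW.
  have t1 z : `|hp * g c z - G z| <= C * hp ^+ 2.
    by have := taylor hp z hpI; rewrite distrC /G mulN1r.
  have t2 z : `|G z - hp * g c z| <= C * hp ^+ 2 by rewrite distrC.
  have d1 := dif_close (f1 s) (f2 s) bhg bG t1.
  have d2 := dif_close (f1 a) (f2 a) bG bhg t2.
  rewrite (difZ _ _ _ (bg c hcT)) in d1; rewrite (difZ _ _ _ (bg c hcT)) in d2.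
  rewrite -(ler_pM2l hp0); apply: (le_trans d1).
  have oE : (3 + ell) * (om + om) = hp * (eta / 4).
    by rewrite /om; field; rewrite gt_eqF// ltr_wpDr.
  have : 4 * (C * hp ^+ 2) <= hp * (eta / 4).
    rewrite (_ : 4 * _ = hp * (4 * (C * hp))); last by ring.
    by rewrite ler_pM2l//; exact: step_arith2.
  by rewrite oE in dG; move: d2 dG; exact: step_arith3.
(* The flux of [f2] is rewritten with [E1], at the cost [src], since the [v]-derivative of the
   mollification is at most one; then the time is frozen in the field and in the measures. *)
have fluxdiff : forall tau, a <= tau <= b ->
    flux f1 E1 phi Rad kp et dkp det tau - flux f2 E2 phi Rad kp et dkp det tau <=
    (dif (f1 a) (f2 a) (g c) + eta * 3 / 4) + sig * (c0 + c1 * r tau).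
  move=> tau hs; have hsT := inT tau hs; have /andP[as_ sb] := hs.
  have bD : bmeas (fun z => (E1 tau z.1 - E2 tau z.1) * uv z).
    by apply: bmeasM => //; apply: bmeasB; [exact: bE|exact: bE'].
  have -> : flux f2 E2 phi Rad kp et dkp det tau =
      \int[f2 tau]_z g tau z - \int[f2 tau]_z ((E1 tau z.1 - E2 tau z.1) * uv z).
    have i1 := bmeas_integrable measurableT (prob_lty (f2 tau)) (bg tau hsT).
    have i2 := bmeas_integrable measurableT (prob_lty (f2 tau)) bD.
    rewrite -(RintegralB measurableT i1 i2); apply: eq_Rintegral => z _.
    by rewrite /g /tt /uv; ring.
  have s1 : \int[f2 tau]_z ((E1 tau z.1 - E2 tau z.1) * uv z) <= sig * (c0 + c1 * r tau).
    have bE12 : bmeas (fun z : R * R => E1 tau z.1 - E2 tau z.1) by apply: bmeasB; [exact: bE|exact: bE'].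
    have i1 := bmeas_integrable measurableT (prob_lty (f2 tau)) bE12.
    have i2 := bmeas_integrable measurableT (prob_lty (f2 tau)) bD.
    suff : `|\int[f2 tau]_z ((E1 tau z.1 - E2 tau z.1) * uv z)| <= (c0 + c1 * r tau) * sig.
      by rewrite ler_norml mulrC => /andP[].
    rewrite (le_trans (le_normr_Rintegral measurableT i2))//.
    apply: (@le_trans _ _ (\int[f2 tau]_z `|E1 tau z.1 - E2 tau z.1|)).
      apply: le_Rintegral => //; [exact: integrable_norm|exact: integrable_norm|].
      by move=> z _; rewrite normrM ler_piMr.
    rewrite (le_trans (src hsT))// ler_wpM2l ?hsig//.
    by rewrite addr_ge0// mulr_ge0// r0.
  have s2 : dif (f1 tau) (f2 tau) (g tau) <= dif (f1 tau) (f2 tau) (g c) + 2 * (eta / 8).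
    apply: dif_close; [exact: bg|exact: bg|] => z.
    rewrite /g opprD addrACA subrr add0r -mulrBl normrM -[eta / 8]mulr1 ler_pM//.
    by apply: he3 => //; exact: (le_lt_trans (step_arith4 as_ sb (ltW ac) cb) h4).
  have := frozen tau hs; rewrite /dif in s2 *; 
  rewrite (_ : flux f1 E1 phi Rad kp et dkp det tau = \int[f1 tau]_z g tau z)//.
  move: s1 s2; exact: step_arith5.
have inc1 := vlasov_increment Rad V1 mol bphi a0 ab bT.
have inc2 := vlasov_increment Rad V2 mol bphi a0 ab bT.
have T0 : 0 < T by apply: lt_trans bT; exact: lt_trans ab.
have flm f E (V : vlasov_curve T B f E) : exists2 K, forall t, 0 <= t <= T ->
    `|flux f E phi Rad kp et dkp det t| <= K & measurable_fun `[0, T] (flux f E phi Rad kp et dkp det).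
  have [K _ hK] := flux_bounded f T0 (vc_mE V) (vc_EB V) Rad bphi bk be bd bde hk pk (mol_supp mol).
  exists K => //.
  exact: (flux_measurable (vc_P1 V) (vc_cont V) (vc_mE V) (vc_EB V) (vc_mG V) Rad bphi bk be bd bde hk pk (mol_supp mol)).
have [K1 hK1 mK1] := flm _ _ V1; have [K2 hK2 mK2] := flm _ _ V2.
have i1 := ires (ltW a0) (ltW bT) mK1 hK1.
have i2 := ires (ltW a0) (ltW bT) mK2 hK2.
pose K0 := dif (f1 a) (f2 a) (g c) + eta * 3 / 4.
have intle : \int[leb]_(t in `]a, b]) (flux f1 E1 phi Rad kp et dkp det t - flux f2 E2 phi Rad kp et dkp det t) <=
    (K0 + sig * c0) * h + (sig * c1) * mass a b.
  rewrite -(mass_affine _ _ (ltW a0) (ltW ab) (ltW bT)).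
  have ic : leb.-integrable `]a, b] (EFin \o (fun=> K0 + sig * c0)).
    by apply: (@ires _ _ (fun=> _) `|K0 + sig * c0|) => //; exact: ltW.
  have ir' := integrable_scale (moc a b) (sig * c1) (ir (ltW a0) (ltW bT)).
  apply: (le_Rintegral (moc a b) (integrable_sub (moc a b) i1 i2) (integrable_add (moc a b) ic ir')).
  move=> t; rewrite /= in_itv/= => /andP[t1 t2].
  have := @fluxdiff t; rewrite t2 (ltW t1) => /(_ isT); rewrite -/K0; exact: step_arith6.
rewrite (RintegralB (moc a b) i1 i2) -inc1 -inc2 in intle.
have hI : 0 <= h <= 1 by rewrite (ltW h0) (le_trans (ltW h1)).
have bhg : bmeas (fun z => h * g c z) by apply: bmeasZ; exact: bg.
(* The expansion is now used backwards: [u + h * g c] is the transported function up to second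
   order. *)
have d1 : dif (f1 a) (f2 a) (fun z => u phi z + h * g c z) <=
    dif (f1 a) (f2 a) (fun z => u phi (Sh h z)) + 2 * (C * h ^+ 2).
  apply: dif_close; [exact: bmeasD|by apply: bSh; exact: ltW|] => z.
  by rewrite distrC opprD addrA; exact: taylor.
rewrite difD// (difZ _ _ _ (bg c hcT)) in d1.
pose psi (z : R * R) := (1 + h * (1 + lc))^-1 * phi (Sh h z).
have comm x v := sm_commutator mol Rad0 B0 x v (ltW h0) hRho hphi (EB c hcT) (pE hcT) lc0 (lE hcT).
have [hpsi _] := comm 0 0.
have hpsi' : cutlip Rad psi := cutlipW hRho hpsi.
have bpsi := cutlip_bmeas Rad0 hpsi'.
have bupsi : bmeas (u psi) := plipb_bmeas (sm_plipb Rad bpsi bk be pk).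
have d2 : dif (f1 a) (f2 a) (fun z => u phi (Sh h z)) <=
    dif (f1 a) (f2 a) (fun z => (1 + h * (1 + lc)) * u psi z) + 2 * (h * (d + lc * kmoment kp)).
  apply: dif_close; [by apply: bSh; exact: ltW|exact: bmeasZ|] => z.
  by have [_] := comm z.1 z.2.
rewrite difZ// in d2.
have d3 : (1 + h * (1 + lc)) * dif (f1 a) (f2 a) (u psi) <= (1 + h * (1 + lc)) * X.
  apply: ler_wpM2l; last exact: hX.
  by apply: addr_ge0 => //; apply: mulr_ge0; [exact: ltW|exact: addr_ge0].
have km := kmoment_ge0 (mol_kp0 mol).
have d4 : lc * kmoment kp <= (l0 + l1 * M) * kmoment kp.
  by rewrite ler_wpM2r// lerD2l ler_wpM2l// rM.
(* The choice of [c] replaces the density at one time by its integral over the step. *)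
have d5 : h * lc <= h * (l0 + l1 * eta) + l1 * mass a b.
  by have := ler_wpM2l l10 hc; rewrite -/h /lc; exact: step_arith7.
have d6 : (1 + h * (1 + lc)) * X <= (1 + (h * (1 + l0 + l1 * eta) + l1 * mass a b)) * X.
  by rewrite ler_wpM2r//; exact: step_arith8 d5.
have d7 : h * (d + lc * kmoment kp) <= h * (d + (l0 + l1 * M) * kmoment kp).
  by rewrite ler_wpM2l ?(ltW h0)// lerD2l.
have d8 : 2 * (C * h ^+ 2) <= h * (eta / 4).
  have : C * h <= C * hp by rewrite ler_wpM2l// ltW.
  rewrite (_ : 2 * _ = h * (2 * (C * h))); last by ring.
  by move=> hC2; rewrite ler_wpM2l ?(ltW h0)//; exact: step_arith9 hC2 Chp eta0.
have e0 : dif (f1 b) (f2 b) (u phi) = dif (f1 a) (f2 a) (u phi) +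
   (moment f1 phi Rad kp et b - moment f1 phi Rad kp et a -
    (moment f2 phi Rad kp et b - moment f2 phi Rad kp et a)).
  by rewrite /dif /moment -/(u phi); ring.
rewrite e0; exact: step_arith10 intle d1 d2 d3 d6 d7 d8.
Qed.

Lemma mass_add a b c : 0 <= a -> a <= b -> b <= c -> c <= T ->
  mass a c = mass a b + mass b c.
Proof.
move=> a0 ab bc cT; have i := ir a0 cT.
have e : `]a, c]%classic = `]a, b]%classic `|` `]b, c]%classic :> set R.
  apply/seteqP; split=> t /=; rewrite !in_itv/=.
    move=> /andP[h1 h2]; have [h|h] := leP t b; [left|right]; apply/andP; split; lra.
  by case=> /andP[h1 h2]; apply/andP; split; lra.
rewrite /mass e; apply: Rintegral_setU; [exact: moc|exact: moc|by rewrite -e|].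
apply/disj_setPS => t /=; rewrite !in_itv/= => -[/andP[_ h1] /andP[h2 _]].
by move: (lt_le_trans h2 h1); rewrite ltxx.
Qed.

Lemma mollified_iterate eta a b Rho sig phi : 0 < eta -> 0 < a -> a < b -> b < T ->
  0 <= Rho -> Rho + (b - a) * B <= Rad -> cutlip Rho phi ->
  (forall s, a <= s <= b -> w1 (f1 s) (f2 s) <= sig) ->
  dif (f1 b) (f2 b) (u phi) <= expR ((b - a) * (1 + l0 + l1 * eta) + l1 * mass a b) *
    (w1 (f1 a) (f2 a) + sig * (c0 * (b - a) + c1 * mass a b) +
     (b - a) * (eta + 2 * (d + (l0 + l1 * M) * kmoment kp))).
Proof.
move=> eta0 a0 ab bT Rho0 hRho hphi hsig.
have [del del0 hstep] := mollified_step eta0.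
have haT : 0 <= a <= T by rewrite (ltW a0) ltW// (lt_trans ab).
have ba : 0 < b - a by rewrite subr_gt0.
have w0 : 0 <= w1 (f1 a) (f2 a) by apply: w1_ge0; [exact: vc_P1 V1 _ haT|exact: vc_P1 V2 _ haT].
have sig0 : 0 <= sig by apply: le_trans w0 (hsig a _); rewrite lexx ltW.
have km := kmoment_ge0 (mol_kp0 mol).
have M0 : 0 <= M by apply: le_trans (r0 haT) (rM haT).
set K := eta + _.
have K0 : 0 <= K.
  apply: addr_ge0; first exact: ltW.
  apply: mulr_ge0 => //; apply: addr_ge0; first exact: ltW (mol_d0 mol).
  by apply: mulr_ge0 => //; apply: addr_ge0 => //; exact: mulr_ge0.
pose kap t := (t - a) * (1 + l0 + l1 * eta) + l1 * mass a t.
pose Y t := w1 (f1 a) (f2 a) + sig * (c0 * (t - a) + c1 * mass a t) + (t - a) * K.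
have l0e : 0 <= 1 + l0 + l1 * eta.
  by apply: addr_ge0; [exact: addr_ge0|apply: mulr_ge0 => //; exact: ltW].
have pos x y : 0 <= x -> x <= y -> y <= T -> 0 <= (y - x) * (1 + l0 + l1 * eta) + l1 * mass x y /\
    0 <= sig * (c0 * (y - x) + c1 * mass x y) + (y - x) * K.
  move=> x0 xy yT; have m0 := mass_ge0 x0 yT; have yx : 0 <= y - x by rewrite subr_ge0.
  split; first exact: addr_ge0 (mulr_ge0 yx l0e) (mulr_ge0 l10 m0).
  apply: addr_ge0; last exact: mulr_ge0.
  by apply: mulr_ge0 => //; exact: addr_ge0 (mulr_ge0 c00 yx) (mulr_ge0 c10 m0).
(* All test functions are quantified, since each step replaces the current one by another. The
   support grows at speed [B] backwards in time, and the condition on [Rad] is the room still left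
   for it. *)
pose P t := forall Rho' psi, 0 <= Rho' -> Rho' + (t - a) * B <= Rad ->
  cutlip Rho' psi -> dif (f1 t) (f2 t) (u psi) <= expR (kap t) * Y t.
suff : P b by move=> /(_ Rho phi Rho0 hRho hphi).
apply: (partition_ind del0 ab) => [Rho' psi Rho'0 hRho' hpsi|].
  have [k0 y0] := pos a a (ltW a0) (lexx a) (ltW (lt_trans ab bT)).
  move: hRho' k0 y0; rewrite /kap /Y subrr mul0r addr0 => hRho' k0 y0.
  have hp := sm_plip1 mol Rad0 (cutlipW hRho' hpsi).
  apply: (@le_trans _ _ (w1 (f1 a) (f2 a))).
    by rewrite -[leRHS]mul1r; apply: w1_ub => //; [exact: vc_P1 V1 _ haT|exact: vc_P1 V2 _ haT].
  apply: (@le_trans _ _ (1 * (w1 (f1 a) (f2 a) + (sig * (c0 * 0 + c1 * mass a a) + 0 * K)))).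
    by rewrite mul1r lerDl.
  rewrite addrA; apply: ler_pM => //; first by rewrite -addrA addr_ge0.
  by apply: le_trans (expR_ge1Dx _); rewrite lerDl.
move=> s t as_ st tb hst ih Rho' psi Rho'0 hRho' hpsi.
have s0 : 0 < s by apply: lt_le_trans as_.
have tT : t < T := le_lt_trans tb bT.
have sT : s <= T by rewrite ltW// (lt_trans st).
have [ka1 ka2] := pos _ _ (ltW a0) as_ sT.
have [kb1 kb2] := pos _ _ (ltW s0) (ltW st) (ltW tT).
have X0 : 0 <= expR (kap s) * Y s.
  by rewrite mulr_ge0 ?expR_ge0// /Y -addrA addr_ge0.
have hR : Rho' + (t - s) * B + (s - a) * B <= Rad.
  by apply: le_trans hRho'; rewrite -addrA -mulrDl addrA subrK.
have hR1 : Rho' + (t - s) * B <= Rad.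
  by apply: le_trans hR; rewrite lerDl mulr_ge0// subr_ge0.
have hR0 : 0 <= Rho' + (t - s) * B by rewrite addr_ge0// mulr_ge0// subr_ge0 ltW.
have hsig' x : s <= x <= t -> w1 (f1 x) (f2 x) <= sig.
  by move=> /andP[h1 h2]; apply: hsig; rewrite (le_trans as_ h1) (le_trans h2 tb).
have := hstep _ _ _ _ _ _ s0 st tT hst Rho'0 hR1 hpsi hsig' X0
  (fun chi hchi => ih _ chi hR0 hR hchi).
move=> /le_trans; apply.
rewrite -addrA (le_trans (exp_step ka1 kb1 kb2 _))//; first by rewrite /Y -addrA addr_ge0.
have mE := mass_add (ltW a0) as_ (ltW st) (ltW tT).
rewrite /kap /Y mE le_eqVlt; apply/orP; left; apply/eqP.
by congr (expR _ * _); rewrite /K; ring.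
Qed.

End stability_step.

(** * Gronwall estimate *)

Section stability.
Context {R : realType}.
Local Notation leb := (@lebesgue_measure R).
Local Notation prob := (probability (R * R)%type R).
Variables (T B M l0 l1 c0 c1 : R) (f1 f2 : R -> prob) (E1 E2 : R -> R -> R) (r : R -> R).
Hypotheses (B0 : 0 <= B) (l00 : 0 <= l0) (l10 : 0 <= l1) (c00 : 0 <= c0) (c10 : 0 <= c1).
Hypotheses (V1 : vlasov_curve T B f1 E1) (V2 : vlasov_curve T B f2 E2).
Hypothesis pE : forall t, 0 <= t <= T -> periodic (E1 t) 1.
Hypothesis lE : forall t, 0 <= t <= T -> forall x y,
  `|E1 t x - E1 t y| <= (l0 + l1 * r t) * `|x - y|.
Hypothesis uE : forall eta : R, 0 < eta -> exists2 del, 0 < del &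
  forall s t, 0 <= s <= T -> 0 <= t <= T -> `|s - t| < del -> forall x, `|E1 s x - E1 t x| <= eta.
Hypothesis src : forall t, 0 <= t <= T ->
  \int[f2 t]_z `|E1 t z.1 - E2 t z.1| <= (c0 + c1 * r t) * w1 (f1 t) (f2 t).
Hypotheses (mr : measurable_fun `[0, T] r) (r0 : forall t, 0 <= t <= T -> 0 <= r t)
  (rM : forall t, 0 <= t <= T -> r t <= M).

Let D t := w1 (f1 t) (f2 t).
Let P1 := vc_P1 V1.
Let P2 := vc_P1 V2.

(** The bound of [mollified_iterate] does not involve [Rad], and sees the mollifier only through its
    width and first moment, both at most [e]: for each truncation level [e] tends to 0, and then the
    level tends to infinity. *)
Lemma w1_step a b sig : 0 < a -> a < b -> b < T ->
  (forall s, a <= s <= b -> D s <= sig) ->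
  D b <= expR ((b - a) * (1 + l0) + l1 * mass r a b) *
         (D a + sig * (c0 * (b - a) + c1 * mass r a b)).
Proof.
move=> a0 ab bT hsig.
have hbT : 0 <= b <= T by rewrite ltW ?(lt_trans a0)// ltW.
pose G e := expR ((b - a) * (1 + l0 + l1 * e) + l1 * mass r a b) *
    (D a + sig * (c0 * (b - a) + c1 * mass r a b) +
     (b - a) * (e + 2 * (e + (l0 + l1 * M) * e))) + 2 * (e + e).
have -> : expR ((b - a) * (1 + l0) + l1 * mass r a b) *
         (D a + sig * (c0 * (b - a) + c1 * mass r a b)) = G 0.
  by rewrite /G !(mulr0, addr0).
have cG : {for 0, continuous G}.
  have cid : {for (0 : R), continuous (fun e : R => e)} by exact: cvg_id.
  have cc (k : R) : {for (0 : R), continuous (fun e : R => k)} by exact: cvg_cst.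
  apply: continuousD; last by apply: continuousM => //; exact: continuousD.
  apply: continuousM.
    apply: (@continuous_comp _ _ _
      (fun e => (b - a) * (1 + l0 + l1 * e) + l1 * mass r a b) expR); last exact: continuous_expR.
    apply: continuousD => //; apply: continuousM => //; apply: continuousD => //.
    exact: continuousM.
  apply: continuousD => //; apply: continuousM => //; apply: continuousD => //.
  apply: continuousM => //; apply: continuousD => //; exact: continuousM.
apply: w1_le => [||phi hphi]; [exact: P1|exact: P2|].
have key m e : 0 < e -> dif (f1 b) (f2 b) (truncate phi m) <= G e.
  move=> e0; have [kp [dkp [et [det [mol hk]]]]] := mollifier_exists e0.
  have ba : 0 < b - a by rewrite subr_gt0.
  pose Rad := m%:R + (b - a) * B.
  have mR : m%:R <= Rad by rewrite lerDl mulr_ge0// ltW.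
  have Rad0 : 0 <= Rad by apply: le_trans mR.
  have ht := truncate_cutlip m hphi.
  have ht' := cutlipW mR ht.
  have m0 : 0 <= m%:R :> R by [].
  have it := mollified_iterate B0 l00 l10 c00 c10 V1 V2 pE lE uE src mr r0 rM mol Rad0 e0
    a0 ab bT m0 (lexx _) ht hsig.
  have bt := cutlip_bmeas m0 ht.
  have bu : bmeas (fun z => sm (truncate phi m) Rad kp et z.1 z.2).
    exact: plipb_bmeas (sm_plipb Rad bt (mol_kp mol) (mol_et mol) (mol_per mol)).
  have ha z : `|truncate phi m z - sm (truncate phi m) Rad kp et z.1 z.2| <= e + e.
    case: z => x v /=; rewrite distrC (le_trans (sm_approx mol Rad0 x v ht'))//.
    by rewrite lerD2l.
  apply: (le_trans (dif_close (f1 b) (f2 b) bt bu ha)).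
  rewrite lerD2r; apply: (le_trans it); rewrite ler_wpM2l ?expR_ge0// lerD2l.
  rewrite ler_wpM2l ?(ltW ba)// lerD2l ler_wpM2l// lerD2l ler_wpM2l//.
  have M0 : 0 <= M by apply: le_trans (r0 hbT) (rM hbT).
  by rewrite addr_ge0// mulr_ge0.
have lim : dif (f1 b) (f2 b) (truncate phi m) @[m --> \oo] --> dif (f1 b) (f2 b) phi.
  have -> : dif (f1 b) (f2 b) phi = (\int[f1 b]_z phi z - phi (0, 0)) - (\int[f2 b]_z phi z - phi (0, 0)).
    by rewrite /dif; ring.
  by apply: cvgB; apply: truncate_cvg => //; [exact: P1|exact: P2].
apply: (cvgr_to_le lim); apply: nearW => m.
by apply: continuous_le_at0 cG _ => e e0; exact: key.
Qed.

Let D_modulus eta : 0 < eta -> exists2 del, 0 < del & forall s t,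
  0 <= s <= T -> 0 <= t <= T -> `|s - t| < del -> D s <= D t + eta.
Proof.
move=> eta0; have e2 : 0 < eta / 2 by rewrite divr_gt0.
have [d1 d10 h1] := vc_cont V1 e2; have [d2 d20 h2] := vc_cont V2 e2.
exists (Num.min d1 d2); first by rewrite lt_min d10 d20.
move=> s t hs ht; rewrite lt_min => /andP[k1 k2].
have q1 := h1 s t hs ht k1.
have := h2 s t hs ht k2; rewrite (w1_sym (P2 hs) (P2 ht)) => q2.
have := w1_triangle (P1 hs) (P1 ht) (P2 hs).
have := w1_triangle (P1 ht) (P2 ht) (P2 hs).
rewrite /D; move: q1 q2; set x1 := w1 _ _; set x2 := w1 _ _; lra.
Qed.

Let D_ge0 t : 0 <= t <= T -> 0 <= D t.
Proof. by move=> ht; exact: w1_ge0 (P1 ht) (P2 ht). Qed.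

(** On steps shorter than the modulus of continuity of [D], [sig] may be taken as [D s + eta]; the
    steps are chained by the discrete Gronwall inequality, and [eta] tends to 0 at the end. *)
Lemma w1_gronwall a b : 0 < a -> a < b -> b < T ->
  D b <= expR ((b - a) * (1 + l0 + c0) + (l1 + c1) * mass r a b) * D a.
Proof.
move=> a0 ab bT.
have haT : 0 <= a <= T by rewrite (ltW a0) ltW// (lt_trans ab).
pose gam t := c0 * (t - a) + c1 * mass r a t.
pose G eta := expR ((b - a) * (1 + l0 + c0) + (l1 + c1) * mass r a b) * (D a + eta * gam b).
rewrite (_ : _ * D a = G 0); last by rewrite /G mul0r addr0.
apply: continuous_le_at0.
  have cid : {for (0 : R), continuous (fun e : R => e)} by exact: cvg_id.
  have cc (k : R) : {for (0 : R), continuous (fun e : R => k)} by exact: cvg_cst.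
  by apply: continuousM => //; apply: continuousD => //; exact: continuousM.
move=> eta eta0; have [del del0 hdel] := D_modulus eta0.
have aa : mass r a a = 0.
  by have := mass_add mr r0 rM (ltW a0) (lexx a) (lexx a) (ltW (lt_trans ab bT)); lra.
pose K t := (t - a) * (1 + l0 + c0) + (l1 + c1) * mass r a t.
pose P t := D t <= expR (K t) * (D a + eta * gam t).
apply: (@partition_ind _ P a b del) => //.
  by rewrite /P /K /gam subrr aa !(mulr0, mul0r, addr0) expR0 mul1r.
move=> s t as_ st tb hst; rewrite /P => hs.
have s0 : 0 < s by apply: lt_le_trans as_.
have tT : t < T by exact: le_lt_trans bT.
have hsT : 0 <= s <= T by rewrite ltW//= ltW// (lt_trans st).
have ms := mass_ge0 r0 (ltW s0) (ltW tT).
have ma := mass_ge0 r0 (ltW a0) (le_trans (ltW st) (ltW tT)).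
have st0 : 0 <= t - s by rewrite subr_ge0 ltW.
have sa0 : 0 <= s - a by rewrite subr_ge0.
have hsig x : s <= x <= t -> D x <= D s + eta.
  move=> /andP[sx xt]; apply: hdel => //.
    by rewrite (le_trans (ltW s0) sx) (le_trans xt (ltW tT)).
  by rewrite ger0_norm ?subr_ge0// (le_lt_trans _ hst)// lerB.
apply: (le_trans (w1_step s0 st tT hsig)).
set g := c0 * (t - s) + c1 * mass r s t.
have g0 : 0 <= g by apply: addr_ge0; exact: mulr_ge0.
have ga0 : 0 <= gam s by apply: addr_ge0; exact: mulr_ge0.
have Y0 : 0 <= D a + eta * gam s.
  by apply: addr_ge0; [exact: D_ge0|apply: mulr_ge0 => //; exact: ltW].
have K0 : 0 <= K s by apply: addr_ge0; apply: mulr_ge0 => //; rewrite ?addr_ge0.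
have eg0 : 0 <= eta * g by apply: mulr_ge0 => //; exact: ltW.
have := exp_step K0 g0 eg0 Y0.
have le1 : D s + (D s + eta) * g <= (1 + g) * (expR (K s) * (D a + eta * gam s)) + eta * g.
  rewrite (_ : D s + _ = (1 + g) * D s + eta * g); last by ring.
  by rewrite lerD2r ler_wpM2l// addr_ge0.
move=> /(le_trans le1); rewrite -(ler_pM2l (expR_gt0 ((t - s) * (1 + l0) + l1 * mass r s t))).
move=> h1; apply: (le_trans h1); rewrite {h1} mulrA -(expRD ((t - s) * (1 + l0) + l1 * mass r s t)).
have mE := mass_add mr r0 rM (ltW a0) as_ (ltW st) (ltW tT).
rewrite /K /gam mE le_eqVlt; apply/orP; left; apply/eqP.
by congr (expR _ * _); rewrite /g; ring.
Qed.

Hypothesis T0 : 0 < T.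

(** Test functions are supported in []0, T[], so the estimate is first known between interior times;
    continuity of [D] carries it to the two endpoints. *)
Lemma w1_stability t : 0 <= t <= T ->
  D t <= expR (t * (1 + l0 + c0) + (l1 + c1) * mass r 0 t) * D 0.
Proof.
have h0T : 0 <= (0 : R) <= T by rewrite lexx ltW.
have D00 := D_ge0 h0T.
have a0 : 0 <= 1 + l0 + c0 by rewrite !addr_ge0.
have b0 : 0 <= l1 + c1 by rewrite addr_ge0.
have mono s u s' : 0 <= s -> s <= s' -> s' <= u -> u <= T -> mass r s s' <= mass r 0 u.
  move=> s0 ss' s'u uT; have ms := mass_ge0 r0 (le_trans s0 ss') uT.
  have m0 := mass_ge0 r0 (lexx 0) (le_trans (le_trans ss' s'u) uT).
  have e1 := mass_add mr r0 rM (lexx 0) s0 (le_trans ss' s'u) uT.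
  have e2 := mass_add mr r0 rM s0 ss' s'u uT.
  rewrite e1 e2; lra.
have inner x : 0 < x -> x < T ->
    D x <= expR (x * (1 + l0 + c0) + (l1 + c1) * mass r 0 x) * D 0.
  move=> x0 xT; set C := expR _.
  rewrite -[D 0]addr0; apply: (@continuous_le_at0 _ (fun eta => C * (D 0 + eta))).
    have cid : {for (0 : R), continuous (fun e : R => e)} by exact: cvg_id.
    have cc (k : R) : {for (0 : R), continuous (fun e : R => k)} by exact: cvg_cst.
    by apply: continuousM => //; exact: continuousD.
  move=> eta eta0; have [del del0 hdel] := D_modulus eta0.
  pose s := Num.min (x / 2) (del / 2).
  have s0 : 0 < s by rewrite lt_min !divr_gt0.
  have sx : s < x by rewrite gt_min; apply/orP; left; lra.
  have sd : s < del by rewrite gt_min; apply/orP; right; lra.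
  have hsT : 0 <= s <= T by rewrite ltW//= ltW// (lt_trans sx).
  have Ds : D s <= D 0 + eta by apply: hdel => //; rewrite subr0 gtr0_norm.
  apply: (le_trans (w1_gronwall s0 sx xT)).
  apply: ler_pM; [exact: expR_ge0|exact: D_ge0| |exact: Ds].
  rewrite /C ler_expR lerD//.
    by rewrite ler_wpM2r// gerBl ltW.
  by rewrite ler_wpM2l//; apply: mono => //; exact: ltW.
move=> /andP[t0 tT]; have [->|tn0] := eqVneq t 0.
  rewrite -[leLHS]mul1r ler_wpM2r//; apply: le_trans (expR_ge1Dx _).
  by rewrite lerDl mul0r add0r mulr_ge0// (mass_ge0 r0)// ltW.
have {tn0} t0' : 0 < t by rewrite lt_neqAle eq_sym tn0.
have [tT'|tT'] := ltP t T; first exact: inner.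
have -> : t = T by apply/le_anti/andP.
apply/ler_addgt0Pr => eta eta0; have [del del0 hdel] := D_modulus eta0.
pose s := T - Num.min (T / 2) (del / 2).
have m0 : 0 < Num.min (T / 2) (del / 2) by rewrite lt_min !divr_gt0.
have m1 : Num.min (T / 2) (del / 2) < T by rewrite gt_min; apply/orP; left; lra.
have m2 : Num.min (T / 2) (del / 2) < del by rewrite gt_min; apply/orP; right; lra.
have sT : s < T by rewrite /s gtrBl.
have s0 : 0 < s by rewrite subr_gt0.
have hsT : 0 <= s <= T by rewrite !ltW.
have hTT : 0 <= T <= T by rewrite lexx ltW.
have Ts : `|T - s| < del by rewrite /s opprB addrCA subrr addr0 gtr0_norm.
apply: (le_trans (hdel T s hTT hsT Ts)); rewrite lerD2r; apply: (le_trans (inner s s0 sT)).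
rewrite ler_wpM2r// ler_expR lerD//; first by rewrite ler_wpM2r// ltW.
by rewrite ler_wpM2l// mono// ltW.
Qed.

End stability.

(** * Fields of measure solutions *)

Section measure_solutions.
Context {R : realType}.
Local Notation leb := (@lebesgue_measure R).
Local Notation prob := (probability (R * R)%type R).
Variables (T eps : R).
Hypothesis eps0 : 0 < eps.

Definition solution_field (f : R -> prob) (U : R -> R -> R) (t x : R) : R :=
  Ebar eps (xmarginal (f t)) x - derive1 (U t) x.

Let y := (eps ^+ 2)^-1.
Let y0 : 0 <= y. Proof. by rewrite invr_ge0 sqr_ge0. Qed.
Let eU0 : 0 <= expU eps. Proof. exact: expR_ge0. Qed.
Let z0 : 0 <= (eps ^+ 4)^-1 * expU eps.
Proof. by rewrite mulr_ge0// invr_ge0 exprn_ge0// ltW. Qed.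

Let field_diff (k a b c d : R) : - (k * a) - c - (- (k * b) - d) = - (k * (a - b)) - (c - d).
Proof. by ring. Qed.

Section one_solution.
Variables (f : R -> prob) (U : R -> R -> R).
Hypothesis Pf : forall t, 0 <= t <= T -> in_P1 (f t).
Hypothesis hU : forall t, 0 <= t <= T -> is_Uhat eps (xmarginal (f t)) (U t).

Let E := solution_field f U.

Let EE t x : 0 <= t <= T -> E t x = - (y * conv (f t) (@W' R) x) - derive1 (U t) x.
Proof. by move=> ht; rewrite /E /solution_field EbarE//; exact: Pf. Qed.

Lemma solution_field_bound t x : 0 <= t <= T ->
  `|E t x| <= y * 2^-1 + y * expU eps.
Proof.
move=> ht; rewrite EE// (le_trans (ler_normB _ _))// lerD//.
  by rewrite normrN normrM ger0_norm// ler_wpM2l// conv_W'_bound.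
by apply: is_Uhat_derive_bound (hU ht) => //; exact: Pf.
Qed.

Lemma derive_Uhat_measurable t : 0 <= t <= T -> measurable_fun setT (derive1 (U t)).
Proof.
move=> ht; apply: continuous_measurable_fun.
exact: lipschitz_continuous (is_Uhat_derive_lipschitz (Pf ht) eps0 (hU ht)).
Qed.

Lemma solution_field_measurable t : 0 <= t <= T -> measurable_fun setT (E t).
Proof.
move=> ht; rewrite (_ : E t = fun x => - (y * conv (f t) (@W' R) x) - derive1 (U t) x); last first.
  by apply/funext => x; exact: EE.
apply: measurable_funB; last exact: derive_Uhat_measurable.
apply: measurableT_comp => //; apply: measurable_funM; first exact: measurable_cst.
exact: conv_W'_measurable.
Qed.

Lemma solution_field_periodic t : 0 <= t <= T -> periodic (E t) 1.
Proof.
move=> ht x; rewrite !EE//; have [d1 _] := is_Uhat_derive (hU ht).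
have [pU _ _ _] := hU ht.
by rewrite (conv_periodic (f t) (@W'_periodic R)) (periodic_derive d1 pU).
Qed.

Lemma solution_field_lipschitz t r : 0 <= t <= T -> dens_le (f t) r -> forall x x',
  `|E t x - E t x'| <= (y * (1 + expU eps) + y * r) * `|x - x'|.
Proof.
move=> ht hr x x'; rewrite !EE//.
have := conv_W'_lipschitz hr x x'.
have := is_Uhat_derive_lipschitz (Pf ht) eps0 (hU ht) x x'.
rewrite -/y => h1 h2.
rewrite field_diff.
rewrite (le_trans (ler_normB _ _))// normrN normrM (ger0_norm y0).
apply: (le_trans (lerD (ler_wpM2l y0 h2) h1)).
by rewrite le_eqVlt; apply/orP; left; apply/eqP; ring.
Qed.

(** [lam] is chosen first, to make [2 * (1 + M) * lam] small; then the distance between the two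
    times is made small compared with [lam]. *)
Lemma solution_field_modulus M : w1_unif_cont T f -> 0 <= M ->
  (forall t, 0 <= t <= T -> dens_le (f t) M) ->
  forall eta : R, 0 < eta -> exists2 del, 0 < del &
  forall s t, 0 <= s <= T -> 0 <= t <= T -> `|s - t| < del -> forall x, `|E s x - E t x| <= eta.
Proof.
move=> cf M0 hM eta eta0.
pose q := y * (2 * (1 + M)) + 1.
have q1 : 1 <= q by rewrite lerDr !mulr_ge0// addr_ge0.
have q0 : 0 < q by apply: lt_le_trans q1.
pose lam := Num.min 2^-1 (eta / 2 / q).
have lam0 : 0 < lam by rewrite lt_min invr_gt0 ltr0n/= !divr_gt0.
have lam2 : lam <= 2^-1 by rewrite ge_min lexx.
have qlam : q * lam <= eta / 2.
  by rewrite mulrC -ler_pdivlMr// ge_min lexx orbT.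
pose p := y / lam + (eps ^+ 4)^-1 * expU eps + 1.
have p0 : 0 < p by rewrite ltr_wpDl// addr_ge0// divr_ge0// ltW.
have [del del0 hdel] := cf _ (divr_gt0 (divr_gt0 eta0 (ltr0Sn R 1)) p0).
exists del => // s t hs ht hst x; rewrite !EE//.
have w0 := w1_ge0 (Pf hs) (Pf ht).
have wle := hdel s t hs ht hst; rewrite ler_pdivlMr// in wle.
have lamI : 0 < lam <= 2^-1 by rewrite lam0.
have h1 := conv_W'_sup_stability x (Pf hs) (Pf ht) (hM s hs) (hM t ht) lamI.
have h2 := is_Uhat_stability x (Pf hs) (Pf ht) eps0 (hU hs) (hU ht).
rewrite field_diff.
rewrite (le_trans (ler_normB _ _))// normrN normrM (ger0_norm y0).
apply: (le_trans (lerD (ler_wpM2l y0 h1) h2)).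
apply: (@le_trans _ _ (q * lam + w1 (f s) (f t) * p)); last first.
  by rewrite [leRHS]splitr lerD.
have -> : q * lam + w1 (f s) (f t) * p = y * (2 * (1 + M) * lam + w1 (f s) (f t) / lam) +
   (eps ^+ 4)^-1 * expU eps * w1 (f s) (f t) + (lam + w1 (f s) (f t)).
  by rewrite /q /p; ring.
by rewrite lerDl addr_ge0// ltW.
Qed.

(** The field may be discontinuous in [x], so continuity of the curve for [w1] does not apply
    directly. With [saw n] in place of [W'] the integrals are controlled by [w1] along the curve,
    hence measurable in time, and they converge pointwise to the wanted one. *)
Lemma solution_flux_measurable : w1_unif_cont T f -> forall g, plipb g ->
  measurable_fun `[0, T] (fun t => \int[f t]_z (E t z.1 * g z)).
Proof.
move=> cf g hg; have bg := plipb_bmeas hg; have [mg _] := bg.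
have [[Lg Lg0 [pg lg]] [Cg hCg]] := hg.
have Cg0 : 0 <= Cg by apply: le_trans (hCg (0, 0)).
pose K n t x := - (y * conv (f t) (saw n) x) - derive1 (U t) x.
pose KB := y * 2^-1 + y * expU eps.
have KB0 : 0 <= KB by rewrite addr_ge0// mulr_ge0.
have mK n t : 0 <= t <= T -> measurable_fun setT (K n t).
  move=> ht; apply: measurable_funB; last exact: derive_Uhat_measurable.
  apply: measurableT_comp => //; apply: measurable_funM; first exact: measurable_cst.
  apply: continuous_measurable_fun => x.
  have h := is_derive_conv_saw (f t) n x.
  by apply: differentiable_continuous; apply/derivable1_diffP; case: h.
have bK n t x : 0 <= t <= T -> `|K n t x| <= KB.
  move=> ht; rewrite (le_trans (ler_normB _ _))// lerD//.
    rewrite normrN normrM ger0_norm// ler_wpM2l//.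
    by apply: conv_bound; [exact: saw_measurable|exact: saw_bound].
  by apply: is_Uhat_derive_bound (hU ht) => //; exact: Pf.
apply: (@measurable_fun_cvg _ _ _ _ (fun n t => \int[f t]_z (K n t z.1 * g z))).
- move=> n; have [L L0 lS] := saw_lipschitz (R := R) n.
  pose LK := y * L + y * expU eps.
  have LK0 : 0 <= LK by rewrite addr_ge0// mulr_ge0.
  have lK t : 0 <= t <= T -> forall x x', `|K n t x - K n t x'| <= LK * `|x - x'|.
    move=> ht x x'.
    have h1 := is_Uhat_derive_lipschitz (Pf ht) eps0 (hU ht) x x'.
    have h2 := conv_lipschitz (f t) (saw_measurable n) (saw_bound n) lS x x'.
    rewrite /K field_diff.
    rewrite (le_trans (ler_normB _ _))// normrN normrM (ger0_norm y0) mulrDl lerD//.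
    by rewrite -mulrA ler_wpM2l.
  have pK t : 0 <= t <= T -> periodic (K n t) 1.
    move=> ht x; have [d1 _] := is_Uhat_derive (hU ht); have [pU _ _ _] := hU ht.
    by rewrite /K (conv_periodic (f t) (saw_periodic n)) (periodic_derive d1 pU).
  have KtK s t x : 0 <= s <= T -> 0 <= t <= T ->
      `|K n s x - K n t x| <= (y * L + (eps ^+ 4)^-1 * expU eps) * w1 (f s) (f t).
    move=> hs ht.
    have h1 := conv_w1 x (Pf hs) (Pf ht) L0 (saw_periodic n) lS.
    have h2 := is_Uhat_stability x (Pf hs) (Pf ht) eps0 (hU hs) (hU ht).
    rewrite /K field_diff.
    rewrite (le_trans (ler_normB _ _))// normrN normrM (ger0_norm y0) mulrDl lerD//.
    by rewrite -mulrA ler_wpM2l.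
  have bKg t : 0 <= t <= T -> bmeas (fun z => K n t z.1 * g z).
    move=> ht; apply: bmeasM => //; split; last by exists KB => z; exact: bK.
    exact: (measurableT_comp (mK n t ht) measurable_fst).
  apply: (@curve_measurable _ _ _ Pf cf _ ((KB * Lg + Cg * LK) +
    (y * L + (eps ^+ 4)^-1 * expU eps) * Cg)) => s t hs ht.
  have w0 := w1_ge0 (Pf hs) (Pf ht).
  have pKg : plip (KB * Lg + Cg * LK) (fun z => K n s z.1 * g z).
    split=> [v x /=|z w]; first by rewrite (pK s hs) (pg v x).
    rewrite (_ : K n s z.1 * g z - K n s w.1 * g w =
      K n s z.1 * (g z - g w) + g w * (K n s z.1 - K n s w.1)); last by ring.
    rewrite (le_trans (ler_normD _ _))// !normrM mulrDl -!mulrA lerD// ler_pM//; first exact: bK.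
    by rewrite (le_trans (lK s hs _ _))// ler_wpM2l// euclidean_dist_ge1.
  have h1 := w1_norm (addr_ge0 (mulr_ge0 KB0 Lg0) (mulr_ge0 Cg0 LK0)) (Pf hs) (Pf ht) pKg.
  have bd := bmeasB (bKg s hs) (bKg t ht).
  rewrite -(subrKA (\int[f t]_z (K n s z.1 * g z))) (le_trans (ler_normD _ _))// mulrDl lerD//.
  rewrite -(RintegralB measurableT (bmeas_integrable measurableT (prob_lty _) (bKg s hs))
    (bmeas_integrable measurableT (prob_lty _) (bKg t ht))).
  have [mbd _] := bd.
  apply: (prob_norm_le _ mbd) => z; rewrite -mulrBl normrM mulrAC.
  by rewrite ler_pM// KtK.
move=> t; rewrite /= in_itv/= => ht.
apply: (Rintegral_cvg measurableT (prob_lty (f t)) (C := KB * Cg)).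
- move=> n; apply: measurable_funM => //.
  exact: (measurableT_comp (mK n t ht) measurable_fst).
- apply: measurable_funM => //.
  exact: (measurableT_comp (solution_field_measurable ht) measurable_fst).
- by move=> n z _; rewrite normrM ler_pM// bK.
move=> z _; apply: cvgM; last exact: cvg_cst.
rewrite EE//; apply: cvgB; last exact: cvg_cst.
by apply: cvgN; apply: cvgM; [exact: cvg_cst|exact: cvg_conv_saw].
Qed.

Lemma solution_vlasov_curve : w1_unif_cont T f -> vlasov T f E ->
  vlasov_curve T (y * 2^-1 + y * expU eps) f E.
Proof.
move=> cf vf; split=> //; first exact: solution_field_measurable.
  by move=> t x ht; exact: solution_field_bound.
exact: solution_flux_measurable.
Qed.

End one_solution.

Lemma solution_field_stability f1 f2 U1 U2 t r : in_P1 (f1 t) -> in_P1 (f2 t) ->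
  is_Uhat eps (xmarginal (f1 t)) (U1 t) -> is_Uhat eps (xmarginal (f2 t)) (U2 t) ->
  dens_le (f1 t) r ->
  \int[f2 t]_z `|solution_field f1 U1 t z.1 - solution_field f2 U2 t z.1| <=
  ((eps ^+ 4)^-1 * expU eps + 2 * y * r) * w1 (f1 t) (f2 t).
Proof.
move=> p1 p2 h1 h2 hr.
have L1 := is_Uhat_derive_lipschitz p1 eps0 h1; have L2 := is_Uhat_derive_lipschitz p2 eps0 h2.
pose G (z : R * R) : R := `|conv (f1 t) (@W' R) z.1 - conv (f2 t) (@W' R) z.1|.
have bW f : bmeas (fun z : R * R => conv f (@W' R) z.1).
  split; last by exists 2^-1 => z; exact: conv_W'_bound.
  exact: (measurableT_comp (conv_W'_measurable f) measurable_fst).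
have bU f u : in_P1 f -> is_Uhat eps (xmarginal f) u -> bmeas (fun z : R * R => derive1 u z.1).
  move=> p hu; split; last by exists (y * expU eps) => z; exact: is_Uhat_derive_bound p eps0 hu.
  apply: measurableT_comp measurable_fst; apply: continuous_measurable_fun.
  exact: lipschitz_continuous (is_Uhat_derive_lipschitz p eps0 hu).
have bN f : bmeas f -> bmeas (fun z : R * R => `|f z| : R).
  by move=> [mf [C hC]]; split; [exact: measurableT_comp|exists C => z; rewrite normr_id].
have bG : bmeas G by apply: bN; apply: bmeasB.
have bE : bmeas (fun z : R * R => solution_field f1 U1 t z.1 - solution_field f2 U2 t z.1).
  have := bmeasB (bmeasB (bmeasZ (- y) (bW (f1 t))) (bU _ _ p1 h1))
     (bmeasB (bmeasZ (- y) (bW (f2 t))) (bU _ _ p2 h2)).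
  by congr bmeas; apply/funext => z; rewrite /solution_field !EbarE// !mulNr.
pose k := (eps ^+ 4)^-1 * expU eps * w1 (f1 t) (f2 t).
have i1 := bmeas_integrable measurableT (prob_lty (f2 t)) (bN _ bE).
have bk : bmeas (fun _ : R * R => k) by exact: bmeas_cst.
have i2 := bmeas_integrable measurableT (prob_lty (f2 t)) (bmeasZ y bG).
have i3 := bmeas_integrable measurableT (prob_lty (f2 t)) bk.
have i4 := bmeas_integrable measurableT (prob_lty (f2 t)) bG.
apply: (@le_trans _ _ (\int[f2 t]_z (y * G z + k))).
  apply: (le_Rintegral measurableT i1 (integrable_add measurableT i2 i3)) => z _.
  rewrite /solution_field !EbarE// -/y.
  rewrite field_diff.
  rewrite (le_trans (ler_normB _ _))// normrN normrM (ger0_norm y0) lerD2l.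
  exact: is_Uhat_stability.
rewrite (RintegralD measurableT i2 i3) (RintegralZl y measurableT i4) prob_cst.
have := ler_wpM2l y0 (conv_W'_stability p1 p2 hr).
rewrite -/G /k; lra.
Qed.

(** Compactness of [[0, T]] makes the local moduli uniform, in the manner of a Lebesgue number. *)
Lemma solution_w1_unif_cont f : (forall t, 0 <= t <= T -> in_P1 (f t)) ->
  (forall s, 0 <= s <= T ->
    (fun t => W1 (f t) (f s)) @ within `[0, T] (nbhs s) --> 0%E) ->
  w1_unif_cont T f.
Proof.
move=> Pf cf eta eta0.
have loc s : 0 <= s <= T -> exists2 del, 0 < del & forall t, 0 <= t <= T ->
    `|s - t| < del -> w1 (f t) (f s) <= eta / 2.
  move=> hs; have e2 : 0 < eta / 2 by rewrite divr_gt0.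
  have /fine_cvgP[_ /cvgrPdist_le /(_ _ e2)] := cf s hs.
  rewrite near_withinE => /nbhs_ballP[del /= del0 hdel]; exists del => // t ht hst.
  have := hdel t hst; rewrite /= in_itv/= ht => /(_ isT).
  rewrite sub0r normrN; apply: le_trans; exact: ler_norm.
have nc : near_covering (`[0, T]%classic : set R).
  exact/compact_near_coveringP/segment_compact.
pose P (d x : R) := 0 <= x <= T -> forall t, 0 <= t <= T -> `|x - t| < d -> w1 (f x) (f t) <= eta.
suff h : \forall d \near (0 : R)^'+, `[0, T]%classic `<=` P d.
  have : \forall d \near (0 : R)^'+, 0 < d /\ `[0, T]%classic `<=` P d.
    by near=> d; split => //; near: d.
  move=> /filter_ex[d [d0 hd]]; exists d => // s t hs ht hst.
  by apply: (hd s) => //=; rewrite in_itv.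
apply: nc => x; rewrite /= in_itv/= => hx.
have [del del0 hdel] := loc x hx.
exists (ball x (del / 2), [set d | d < del / 2]) => /=.
  split; first by apply: nbhsx_ballx; rewrite divr_gt0.
  by apply: nbhs_right_lt; rewrite divr_gt0.
move=> [x' d] /= [hx' hd] hx'T t ht hxt.
have w1x : w1 (f x') (f x) <= eta / 2.
  by apply: hdel => //; rewrite (lt_trans hx')//; lra.
have w2x : w1 (f t) (f x) <= eta / 2.
  apply: hdel => //; rewrite -(subrKA x') (le_lt_trans (ler_normD _ _))//.
  by rewrite (splitr del) ltrD// (lt_trans hxt).
have := w1_triangle (Pf x' hx'T) (Pf x hx) (Pf t ht).
rewrite (w1_sym (Pf x hx) (Pf t ht)); lra.
Unshelve. all: by end_near. Qed.

End measure_solutions.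

(* The library's Lebesgue measure lives on [measurableTypeR R], a copy of [R]
   with the same measurable sets but another display; the identity transports
   it to [R], on which the marginals are defined. *)
Definition to_borel (R : realType) (x : measurableTypeR R) : R := x.

Lemma measurable_to_borel (R : realType) : measurable_fun setT (@to_borel R).
Proof. by move=> _ Y mY; rewrite setTI; exact: mY. Qed.

(** * Bounded densities *)

Section density.
Context {R : realType}.
Local Notation leb := (@lebesgue_measure R).
Local Notation prob := (probability (R * R)%type R).

Lemma density_measure_le (rho : probability R R) (p : R -> R) (N : R) :
  is_density rho p -> (Linfty_norm p <= N%:E)%E ->
  forall A : set (measurableTypeR R), measurable A -> A `<=` torus R ->
  (rho A <= N%:E * leb A)%E.
Proof.
move=> [mp hp] hN A mA At.
have N0 : (0 <= N%:E)%E by apply: le_trans hN; exact: Lnorm_ge0.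
(* The norm with infinite exponent unfolds to an essential supremum only for a measure of positive
   total mass. *)
have mE : (0 < mrestr leb (measurable_torus R) setT)%E.
  by rewrite /mrestr setTI torus_measure lte01.
move: hN; rewrite /Linfty_norm unlock mE => /ess_supP[C [mC C0 hC]].
have mpA : measurable_fun A p := measurable_funS (measurable_torus R) At mp.
rewrite hp// (le_trans (lee_abs _))//.
apply: (le_trans (le_abse_integral leb mA _)); first exact/measurable_EFinP.
rewrite -integral_cst//; apply: ae_ge0_le_integral => //.
  have mn : measurable_fun A (fun x => `|p x|) by exact: measurableT_comp.
  exact: (measurable_EFinP _ _).2 mn.
exists (C `&` torus R); split; [exact: (measurableI _ _ mC (measurable_torus R))|exact: C0|].
move=> x hx; have Ax : A x by apply: contrapT => nAx; apply: hx => /nAx.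
split; last exact: At.
by apply: hC => h; apply: hx => _.
Qed.

(** The kernel has integral one, so smoothing keeps the bound; and [1 <= N] because a total mass one
    is spread over a length one. *)
Lemma density_dens_le (mu : prob) (p : R -> R) (N : R) : in_P1 mu ->
  is_density (xmarginal mu) p -> (Linfty_norm p <= N%:E)%E ->
  dens_le mu N /\ 1 <= N.
Proof.
move=> Pmu hp hN; have hA := density_measure_le hp hN.
have N0 : 0 <= N by rewrite -lee_fin; apply: le_trans hN; exact: Lnorm_ge0.
have xm1 : xmarginal mu (torus R) = 1%E.
  have [h _] := Pmu; rewrite -h /xmarginal /distribution /pushforward; congr (mu _).
  by apply/seteqP; split => [z ?|z []//]; split.
have m1 := hA (torus R) mtorus (@subset_refl _ _).
rewrite xm1 torus_measure mule1 lee_fin in m1.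
split=> // n x.
have [K hK] := kap_bounded (R := R) n.
rewrite -(Rintegral_xmarginal x Pmu (kap_measurable n) hK).
have mk : measurable_fun setT (fun t : R => kap n (x - t)).
  by apply: (measurableT_comp (kap_measurable n)); exact: measurable_funB.
have e : (\int[leb]_(t in torus R) (kap n (x - t))%:E = 1)%E.
  have i : leb.-integrable (torus R) (EFin \o (fun t : R => kap n (x - t))).
    by apply: (@bounded_integrable _ _ _ leb _ mtorus torus_lty _ K) => //; exact: measurable_funTS.
  rewrite -(fineK (integrable_fin_num mtorus i)); congr EFin.
  transitivity (\int[leb]_(t in torus R) kap n (t + - x)).
    by apply: eq_Rintegral => t _; rewrite -(kap_even n (t + - x)) opprD opprK addrC.
  rewrite (torus_translation (- x) (kap_measurable n) hK (kap_periodic n)).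
  exact: kap_integral.
have le : (\int[xmarginal mu]_(t in torus R) (kap n (x - t))%:E <= N%:E)%E.
  (* An inequality between measures on the whole line is available, as the marginal does not charge
     the complement of the torus. *)
  have m12 S : measurable S -> (xmarginal mu S <= mscale (NngNum N0) (pushforward leb (@to_borel R)) S)%E.
    move=> mS; have mSt : measurable (S `&` torus R) by exact: (measurableI _ _ mS (measurable_torus R)).
    have mC : measurable (~` torus R) by exact: measurableC (measurable_torus R).
    apply: (@le_trans _ _ (xmarginal mu ((S `&` torus R) `|` ~` torus R))).
      apply: le_measure; rewrite ?inE//; first exact: measurableU.
      by move=> s Ss; have [h|h] := pselect (torus R s); [left|right].
    apply: (le_trans (measureU2 _ mSt mC)).
    have xC : xmarginal mu (~` torus R) = 0%E.
      by rewrite probability_setC ?xm1 ?subee//; exact: measurable_torus.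
    apply: (@le_trans _ _ (N%:E * leb (S `&` torus R) + 0)%E).
      apply: leeD; first by apply: hA => // s [].
      by rewrite le_eqVlt; apply/orP; left; apply/eqP; exact: xC.
    rewrite adde0.
    rewrite /mscale/= lee_wpmul2l// le_measure// ?inE//.
  have h0 (t : R) : (0 <= (kap n (x - t))%:E)%E by rewrite lee_fin kap_ge0.
  have mk' : measurable_fun setT (fun t : R => (kap n (x - t))%:E).
    by exact: (measurable_EFinP _ _).2 mk.
  apply: (le_trans (ge0_le_measure_integral (m12 (@measurable_to_borel R)) (measurable_torus R) h0 mk')).
  rewrite (ge0_integral_mscale _ (measurable_torus R))//; last exact: measurable_funTS.
  rewrite (ge0_integral_pushforward (@measurable_to_borel R) _ (measurable_torus R))//; last exact: measurable_funTS.
  by rewrite -[leRHS]mule1 -e.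
rewrite /Rintegral -lee_fin fineK//.
have ge : (0 <= \int[xmarginal mu]_(t in torus R) (kap n (x - t))%:E)%E.
  by apply: integral_ge0 => t _; rewrite lee_fin kap_ge0.
by rewrite ge0_fin_numE// (le_lt_trans le)// ltry.
Qed.

End density.

(** * A measurable substitute for the norm of the density *)

Section local_density.
Context {R : realType}.
Local Notation leb := (@lebesgue_measure R).
Local Notation prob := (probability (R * R)%type R).
Variables (T M : R) (f : R -> prob).
Hypotheses (T0 : 0 < T) (Pf : forall t, 0 <= t <= T -> in_P1 (f t)) (cf : w1_unif_cont T f).

(** For fixed [n] and [x] the smoothed density is continuous in time, so that an excess at [t] would
    persist on an interval of positive length. *)
Lemma dens_le_everywhere :
  {ae leb, forall t, 0 <= t <= T -> dens_le (f t) M} ->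
  forall t, 0 <= t <= T -> dens_le (f t) M.
Proof.
move=> [C [mC C0 hC]] t ht n x; rewrite leNgt; apply/negP => hlt.
have [L0 hL0] := kap_lipschitz (R := R) n.
pose L := `|L0| + 1.
have L1 : 0 < L by rewrite ltr_wpDl.
have hL u v : `|kap n u - kap n v| <= L * `|u - v|.
  by rewrite (le_trans (hL0 u v))// ler_wpM2r// (le_trans (ler_norm L0))// lerDl.
pose e := conv (f t) (kap n) x - M.
have e0 : 0 < e by rewrite subr_gt0.
have e2 : 0 < e / 2 / L by rewrite !divr_gt0.
have [del del0 hdel] := cf e2.
pose a := Num.max 0 (t - del / 2); pose b := Num.min T (t + del / 2).
have /andP[t0 tT] := ht.
have d2 : 0 < del / 2 by rewrite divr_gt0.
have ab : a < b.
  by rewrite lt_min !gt_max T0 /=; apply/andP; split; [|apply/andP; split]; lra.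
have : (leb `[a, b] <= leb C)%E.
  apply: (@le_measure _ _ _ leb); [by rewrite inE; exact: measurable_itv|by rewrite inE|].
  move=> s /=; rewrite in_itv/= /a /b ge_max le_min => /andP[/andP[s0 s1] /andP[s2 s3]].
  apply: hC => h; have hs : 0 <= s <= T by rewrite s0.
  have st : `|s - t| < del by rewrite ltr_norml; apply/andP; split; lra.
  have := hdel s t hs ht st; rewrite ler_pdivlMr// mulrC => w.
  have := conv_w1 x (Pf hs) (Pf ht) (ltW L1) (kap_periodic n) hL.
  have := h hs n x; move: w; rewrite ler_norml => w h1 /andP[h2 h3].
  move: e0 w h1 h2; rewrite /e; clear; lra.
rewrite C0 lebesgue_measure_itv/= lte_fin ab -EFinB lee_fin leNgt => /negP; apply.
by rewrite subr_gt0.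
Qed.

(** Countably many [n] and rational points suffice, by continuity of the smoothed densities, and
    give measurability in time. The floor 1 does not spoil the comparison with the norm, which is at
    least 1. *)
Definition sup_density (t : R) : R :=
  Num.max 1 (sups ((fun (k : nat) (s : R) =>
    if @unpickle (nat * rat)%type k is Some nq then conv (f s) (kap nq.1) (ratr nq.2) else 0) ^~ t) 0%N).

Hypotheses (M1 : 1 <= M) (hM : forall t, 0 <= t <= T -> dens_le (f t) M).

Let h (k : nat) (s : R) : R :=
  if @unpickle (nat * rat)%type k is Some nq then conv (f s) (kap nq.1) (ratr nq.2) else 0.

Let h_le k s N : 0 <= N -> dens_le (f s) N -> h k s <= N.
Proof. by move=> N0 hN; rewrite /h; case: unpickle => // nq; exact: hN. Qed.

Lemma sup_density_ge1 t : 1 <= sup_density t.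
Proof. by rewrite /sup_density le_max lexx. Qed.

Lemma sup_density_le t N : 1 <= N -> dens_le (f t) N -> sup_density t <= N.
Proof.
move=> N1 hN; rewrite /sup_density ge_max N1/=.
apply: ge_sup; first by exists (h 0%N t); exists 0%N.
by move=> _ [k _ <-]; apply: h_le => //; apply: le_trans N1.
Qed.

Lemma sup_density_dens_le t : 0 <= t <= T -> dens_le (f t) (sup_density t).
Proof.
move=> ht n x.
have rat_le q : conv (f t) (kap n) (ratr q) <= sup_density t.
  rewrite /sup_density le_max; apply/orP; right.
  apply: ub_le_sup.
    exists M => _ [k _ <-]; apply: h_le; last exact: hM.
    by apply: le_trans M1.
  exists (pickle (n, q)) => //; by rewrite pickleK.
have [L hL] := conv_kap_lipschitz (f t) n.
have L1 : 0 < `|L| + 1 by rewrite ltr_wpDl.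
apply/ler_addgt0Pr => e e0.
have eL : 0 < e / (`|L| + 1) by rewrite divr_gt0.
have xe : x < x + e / (`|L| + 1) by rewrite ltrDl.
have [q] := rat_in_itvoo xe.
rewrite in_itv/= => /andP[q1 q2].
have lq : `|x - ratr q| <= e / (`|L| + 1) by rewrite ler_norml; apply/andP; split; lra.
have := hL x (ratr q); rewrite ler_norml => /andP[_ h1].
have h2 : L * `|x - ratr q| <= e.
  apply: (@le_trans _ _ ((`|L| + 1) * `|x - ratr q|)).
    by rewrite ler_wpM2r// (le_trans (ler_norm L))// lerDl.
  by rewrite mulrC -ler_pdivlMr.
by rewrite -lerBlDl; apply: le_trans h2; apply: le_trans h1; rewrite lerD2l lerN2.
Qed.

Lemma sup_density_measurable : measurable_fun `[0, T] sup_density.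
Proof.
apply: measurable_maxr; first exact: measurable_cst.
apply: (measurable_fun_sups (h := h)).
  move=> t; rewrite /= in_itv/= => ht; exists M => _ [k _ <-]; apply: h_le; last exact: hM.
  by apply: le_trans M1.
move=> k; rewrite /h; case: unpickle => [[n q]|]; last exact: measurable_cst.
have [L hL] := kap_lipschitz (R := R) n.
have hL' u v : `|kap n u - kap n v| <= `|L| * `|u - v|.
  by rewrite (le_trans (hL u v))// ler_wpM2r// ler_norm.
apply: (curve_measurable Pf cf (L := `|L|)) => s t hs ht.
by apply: conv_w1 => //; [exact: Pf|exact: Pf|exact: kap_periodic].
Qed.

End local_density.

(** * Conclusion *)

Section final_estimates.
Context {R : realType}.
Local Notation leb := (@lebesgue_measure R).

(* The right-hand side may be non-measurable, so the comparison goes through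
   the simple functions below the integrands. *)
Lemma Rintegral_le_ae (r : R -> R) (L : R -> \bar R) (t M : R) :
  measurable_fun (`]0, t]%classic : set (measurableTypeR R)) r ->
  (forall s, 0 < s <= t -> 0 <= r s <= M) -> (forall s, (0 <= L s)%E) ->
  {ae leb, forall s, 0 <= s <= t -> ((r s)%:E <= L s)%E} ->
  ((\int[leb]_(s in `]0, t]) r s)%:E <= \int[leb]_(s in `[0%R, t]) L s)%E.
Proof.
move=> mr hr L0 [C [mC C0 hC]].
have mD : measurable (`]0, t]%classic : set (measurableTypeR R)) by exact: measurable_itv.
have r0 s : `]0, t]%classic s -> (0 <= (r s)%:E)%E.
  by rewrite /= in_itv/= => /hr/andP[h _]; rewrite lee_fin.
have i : leb.-integrable `]0, t] (EFin \o r).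
  apply: (@bounded_integrable _ _ _ leb _ mD (itvoc_lty 0 t) r M mr) => s.
  by rewrite /= in_itv/= => /hr/andP[h1 h2]; rewrite ger0_norm.
rewrite /Rintegral fineK; last exact: integrable_fin_num.
have mE : measurable_fun `]0, t]%classic (EFin \o r) := (measurable_EFinP _ _).2 mr.
rewrite (ge0_negligible_integral mC mD mE r0 C0).
rewrite ge0_integralE; last by move=> s [h _]; exact: r0.
rewrite [leRHS]ge0_integralE; last by move=> s _; exact: L0.
apply: ereal_sup_le => _ [h /= hle <-]; exists h => // s.
apply: (le_trans (hle s)); rewrite !patchE; case: ifPn => [|_]; last by case: ifP.
rewrite inE /= => -[]; rewrite in_itv/= => /andP[s0 st] nC.
have st' : 0 <= s <= t by rewrite st ltW.
rewrite mem_set/=; last by rewrite in_itv.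
by apply: contrapT => hn; apply: nC; apply: hC => hh; apply: hn; exact: hh.
Qed.

(** With [y = eps^-2 >= 1] and [g = expU eps], the left-hand side is
    [(1 + y) t + y g (1 + y) t + 3 y I]. As [t <= I], the last two terms are at most
    [y (g (1 + y) + 3) I], and the factor [g (1 + y) + 3] is below [e^(15 y / 2)]. *)
Lemma exponent_bound (eps t I : R) : 0 < eps <= 1 -> 0 <= t <= I ->
  t * (1 + (eps ^+ 2)^-1 * (1 + expU eps) + (eps ^+ 4)^-1 * expU eps) +
    ((eps ^+ 2)^-1 + 2 * (eps ^+ 2)^-1) * I <=
  eps^-1 * ((1 + 3 / eps ^+ 2) * t +
    (8 + (eps ^+ 2)^-1 * expR (15 / (2 * eps ^+ 2))) * I).
Proof.
move=> /andP[e0 e1] /andP[t0 tI].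
have I0 : 0 <= I by apply: le_trans tI.
have en0 : eps != 0 by rewrite gt_eqF.
rewrite /expU.
have -> : (eps ^+ 4)^-1 = (eps ^+ 2)^-1 * (eps ^+ 2)^-1 by field.
have -> : (8 * eps ^+ 2)^-1 = (eps ^+ 2)^-1 / 8 by field.
(* The split [15/2 = 1/8 + 1 + 51/8] produces the factors [g], [e^y >= 1 + y], and a third one that
   is at least 4. *)
have -> : 15 / (2 * eps ^+ 2) = (eps ^+ 2)^-1 / 8 + (eps ^+ 2)^-1 + 51 / 8 * (eps ^+ 2)^-1 by field.
have y1 : 1 <= (eps ^+ 2)^-1 by rewrite invf_ge1 ?exprn_gt0// exprn_ile1// ltW.
have k1 : 1 <= eps^-1 by rewrite invf_ge1.
move: (eps ^+ 2)^-1 y1 (eps^-1) k1 => y y1 k k1.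
have y0 : 0 <= y by apply: le_trans y1.
rewrite !expRD.
have g0 := expR_gt0 (y / 8); set g := expR (y / 8) in g0 *.
have g1 : 1 <= g by rewrite /g; apply: le_trans (expR_ge1Dx _); rewrite lerDl divr_ge0.
have p1 : 1 + y <= expR y := expR_ge1Dx y.
have q1 : 1 + 51 / 8 * y <= expR (51 / 8 * y) := expR_ge1Dx _.
move: (expR y) (expR (51 / 8 * y)) p1 q1 => p q p1 q1.
have q4 : 4 <= q by lra.
have gp1 : 1 <= g * p by rewrite -[leLHS]mulr1 ler_pM//; lra.
have h1 : g * (1 + y) <= g * p by rewrite ler_wpM2l// ltW.
have h2 : 4 * (g * p) <= g * p * q by rewrite mulrC ler_wpM2l//; lra.
have h3 : g * (1 + y) + 3 <= g * p * q by lra.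
set Q := (1 + 3 * y) * t + _.
have Q0 : 0 <= Q.
  apply: addr_ge0; apply: mulr_ge0 => //; first by lra.
  apply: addr_ge0 => //; apply: mulr_ge0 => //; lra.
apply: (@le_trans _ _ Q); last by rewrite ler_peMl.
have h4 : y * I * (g * (1 + y) + 3) <= y * I * (g * p * q).
  by rewrite ler_wpM2l// mulr_ge0.
have h5 : y * (g * (1 + y)) * t <= y * (g * (1 + y)) * I.
  by rewrite ler_wpM2l//; apply: mulr_ge0 => //; apply: mulr_ge0; lra.
have yt : 0 <= y * t by rewrite mulr_ge0.
rewrite /Q; move: h4 h5; set w := g * p * q; lra.
Qed.

End final_estimates.

Unset Implicit Arguments.

Theorem theorem1p9 (R : realType) (T eps : R)
    (f1 f2 : R -> probability (R * R)%type R) (rho1 : R -> R -> R) :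
  0 < T -> 0 < eps <= 1 ->
  measure_solution T eps f1 -> measure_solution T eps f2 ->
  Linfty_density T f1 rho1 ->
  forall t, 0 <= t <= T ->
  (W1 (f1 t) (f2 t) <=
     (eps^-1)%:E *
     expeR ((eps^-1)%:E *
       (((1 + 3 / eps ^+ 2) * t)%:E +
        (8 + (eps ^+ 2)^-1 * expR (15 / (2 * eps ^+ 2)))%:E *
        \int[lebesgue_measure]_(tau in `[0%R, t]) Linfty_norm (rho1 tau))) *
     W1 (f1 0%R) (f2 0%R))%E.
Proof.
move=> T0 he [P1 C1 [U1 [hU1 v1]]] [P2 C2 [U2 [hU2 v2]]] [M0 [Z [mZ Z0 hZ]]] t ht.
have /andP[eps0 eps1] := he; have /andP[t0 tT] := ht.
have c1 := solution_w1_unif_cont P1 C1; have c2 := solution_w1_unif_cont P2 C2.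
pose M := Num.max 1 M0.
have M1 : 1 <= M by rewrite le_max lexx.
have hM : forall s, 0 <= s <= T -> dens_le (f1 s) M.
  apply: (dens_le_everywhere T0 P1 c1); exists Z; split=> // s hn.
  apply: hZ => hs; apply: hn => hsT.
  have [hd hL] := hs hsT; have [h _] := density_dens_le (P1 s hsT) hd hL.
  by move=> n x; rewrite (le_trans (h n x))// le_max lexx orbT.
have V1 := solution_vlasov_curve eps0 P1 hU1 c1 v1.
have V2 := solution_vlasov_curve eps0 P2 hU2 c2 v2.
pose r := sup_density f1.
have hr s : 0 <= s <= T -> dens_le (f1 s) (r s) := @sup_density_dens_le _ _ _ _ M1 hM s.
have mr : measurable_fun `[0, T] r := sup_density_measurable P1 c1 M1 hM.
have r1 s : 1 <= r s := sup_density_ge1 f1 s.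
have rM s : 0 <= s <= T -> r s <= M by move=> hs; apply: sup_density_le M1 (hM s hs).
have r0 s : 0 <= s <= T -> 0 <= r s by move=> _; exact: le_trans (r1 s).
have y0 : 0 <= (eps ^+ 2)^-1 by rewrite invr_ge0 sqr_ge0.
have eU0 : 0 <= expU eps := expR_ge0 _.
have z0 : 0 <= (eps ^+ 4)^-1 * expU eps.
  by rewrite mulr_ge0// invr_ge0 exprn_ge0// ltW.
have B0 : 0 <= (eps ^+ 2)^-1 * 2^-1 + (eps ^+ 2)^-1 * expU eps.
  by rewrite addr_ge0// mulr_ge0.
have l00 : 0 <= (eps ^+ 2)^-1 * (1 + expU eps) by rewrite mulr_ge0// addr_ge0.
have c10 : 0 <= 2 * (eps ^+ 2)^-1 by rewrite mulr_ge0.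
have stab := w1_stability B0 l00 y0 z0 c10 V1 V2
  (fun s hs => solution_field_periodic P1 hU1 hs)
  (fun s hs => solution_field_lipschitz eps0 P1 hU1 hs (hr s hs))
  (solution_field_modulus eps0 P1 hU1 c1 (le_trans ler01 M1) hM)
  (fun s hs => solution_field_stability eps0 (P1 s hs) (P2 s hs) (hU1 s hs) (hU2 s hs) (hr s hs))
  mr r0 rM T0 ht.
have h0 : 0 <= (0 : R) <= T by rewrite lexx ltW.
have D0 := w1_ge0 (P1 0 h0) (P2 0 h0).
have sub : `]0, t]%classic `<=` (`[0, T]%classic : set R).
  by move=> s /=; rewrite !in_itv/= => /andP[s0 st]; rewrite (ltW s0) (le_trans st tT).
have mrt : measurable_fun (`]0, t]%classic : set (measurableTypeR R)) r.
  by apply: measurable_funS mr; [exact: measurable_itv|exact: sub].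
(* The floor 1 of [r] supplies the hypothesis [t <= I] of [exponent_bound]. *)
have tm : t <= mass r 0 t.
  rewrite -[leLHS]subr0 -[leLHS]mul1r -(Rintegral_itvoc_cst 1 t0).
  have ib (g : R -> R) (K : R) : measurable_fun (`]0, t]%classic : set (measurableTypeR R)) g ->
      (forall s, 0 <= s <= T -> `|g s| <= K) -> (@lebesgue_measure R).-integrable `]0, t] (EFin \o g).
    move=> mg hg; apply: (@bounded_integrable _ _ _ (@lebesgue_measure R) _ (measurable_itv _) (itvoc_lty 0 t) g K mg) => s.
    by move=> /sub; rewrite /= in_itv/=; exact: hg.
  apply: le_Rintegral.
  - exact: measurable_itv.
  - by apply: (ib (fun=> 1) 1) => [|s _]; [exact: measurable_cst|rewrite normr1].
  - by apply: (ib r M) => // s hs; rewrite ger0_norm ?r0// rM.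
  - by move=> s _; exact: r1.
(* For almost every time the norm is itself an admissible bound in [density_dens_le], and hence
   dominates [r]. *)
have hJ : ((mass r 0 t)%:E <=
    \int[lebesgue_measure]_(tau in `[0%R, t]) Linfty_norm (rho1 tau))%E.
  apply: (@Rintegral_le_ae _ _ _ _ M mrt) => [s /andP[s0 st]|s|].
  - by have hs : 0 <= s <= T by [rewrite (ltW s0) (le_trans st tT)]; rewrite r0// rM.
  - exact: Lnorm_ge0.
  exists Z; split=> // s hn; apply: hZ => hs; apply: hn => /andP[s0 st].
  have hsT : 0 <= s <= T by rewrite s0 (le_trans st tT).
  have [hd hL] := hs hsT.
  have L0 : (0 <= Linfty_norm (rho1 s))%E by exact: Lnorm_ge0.
  have Lf : Linfty_norm (rho1 s) \is a fin_num.
    by rewrite ge0_fin_numE// (le_lt_trans hL)// ltry.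
  have LE : (Linfty_norm (rho1 s) <= (fine (Linfty_norm (rho1 s)))%:E)%E by rewrite fineK.
  have [h1 h2] := density_dens_le (P1 s hsT) hd LE.
  by rewrite -(fineK Lf) lee_fin sup_density_le.
rewrite (W1_fin (P1 t ht) (P2 t ht)) (W1_fin (P1 0 h0) (P2 0 h0)).
set A := (1 + 3 / eps ^+ 2) * t.
set K := 8 + _.
have K0 : 0 <= K by rewrite addr_ge0// mulr_ge0// expR_ge0.
have e0 : 0 <= eps^-1 by rewrite invr_ge0 ltW.
apply: (@le_trans _ _ ((eps^-1)%:E * expeR ((eps^-1)%:E * (A%:E + K%:E * (mass r 0 t)%:E)) *
    (w1 (f1 0) (f2 0))%:E)%E); last first.
  apply: lee_wpmul2r; first by rewrite lee_fin.
  apply: lee_wpmul2l; first by rewrite lee_fin.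
  rewrite lee_expeR; apply: lee_wpmul2l; first by rewrite lee_fin.
  by apply: leeD => //; apply: lee_wpmul2l => //; rewrite lee_fin.
rewrite -(EFinM K) -(EFinD A) -(EFinM eps^-1 (A + _)) /= -!EFinM lee_fin.
apply: (le_trans stab); rewrite ler_wpM2r//.
have tI : 0 <= t <= mass r 0 t by rewrite t0.
apply: (@le_trans _ _ (expR (eps^-1 * (A + K * mass r 0 t)))).
  by rewrite ler_expR; exact: exponent_bound he tI.
by rewrite ler_peMl ?expR_ge0// invf_ge1.
Qed.
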